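(* Let $k$ be a field and $A$ a graded, square-free Hodge algebra over $k$ generated by a finite poset $H$ and governed by $\Sigma$. Suppose that $A$ is Cohen–Macaulay and that $\operatorname{core}A_{\rm dis}$ is Buchsbaum. Then $A_{\rm dis}$ is Cohen–Macaulay.
   Context: Let $H$ be a finite poset and $\Sigma$ an ideal of monomials on $H$ (set of monomials in elements of $H$ closed under multiplication by monomials); monomials not in $\Sigma$ are standard. A commutative $k$-algebra $A\supseteq H$ is a Hodge algebra generated by $H$ governed by $\Sigma$ if (i) the standard monomials form a $k$-basis of $A$, and (ii) for every minimal generator $\mu$ of $\Sigma$ with expansion $\mu=\sum_i r_i\mu_i$ ($0\ne r_i\in k$, $\mu_i$ standard), for every $i$ and every $x\in H$ dividing $\mu$, $\mu_i$ has a factor $y<x$. It is square-free if $\Sigma$ is generated by square-free monomials, and graded if $A=\bigoplus_{n\ge0}A_n$, $A_0=k$, with elements of $H$ homogeneous of positive degree. The discrete counterpart is $A_{\rm dis}=k[X_h:h\in H]/(\Sigma)$. Let $\operatorname{core}H$ be the union of the supports of the minimal generators of $\Sigma$, and $\operatorname{core}A_{\rm dis}=A_{\rm dis}/(X_h: h\in H\setminus\operatorname{core}H)$, i.e. $k[X_h:h\in\operatorname{core}H]$ modulo the monomials of $\Sigma$ supported in $\operatorname{core}H$. *)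

(* Defs.v *)
From HB Require Import structures.
From mathcomp Require Import all_boot all_order all_algebra.
From mathcomp Require Import mpoly.

Set Implicit Arguments.
Unset Strict Implicit.
Unset Printing Implicit Defensive.

Import Order.TTheory GRing.Theory.
Local Open Scope ring_scope.

(* Commutative algebra of a quotient ring  R / (B)  where B : R -> Prop is a  *)
(* set of generators of the defining ideal.  (For R itself take B = empty.)   *)
Section CommAlg.
Variable R : comNzRingType.

Definition ideal_gen (P : R -> Prop) (a : R) : Prop :=
  exists n (g c : 'I_n -> R), (forall i, P (g i)) /\ a = \sum_(i < n) c i * g i.

Definition is_ideal (P : R -> Prop) : Prop :=
  [/\ P 0, (forall a b, P a -> P b -> P (a + b)) & (forall a b, P b -> P (a * b))].

Definition prime_ideal (P : R -> Prop) : Prop :=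
  [/\ is_ideal P, ~ P 1 & forall a b, P (a * b) -> P a \/ P b].

Definition maximal_ideal (P : R -> Prop) : Prop :=
  [/\ is_ideal P, ~ P 1 &
      forall Q, is_ideal Q -> ~ Q 1 -> (forall a, P a -> Q a) -> forall a, Q a -> P a].

Definition gens (B : R -> Prop) k (x : 'I_k -> R) (i : nat) : R -> Prop :=
  fun a => B a \/ exists j : 'I_k, (j < i)%N /\ a = x j.

(* the (image of the) prime/maximal ideals of R/(B): those of R containing B *)
Definition over (B : R -> Prop) (P : R -> Prop) := forall a, B a -> P a.

Definition prime_chain (B : R -> Prop) (n : R -> Prop) (h : nat) : Prop :=
  exists P : 'I_h.+1 -> (R -> Prop),
    [/\ forall i, prime_ideal (P i) /\ over B (P i),
        (forall a, P ord_max a <-> n a) &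
        forall i j : 'I_h.+1, (i < j)%N ->
          (forall a, P i a -> P j a) /\ exists a, P j a /\ ~ P i a].

(* height of n in R/(B) (= Krull dimension of the localization at n) *)
Definition height (B : R -> Prop) (n : R -> Prop) (h : nat) : Prop :=
  prime_chain B n h /\ forall h', prime_chain B n h' -> (h' <= h)%N.

(* membership of a/1 in the extension of the ideal (Q) to the localization *)
(* R_n, i.e. s * a \in (Q) for some s outside n                           *)
Definition locmem (n Q : R -> Prop) (a : R) : Prop :=
  exists s, ~ n s /\ ideal_gen Q (s * a).

Definition loc_regular (B n : R -> Prop) k (x : 'I_k -> R) : Prop :=
  (forall i, n (x i)) /\
  forall (i : 'I_k) a, locmem n (gens B x i) (x i * a) -> locmem n (gens B x i) a.

Definition loc_sop (B n : R -> Prop) k (x : 'I_k -> R) : Prop :=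
  [/\ height B n k, (forall i, n (x i)) &
      forall P, prime_ideal P -> over (gens B x k) P -> (forall a, P a -> n a) ->
        forall a, n a -> P a].

Definition loc_weak (B n : R -> Prop) k (x : 'I_k -> R) : Prop :=
  forall (i : 'I_k) a, locmem n (gens B x i) (x i * a) ->
    forall y, n y -> locmem n (gens B x i) (y * a).

Definition CohenMacaulay (B : R -> Prop) : Prop :=
  forall n, maximal_ideal n -> over B n ->
    exists h, height B n h /\ exists x : 'I_h -> R, loc_regular B n x.

(* R/(B) is Buchsbaum: for every maximal ideal n, every system of parameters *)
(* of the localization at n is a weak sequence (Stueckrad-Vogel)            *)
Definition Buchsbaum (B : R -> Prop) : Prop :=
  forall n, maximal_ideal n -> over B n ->
    exists h, height B n h /\ forall x : 'I_h -> R, loc_sop B n x -> loc_weak B n x.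

End CommAlg.

Section Hodge.
Variables (d : Order.disp_t) (H : finPOrderType d).

Definition monom := {ffun H -> nat}.
Definition mmul (m m' : monom) : monom := [ffun h => (m h + m' h)%N].
Definition mdivides (m m' : monom) : Prop := forall h, (m h <= m' h)%N.

Definition monomial_ideal (Sigma : monom -> Prop) : Prop :=
  forall m m', Sigma m -> Sigma (mmul m m').

Definition standard (Sigma : monom -> Prop) (m : monom) : Prop := ~ Sigma m.

Definition min_gen (Sigma : monom -> Prop) (mu : monom) : Prop :=
  Sigma mu /\ forall nu, mdivides nu mu -> nu <> mu -> ~ Sigma nu.

Definition square_free_mon (m : monom) : Prop := forall h, (m h <= 1)%N.

Definition square_free (Sigma : monom -> Prop) : Prop :=
  forall m, Sigma m -> exists g, [/\ Sigma g, square_free_mon g & mdivides g m].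

Definition core (Sigma : monom -> Prop) (h : H) : Prop :=
  exists mu, min_gen Sigma mu /\ (0 < mu h)%N.

Variables (k : fieldType) (A : comAlgType k) (emb : H -> A).

Definition evalA (m : monom) : A := \prod_(h : H) emb h ^+ m h.

Definition hodge_algebra (Sigma : monom -> Prop) : Prop :=
  [/\ injective emb,
      monomial_ideal Sigma,
      (forall a : A, exists n (mu : 'I_n -> monom) (c : 'I_n -> k),
          (forall i, standard Sigma (mu i)) /\ a = \sum_(i < n) c i *: evalA (mu i)),
      (forall n (mu : 'I_n -> monom) (c : 'I_n -> k), injective mu ->
          (forall i, standard Sigma (mu i)) ->
          \sum_(i < n) c i *: evalA (mu i) = 0 -> forall i, c i = 0) &
      (forall mu, min_gen Sigma mu ->
        forall n (nu : 'I_n -> monom) (r : 'I_n -> k), injective nu ->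
          (forall i, standard Sigma (nu i)) ->
          evalA mu = \sum_(i < n) r i *: evalA (nu i) ->
          forall i, r i != 0 -> forall x, (0 < mu x)%N ->
            exists y, (0 < nu i y)%N /\ (y < x)%O)].

Definition graded_hodge (G : nat -> A -> Prop) : Prop :=
  [/\ forall n, G n 0 /\ (forall a b, G n a -> G n b -> G n (a + b)) /\
                (forall (c : k) a, G n a -> G n (c *: a)),
      (forall m n a b, G m a -> G n b -> G (m + n)%N (a * b)),
      (forall a, exists N (f : 'I_N -> A), (forall i : 'I_N, G i (f i)) /\ a = \sum_i f i),
      (forall N (f : 'I_N -> A), (forall i : 'I_N, G i (f i)) -> \sum_i f i = 0 ->
          forall i, f i = 0) &
      (forall a, G 0 a <-> exists c : k, a = c%:A)] /\
  (forall h, exists n, (0 < n)%N /\ G n (emb h)).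

End Hodge.

(* The polynomial ring k[X_h : h \in H], the variable X_h being 'X_(enum_rank h) *)
Definition polyH (k : fieldType) (d : Order.disp_t) (H : finPOrderType d) :=
  {mpoly k[#|H|]}.

Definition Xmon (k : fieldType) d (H : finPOrderType d) (m : monom H) : polyH k H :=
  \prod_(h : H) 'X_(enum_rank h) ^+ m h.
Arguments Xmon k {d H} m.

(* generators of the ideal (Sigma) defining A_dis = k[X_h]/(Sigma) *)
Definition dis_gens (k : fieldType) d (H : finPOrderType d) (Sigma : monom H -> Prop)
  : polyH k H -> Prop :=
  fun p => exists m, Sigma m /\ p = Xmon k m.
Arguments dis_gens k {d H} Sigma p.

(* generators of the ideal defining core A_dis = A_dis / (X_h : h \notin core H) *)
Definition core_gens (k : fieldType) d (H : finPOrderType d) (Sigma : monom H -> Prop)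
  : polyH k H -> Prop :=
  fun p => dis_gens k Sigma p \/ exists h, ~ core Sigma h /\ p = 'X_(enum_rank h).
Arguments core_gens k {d H} Sigma p.

(* Main.v *)
Require Import Defs.
From HB Require Import structures.
From mathcomp Require Import all_boot all_order all_algebra.
From mathcomp Require Import perm mpoly.
From mathcomp Require Import zify ring.
From mathcomp Require boolp classical_sets.

(** The relations of A raise a suitable weight on monomials, so A degenerates to
    A_dis: it carries a filtration whose associated graded ring is A_dis. Let H_q
    be the Koszul homology with respect to the generators X_h, |H| - q being the
    cohomological degree. Write d for the dimension of A_dis. If A_dis is not
    Cohen-Macaulay, some H_q(A_dis) with q > |H| - d is nonzero; take q maximal.
    The homology of a square-free monomial quotient lives in multidegrees at
    most the indicator 1_core of the core, and the Buchsbaum property (systems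
    of parameters are weak sequences) excludes every multidegree but 1_core
    itself. This is the top weight of the homology, so a class there lifts to a
    cycle over A, the obstructions having larger weight. As A is Cohen-Macaulay
    this cycle is a boundary over A, and since H_(q+1)(A_dis) = 0 the bounding
    chain can be pushed up to the weight of the class, which therefore vanishes.

    Hence the elementary symmetric polynomials in the core variables, a weak
    sequence on the core, form a regular sequence, and so do their powers. At an
    arbitrary maximal ideal n, Zariski's lemma provides elements of n whose top
    forms are such powers, together with powers of the variables off the core;
    these elements form a regular sequence of length d in n. *)

Set Implicit Arguments.
Unset Strict Implicit.
Unset Printing Implicit Defensive.

Import Order.TTheory GRing.Theory.
Local Open Scope ring_scope.

(** The two ends of the weight scale need different inputs. A multidegree heavier than 1_core
    exceeds it in some coordinate, where a homotopy divided by a variable kills the homology.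
    Lighter multidegrees are controlled only by the vanishing of H_(q+1), hence the choice of q
    maximal. The weight comes from the Hodge axiom: when lower poset elements weigh exponentially
    more, one factor y < x outweighs a whole square-free generator containing no element heavier
    than x. The relations are homogeneous, so weights are bounded in each degree and successive
    corrections terminate. The Buchsbaum hypothesis enters through squares: parameters of degree at
    least two lie in the ideal where X_g is replaced by its square, and comparing the two Koszul
    complexes excludes multidegrees vanishing at g. Dimensions are compared by counting alone:
    standard monomials on a largest face are independent in A, so dim A_dis is at most the height of
    the irrelevant ideal of A. Finally, Cohen-Macaulayness concerns every maximal ideal, whose
    residue field may be a proper extension of k; top forms replace a translation to the origin. *)

Local Notation over := Defs.over.

(** * Ideals, primes and localization *)

Section Ideals.
Variable R : comNzRingType.
Implicit Types (P J W n : R -> Prop) (a b u : R).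

Lemma idealN J a : is_ideal J -> J a -> J (- a).
Proof. by case=> _ _ JM Ja; rewrite -mulN1r; apply: JM. Qed.

Lemma idealB J a b : is_ideal J -> J a -> J b -> J (a - b).
Proof. by move=> iJ Ja Jb; case: (iJ) => _ + _; apply=> //; apply: idealN. Qed.

Lemma ideal_sum J (I : Type) (r : seq I) (Q : pred I) (F : I -> R) :
  is_ideal J -> (forall i, Q i -> J (F i)) -> J (\sum_(i <- r | Q i) F i).
Proof. by case=> J0 JD _ JF; elim/big_ind: _ => // *; apply: JD. Qed.

Lemma ideal_gen_mem P a : P a -> ideal_gen P a.
Proof.
by exists 1%N, (fun=> a), (fun=> 1); split=> //; rewrite big_ord1 mul1r.
Qed.

Lemma ideal_gen_ideal P : is_ideal (ideal_gen P).
Proof.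
split.
- by exists 0%N, (fun=> 0), (fun=> 0); split=> [[]|] //; rewrite big_ord0.
- move=> _ _ [n1 [g1 [c1 [P1 ->]]]] [n2 [g2 [c2 [P2 ->]]]].
  exists (n1 + n2)%N.
  exists (fun i => match split i with inl j => g1 j | inr j => g2 j end).
  exists (fun i => match split i with inl j => c1 j | inr j => c2 j end).
  split; first by move=> i; case: split.
  rewrite big_split_ord /=; congr (_ + _); apply: eq_bigr => i _.
  + by case: split_ordP => j /eqP; rewrite ?eq_lshift ?eq_lrshift // => /eqP->.
  + by case: split_ordP => j /eqP; rewrite ?eq_rshift ?eq_rlshift // => /eqP->.
- move=> a _ [n1 [g1 [c1 [P1 ->]]]]; exists n1, g1, (fun i => a * c1 i).
  by split=> //; rewrite mulr_sumr; apply: eq_bigr => i _; rewrite mulrA.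
Qed.

Lemma ideal_gen_sub P J : is_ideal J -> over P J -> over (ideal_gen P) J.
Proof.
move=> iJ PJ _ [n1 [g1 [c1 [P1 ->]]]]; apply: ideal_sum => // i _.
by case: iJ => _ _; apply; apply: PJ.
Qed.

Lemma ideal_gen_mono P P' : over P P' -> over (ideal_gen P) (ideal_gen P').
Proof.
move=> PP'; apply: ideal_gen_sub; first exact: ideal_gen_ideal.
by move=> a /PP'; apply: ideal_gen_mem.
Qed.

Lemma ideal_genU1 P u a :
  ideal_gen (fun b => P b \/ b = u) a <-> exists c, ideal_gen P (a - c * u).
Proof.
have iP := ideal_gen_ideal P; have [P0 PD PM] := iP.
split; last first.
  have [_ D M] := ideal_gen_ideal (fun b => P b \/ b = u).
  case=> c h; rewrite -(subrK (c * u) a); apply: D; last first.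
    by apply: M; apply: ideal_gen_mem; right.
  by apply: ideal_gen_mono h => b; left.
move: a; apply: ideal_gen_sub; first split.
- by exists 0; rewrite mul0r subr0.
- move=> a b [c hc] [c' hc']; exists (c + c').
  by rewrite mulrDl opprD addrACA; apply: PD.
- by move=> a b [c hc]; exists (a * c); rewrite -mulrA -mulrBr; apply: PM.
- move=> b [Pb|->]; first by exists 0; rewrite mul0r subr0; apply: ideal_gen_mem.
  by exists 1; rewrite mul1r subrr.
Qed.

Lemma prime_idealX P a m : prime_ideal P -> P (a ^+ m) -> P a.
Proof.
case=> _ P1 Pp; elim: m => [|m IH]; first by rewrite expr0 => /P1.
by rewrite exprS => /Pp[].
Qed.

Lemma maximal_prime n : maximal_ideal n -> prime_ideal n.
Proof.
case=> iN N1 Nmax; split=> // a b nab.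
have [n0 nD nM] := iN.
case: (boolp.EM (n a)) => [|na]; [by left|right].
have iQ := ideal_gen_ideal (fun x => n x \/ x = a).
case: (boolp.EM (ideal_gen (fun x => n x \/ x = a) 1)) => [/ideal_genU1[c h]|Q1].
  have h' : n (1 - c * a) by apply: ideal_gen_sub h.
  rewrite -(mul1r b) -(subrK (c * a) 1) mulrDl; apply: nD.
    by rewrite mulrC; apply: nM.
  by rewrite -mulrA; apply: nM.
case: na; apply: (Nmax _ iQ) => //.
  by move=> x nx; apply: ideal_gen_mem; left.
by apply: ideal_gen_mem; right.
Qed.

Lemma maximal_inv n a : maximal_ideal n -> ~ n a -> exists b, n (a * b - 1).
Proof.
move=> mn na; have [iN N1 Nmax] := mn; have [n0 nD nM] := iN.
have iQ := ideal_gen_ideal (fun x => n x \/ x = a).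
case: (boolp.EM (ideal_gen (fun x => n x \/ x = a) 1)) => [/ideal_genU1[c h]|Q1].
  exists c; rewrite mulrC -opprB; apply: idealN => //.
  exact: ideal_gen_sub h.
case: na; apply: (Nmax _ iQ) => //.
  by move=> x nx; apply: ideal_gen_mem; left.
by apply: ideal_gen_mem; right.
Qed.

(** Zorn's lemma gives an ideal maximal among those containing J and disjoint from the
    multiplicative set W; such an ideal is prime. *)
Lemma prime_avoid J W : is_ideal J -> W 1 ->
  (forall a b, W a -> W b -> W (a * b)) -> (forall a, J a -> ~ W a) ->
  exists P, [/\ prime_ideal P, over J P & forall a, P a -> ~ W a].
Proof.
move=> iJ W1 WM JW.
pose good (X : R -> Prop) := [/\ is_ideal X, over J X & forall a, X a -> ~ W a].
pose T := {X : R -> Prop | good X}.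
pose t0 : T := exist good J (And3 iJ (fun a Ja => Ja) JW).
pose leT (X Y : T) : bool := boolp.asbool (over (sval X) (sval Y)).
have leTP X Y : leT X Y -> over (sval X) (sval Y) by move/boolp.asboolP.
have [| | |Pt Pmax] := @classical_sets.ZL_preorder T t0 leT.
- by move=> t; apply/boolp.asboolP.
- by move=> r s t /leTP rs /leTP st; apply/boolp.asboolP => a /rs /st.
- move=> A Atot.
  case: (boolp.EM (exists t, A t)) => [[t1 At1]|nA]; last first.
    by exists t0 => s As; case: nA; exists s.
  have gU : good (fun a => exists t, A t /\ sval t a).
    split; first split.
    - by exists t1; split=> //; case: (svalP t1) => [[]].
    - move=> a b [s [As sa]] [t [At tb]].
      have [_ sD _] : is_ideal (sval s) by case: (svalP s).
      have [_ tD _] : is_ideal (sval t) by case: (svalP t).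
      case: (Atot _ _ As At) => /leTP st.
        by exists t; split=> //; apply: tD => //; apply: st.
      by exists s; split=> //; apply: sD => //; apply: st.
    - move=> a b [t [At tb]]; exists t; split=> //.
      by case: (svalP t) => [[_ _ tM] _ _]; apply: tM.
    - by move=> a Ja; exists t1; split=> //; case: (svalP t1) => _ h _; apply: h.
    - by move=> a [t [At ta]]; case: (svalP t) => _ _; apply.
  exists (exist good _ gU) => s As; apply/boolp.asboolP => a sa /=.
  by exists s.
pose P := sval Pt; have [iP JP PW] : good P by exact: svalP.
have [P0 PD PM] := iP.
(* By maximality, adjoining x to P produces an element of W. For two elements outside P, the product
   of the corresponding w and w' is a multiple of a b modulo P. *)
have ext x : ~ P x -> exists w c, W w /\ P (w - c * x).
  move=> nPx; case: (boolp.EM (exists w c, W w /\ P (w - c * x))) => // nex.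
  have gQ : good (ideal_gen (fun b => P b \/ b = x)).
    split; first exact: ideal_gen_ideal.
      by move=> a Ja; apply: ideal_gen_mem; left; apply: JP.
    move=> a /ideal_genU1[c h] Wa; case: nex; exists a, c; split=> //.
    by apply: ideal_gen_sub h.
  have /leTP : leT (exist good _ gQ) Pt.
    by apply: Pmax; apply/boolp.asboolP => a Pa /=; apply: ideal_gen_mem; left.
  by move=> /= /(_ x) h; case: nPx; apply: h; apply: ideal_gen_mem; right.
exists P; split=> //; split=> //; first by move/PW; apply.
move=> a b Pab; case: (boolp.EM (P a)) => [|/ext[w [c [Ww Pw]]]]; first by left.
case: (boolp.EM (P b)) => [|/ext[w' [c' [Ww' Pw']]]]; first by right.
case: (PW (w * w')); last exact: WM.
have -> : w * w' = w' * (w - c * a) + c * a * (w' - c' * b) + c * c' * (a * b).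
  by ring.
by apply: (PD); [apply: (PD)|]; apply: (PM).
Qed.

Lemma locmem_gen n P a : prime_ideal n -> ideal_gen P a -> locmem n P a.
Proof. by case=> _ n1 _ Pa; exists 1; rewrite mul1r. Qed.

Lemma locmem_ideal n P : prime_ideal n -> is_ideal (locmem n P).
Proof.
move=> pn; have [iN n1 np] := pn; have [P0 PD PM] := ideal_gen_ideal P; split.
- exact: locmem_gen.
- move=> a b [s [ns ha]] [t [nt hb]]; exists (s * t); split.
    by move/np => [].
  by rewrite mulrDr {1}(mulrC s) -!mulrA; apply: PD; apply: PM.
- move=> a b [s [ns hb]]; exists s; split=> //.
  by rewrite mulrCA; apply: PM.
Qed.

Lemma locmem_cancel n P s a :
  prime_ideal n -> ~ n s -> locmem n P (s * a) -> locmem n P a.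
Proof.
move=> [_ _ np] ns [t [nt h]]; exists (t * s); split; last by rewrite -mulrA.
by move/np => [].
Qed.

Lemma locmem_sub n P Q : prime_ideal Q -> over P Q -> (forall a, Q a -> n a) ->
  over (locmem n P) Q.
Proof.
move=> pQ PQ Qn a [s [ns h]]; have [iQ _ Qp] := pQ.
by have /Qp[/Qn|] := ideal_gen_sub iQ PQ h.
Qed.

Lemma gens_over B n k (x : 'I_k -> R) i :
  over B n -> (forall j, n (x j)) -> over (gens B x i) n.
Proof. by move=> Bn xn a [/Bn|[j [_ ->]]]. Qed.

(* The prime below Q is one avoiding the multiplicative set {s u^m : s \notin Q},
   where u is the last element of the regular sequence; hence no minimal primes. *)
Lemma regular_chain_below B n k (x : 'I_k -> R) Q : prime_ideal n ->
  loc_regular B n x -> prime_ideal Q -> over (gens B x k) Q ->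
  (forall a, Q a -> n a) -> prime_chain B Q k.
Proof.
move=> pn [xn xreg] pQ oQ Qn; have [iN n1 np] := pn.
pose last_is (r : nat) (Q' : R -> Prop) := exists P : 'I_r.+1 -> (R -> Prop),
    [/\ forall i, prime_ideal (P i) /\ over B (P i),
        P ord_max = Q' &
        forall i j : 'I_r.+1, (i < j)%N ->
          (forall a, P i a -> P j a) /\ exists a, P j a /\ ~ P i a].
suff main i : (i <= k)%N -> forall Q', prime_ideal Q' -> over (gens B x i) Q' ->
    (forall a, Q' a -> n a) -> last_is i Q'.
  have [P [h1 h2 h3]] := main k (leqnn k) Q pQ oQ Qn.
  by exists P; split=> // a; rewrite h2.
elim: i => [|i IH] lik Q' pQ' oQ' Q'n.
  exists (fun=> Q'); split=> //; last by move=> i j; rewrite !ord1.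
  by move=> i; split=> // a Ba; apply: oQ'; left.
pose u := x (Ordinal lik).
have [iQ Q1 Qp] := pQ'.
have Ju : over (locmem n (gens B x i)) Q'.
  apply: locmem_sub => // a [Ba|[j [ji ->]]]; apply: oQ'; first by left.
  by right; exists j; split=> //; apply: ltnW.
have regX m a : locmem n (gens B x i) (u ^+ m * a) -> locmem n (gens B x i) a.
  elim: m => [|m IHm]; first by rewrite mul1r.
  rewrite exprS -mulrA => h; apply: IHm.
  exact: (xreg (Ordinal lik)).
have Qu : Q' u by apply: oQ'; right; exists (Ordinal lik).
have [||||P [pP JP PW]] :=
    @prime_avoid (locmem n (gens B x i)) (fun a => exists s m, ~ Q' s /\ a = u ^+ m * s).
- exact: locmem_ideal.
- by exists 1, 0%N; rewrite mul1r.
- move=> _ _ [s [m [h ->]]] [s' [m' [h' ->]]]; exists (s * s'), (m + m')%N.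
  by split; [move/Qp => [] | rewrite exprD mulrACA].
- by move=> a + [s [m [h ea]]]; rewrite ea => /regX /Ju /h.
have PQ a : P a -> Q' a.
  move=> Pa; apply: boolp.contrapT => nQ; apply: (PW _ Pa).
  by exists a, 0%N; rewrite mul1r.
have nPu : ~ P u.
  by move=> Pu; apply: (PW _ Pu); exists 1, 1%N; rewrite mulr1.
have [||||Pc [h1 h2 h3]] := IH _ P => //; first exact: ltnW.
- by move=> a Ba; apply: JP; apply: locmem_gen => //; apply: ideal_gen_mem.
- by move=> a /PQ /Q'n.
exists (fun j : 'I_i.+2 => if unlift ord_max j is Some j' then Pc j' else Q').
split.
- move=> j; case: unliftP => [j' _|_]; first exact: h1.
  by split=> // a Ba; apply: oQ'; left.
- by rewrite unlift_none.
have sub j : forall a, Pc j a -> P a.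
  have : (j <= i)%N by rewrite -ltnS.
  rewrite leq_eqVlt => /orP[/eqP ji|ji] a.
    by rewrite -h2 (_ : j = ord_max) //; apply: val_inj.
  by rewrite -h2; apply: (h3 j ord_max ji).1.
move=> j l; case: unliftP => [j'|] -> ; case: unliftP => [l'|] ->; rewrite ?lift_max /=.
- exact: h3.
- by move=> _; split; [move=> a /sub /PQ | exists u; split=> // /sub].
- by rewrite ltnNge ltnW.
- by rewrite ltnn.
Qed.

(** The regular sequence already gives a chain of length h ending at Q, which a strict inclusion of
    Q in n would prolong beyond the height. Thus x is a system of parameters. *)
Lemma height_regular_maximal B n h (x : 'I_h -> R) Q : prime_ideal n ->
  height B n h -> loc_regular B n x -> prime_ideal Q -> over (gens B x h) Q ->
  (forall a, Q a -> n a) -> forall a, n a -> Q a.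
Proof.
move=> pn [hB hmax] xreg pQ oQ Qn a na; apply: boolp.contrapT => nQa.
have [P [P1 P2 P3]] := regular_chain_below pn xreg pQ oQ Qn.
have Bn : over B n.
  by move=> b Bb; apply: Qn; apply: oQ; left.
suff /hmax : prime_chain B n h.+1 by rewrite ltnn.
exists (fun j : 'I_h.+2 => if unlift ord_max j is Some j' then P j' else n).
split=> [j||]; last 2 first.
- by move=> b; rewrite unlift_none.
- have sub j b : P j b -> Q b.
    have : (j <= h)%N by rewrite -ltnS.
    rewrite leq_eqVlt => /orP[/eqP ji|ji] h0; apply/P2.
      by rewrite (_ : ord_max = j) //; apply: val_inj.
    by apply: (P3 j ord_max ji).1.
  move=> j l; case: unliftP => [j'|] -> ; case: unliftP => [l'|] ->; rewrite ?lift_max /=.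
  + exact: P3.
  + move=> _; split; first by move=> b /sub /Qn.
    by exists a; split=> // /sub.
  + by rewrite ltnNge ltnW.
  + by rewrite ltnn.
by case: unliftP => [j' _|_] //; apply: P1.
Qed.

End Ideals.

(** * Koszul homology *)

Section Koszul.
Variables (R : comNzRingType) (n : nat).
Implicit Types (z y v w : {set 'I_n} -> R) (f c : 'I_n -> R) (U : {set 'I_n}).
Implicit Types (J : R -> Prop) (g h : 'I_n) (q : nat).

(** Sign of moving e_h to its place in the increasing product e_U. Elements of the exterior algebra
    are coefficient functions on subsets, with [contract] the interior product and [extend] the left
    product by e_h. *)
Definition ksign h U : R := (-1) ^+ #|[set g in U | (g < h)%N]|.

Definition contract h z U : R :=
  if h \in U then 0 else ksign h U * z (h |: U).

Definition extend h z U : R :=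
  if h \in U then ksign h U * z (U :\ h) else 0.

(* Koszul differential, a chain z being \sum_U z(U) e_U:
   d e_(h |: U) has coefficient +/- f_h at e_U. *)
Definition kdiff f z U : R := \sum_h f h * contract h z U.

Definition extends c z U : R := \sum_h c h * extend h z U.

Definition hdeg q z := forall U, #|U| != q -> z U = 0.

Lemma ksignU h g U : g \notin U ->
  ksign h (g |: U) = (-1) ^+ (g < h)%N * ksign h U.
Proof.
move=> gU; rewrite /ksign; case: ltnP => gh; last first.
  rewrite expr0 mul1r; congr (_ ^+ _); apply: eq_card => j; rewrite !inE.
  by case: eqP => // ->; rewrite ltnNge gh /= !andbF.
have -> : [set j in g |: U | (j < h)%N] = g |: [set j in U | (j < h)%N].
  by apply/setP => j; rewrite !inE; case: eqP => // ->; rewrite gh.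
by rewrite cardsU1 !inE (negPf gU) exprD.
Qed.

Lemma ksignD1 h U : ksign h (U :\ h) = ksign h U.
Proof.
congr (_ ^+ _); apply: eq_card => j; rewrite !inE.
by case: eqP => // ->; rewrite ltnn !andbF.
Qed.

Lemma ksignK h U a : ksign h U * (ksign h U * a) = a.
Proof. by rewrite mulrA -expr2 sqrr_sign mul1r. Qed.

Lemma ltn_sign_anti h g : h != g ->
  (-1) ^+ (h < g)%N = - (-1) ^+ (g < h)%N :> R.
Proof. by rewrite neq_ltn; case: ltngtP => //=; rewrite ?opprK. Qed.

Lemma contract_anti h g z U :
  contract h (contract g z) U = - contract g (contract h z) U.
Proof.
rewrite /contract; case hU: (h \in U); case gU: (g \in U);
  rewrite ?in_setU1 ?hU ?gU ?orbT ?mulr0 ?oppr0 //.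
have [->|hg] := eqVneq h g; first by rewrite mulr0 oppr0.
rewrite !ksignU ?hU ?gU // setUCA ltn_sign_anti //.
rewrite /=; ring.
Qed.

(** The anticommutation relation between interior and exterior products, source of all homotopies
    below. *)
Lemma contract_extend h g z U :
  contract h (extend g z) U + extend g (contract h z) U =
  if h == g then z U else 0.
Proof.
rewrite /contract /extend.
have [<-|hg] := eqVneq h g.
  rewrite setU11; case: ifP => hU.
    by rewrite add0r !inE eqxx /= ksignD1 setD1K // ksignK.
  by rewrite addr0 ksignU ?hU // ltnn mul1r setU1K ?hU // ksignK.
rewrite !inE /=; have gh : g == h = false by rewrite eq_sym (negPf hg).
case hU: (h \in U); case gU: (g \in U); rewrite ?gh ?(negPf hg) /= ?mulr0 ?addr0 //.
rewrite ksignU ?hU //.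
have -> : (h |: U) :\ g = h |: (U :\ g).
  by apply/setP => j; rewrite !inE; case: (eqVneq j g) => // ->;
     rewrite eq_sym (negPf hg).
have -> : ksign h U = (-1) ^+ (g < h)%N * ksign h (U :\ g).
  by rewrite -ksignU ?inE ?eqxx // setD1K.
rewrite (ltn_sign_anti hg); set s := (-1) ^+ (g < h)%N.
have s2 : s * s = 1 by rewrite -expr2 sqrr_sign.
by rewrite -[X in _ + X]mul1r -s2; ring.
Qed.

Lemma contractB h z y U :
  contract h (fun V => z V - y V) U = contract h z U - contract h y U.
Proof. by rewrite /contract; case: ifP; rewrite ?subr0 ?mulrBr. Qed.

Lemma contractZ h a z U : contract h (fun V => a * z V) U = a * contract h z U.
Proof. by rewrite /contract; case: ifP; rewrite ?mulr0 // mulrCA. Qed.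

Lemma contract_sum h (I : Type) (r : seq I) (F : I -> {set 'I_n} -> R) U :
  contract h (fun V => \sum_(i <- r) F i V) U = \sum_(i <- r) contract h (F i) U.
Proof.
by rewrite /contract; case: ifP => _; rewrite ?mulr_sumr // big1.
Qed.

Lemma extend_sum h (I : Type) (r : seq I) (F : I -> {set 'I_n} -> R) U :
  extend h (fun V => \sum_(i <- r) F i V) U = \sum_(i <- r) extend h (F i) U.
Proof.
by rewrite /extend; case: ifP => _; rewrite ?mulr_sumr // big1.
Qed.

Lemma extendZ h a z U : extend h (fun V => a * z V) U = a * extend h z U.
Proof. by rewrite /extend; case: ifP; rewrite ?mulr0 // mulrCA. Qed.

Lemma eq_kdiff f z y : z =1 y -> kdiff f z =1 kdiff f y.
Proof.
move=> zy U; apply: eq_bigr => h _; congr (_ * _).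
by rewrite /contract zy.
Qed.

Lemma kdiffB f z y U : kdiff f (fun V => z V - y V) U = kdiff f z U - kdiff f y U.
Proof. by rewrite /kdiff -sumrB; apply: eq_bigr => h _; rewrite contractB mulrBr. Qed.

Lemma kdiffZ f a z U : kdiff f (fun V => a * z V) U = a * kdiff f z U.
Proof. by rewrite /kdiff mulr_sumr; apply: eq_bigr => h _; rewrite contractZ mulrCA. Qed.

Lemma kdiffN f z U : kdiff f (fun V => - z V) U = - kdiff f z U.
Proof.
rewrite -mulN1r -kdiffZ; apply: eq_kdiff => V; by rewrite mulN1r.
Qed.

Lemma kdiffD f z y U : kdiff f (fun V => z V + y V) U = kdiff f z U + kdiff f y U.
Proof.
rewrite -[kdiff f y U]opprK -kdiffN -kdiffB; apply: eq_kdiff => V.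
by rewrite opprK.
Qed.

Lemma kdiff_sum f (I : Type) (r : seq I) (F : I -> {set 'I_n} -> R) U :
  kdiff f (fun V => \sum_(i <- r) F i V) U = \sum_(i <- r) kdiff f (F i) U.
Proof.
rewrite /kdiff exchange_big /=; apply: eq_bigr => h _.
by rewrite contract_sum mulr_sumr.
Qed.

Lemma contract_kdiff f h z U : contract h (kdiff f z) U = - kdiff f (contract h z) U.
Proof.
rewrite /kdiff contract_sum -sumrN; apply: eq_bigr => g _.
by rewrite contractZ contract_anti mulrN.
Qed.

Lemma kdiffK f z U : kdiff f (kdiff f z) U = 0.
Proof.
rewrite {1}/kdiff; under eq_bigr do rewrite contract_kdiff.
have E : \sum_h f h * - kdiff f (contract h z) U
   = - \sum_h \sum_g f h * f g * contract g (contract h z) U.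
  rewrite -sumrN; apply: eq_bigr => h _; rewrite mulrN mulr_sumr.
  by congr (- _); apply: eq_bigr => g _; rewrite mulrA.
rewrite E; apply/eqP; rewrite oppr_eq0; apply/eqP.
(* Separating g < h from h <= g pairs each term with its transpose. The diagonal vanishes by itself,
   so no division by two occurs. *)
rewrite (eq_bigr (fun h => \sum_(g : 'I_n | (g < h)%N) f h * f g * contract g (contract h z) U
   + \sum_(g : 'I_n | ~~ (g < h)%N) f h * f g * contract g (contract h z) U)); last first.
  by move=> h _; rewrite (bigID (fun g : 'I_n => (g < h)%N)).
rewrite big_split /= [X in _ + X](exchange_big_dep xpredT) //= -big_split big1 //= => h _.
rewrite [X in _ + X](bigD1 h) ?ltnn //=.
have cc : contract h (contract h z) U = 0.
  by rewrite /contract; case: ifP => // _; rewrite setU11 mulr0.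
rewrite cc mulr0 add0r.
rewrite [X in _ + X](eq_bigl (fun g : 'I_n => (g < h)%N)); last first.
  by move=> g; rewrite -leqNgt andbC -(inj_eq val_inj) -ltn_neqAle.
rewrite -big_split big1 //= => g _.
by rewrite contract_anti; ring.
Qed.

Lemma kdiff_extend f g z U :
  kdiff f (extend g z) U + extend g (kdiff f z) U = f g * z U.
Proof.
rewrite /kdiff extend_sum -big_split /= (bigD1 g) //= extendZ -mulrDr.
rewrite contract_extend eqxx big1 ?addr0 // => h hg.
by rewrite extendZ -mulrDr contract_extend (negPf hg) mulr0.
Qed.

(** The homotopy by which every element of the ideal of the f_h acts as zero on Koszul homology. *)
Lemma kdiff_extends f c z U :
  kdiff f (extends c z) U + extends c (kdiff f z) U = (\sum_h c h * f h) * z U.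
Proof.
rewrite /extends kdiff_sum -big_split mulr_suml; apply: eq_bigr => h _ /=.
by rewrite kdiffZ -mulrDr kdiff_extend mulrA.
Qed.

Lemma contract_extend_id h z U :
  (forall V : {set _}, h \in V -> z V = 0) -> contract h (extend h z) U = z U.
Proof.
move=> z0; have := contract_extend h h z U; rewrite eqxx => <-.
rewrite -[LHS]addr0; congr (_ + _); rewrite /extend /contract.
by case: ifP => // hU; rewrite !inE eqxx /= setD1K // z0 ?mulr0.
Qed.

Lemma hdegB q z y : hdeg q z -> hdeg q y -> hdeg q (fun U => z U - y U).
Proof. by move=> hz hy U Uq; rewrite hz // hy // subr0. Qed.

Lemma hdegD q z y : hdeg q z -> hdeg q y -> hdeg q (fun U => z U + y U).
Proof. by move=> hz hy U Uq; rewrite hz // hy // addr0. Qed.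

Lemma hdegZ q a z : hdeg q z -> hdeg q (fun U => a * z U).
Proof. by move=> hz U Uq; rewrite hz // mulr0. Qed.

Lemma hdeg_sum q (I : Type) (r : seq I) (F : I -> {set 'I_n} -> R) :
  (forall i, hdeg q (F i)) -> hdeg q (fun U => \sum_(i <- r) F i U).
Proof. by move=> hF U Uq; rewrite big1 // => i _; apply: hF. Qed.

Lemma hdeg_contract q h z : hdeg q.+1 z -> hdeg q (contract h z).
Proof.
move=> hz U Uq; rewrite /contract; case: ifP => // hU.
by rewrite hz ?mulr0 // cardsU1 hU add1n eqSS.
Qed.

Lemma hdeg_extend q h z : hdeg q z -> hdeg q.+1 (extend h z).
Proof.
move=> hz U Uq; rewrite /extend; case: ifP => // hU.
by rewrite hz ?mulr0 //; move: Uq; rewrite (cardsD1 h) hU add1n eqSS.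
Qed.

Lemma hdeg_kdiff q f z : hdeg q.+1 z -> hdeg q (kdiff f z).
Proof.
move=> hz; apply: hdeg_sum => h U Uq.
by rewrite (hdeg_contract _ hz) ?mulr0.
Qed.

Lemma hdeg_extends q c z : hdeg q z -> hdeg q.+1 (extends c z).
Proof.
move=> hz; apply: hdeg_sum => h U Uq.
by rewrite (hdeg_extend _ hz) ?mulr0.
Qed.

Lemma kdiff_ideal f J z : is_ideal J -> (forall U, J (z U)) ->
  forall U, J (kdiff f z U).
Proof.
move=> iJ Jz U; have [J0 _ JM] := iJ; apply: ideal_sum => // h _.
by rewrite /contract; case: ifP => _; rewrite ?mulr0 // mulrA; apply: JM.
Qed.

Lemma extend_ideal h J z : is_ideal J -> (forall U, J (z U)) ->
  forall U, J (extend h z U).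
Proof.
by move=> [J0 _ JM] Jz U; rewrite /extend; case: ifP => _ //; apply: JM.
Qed.

Lemma extends_ideal c J z : is_ideal J -> (forall U, J (z U)) ->
  forall U, J (extends c z U).
Proof.
move=> iJ Jz U; apply: ideal_sum => // h _.
by have [_ _ JM] := iJ; apply: JM; apply: extend_ideal.
Qed.

(** The quotient by J is handled through representatives: coefficients stay in R and equations hold
    modulo J. *)
Definition kcycle f J q z := hdeg q z /\ forall U, J (kdiff f z U).

Definition kbound f J q z :=
  exists y, hdeg q.+1 y /\ forall U, J (z U - kdiff f y U).

(* x annihilates the q-th Koszul homology of R/J with respect to f;
   for x = 1 this homology vanishes. *)
Definition kills x f J q :=
  forall z, kcycle f J q z -> kbound f J q (fun U => x * z U).

Lemma kbound_comb f c J q z : is_ideal J -> kcycle f J q z ->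
  kbound f J q (fun U => (\sum_h c h * f h) * z U).
Proof.
move=> iJ [hz Jz]; exists (extends c z); split; first exact: hdeg_extends.
by move=> U; rewrite -kdiff_extends addrC addKr; apply: extends_ideal.
Qed.

Lemma kboundZ f J q a z : is_ideal J -> kbound f J q z ->
  kbound f J q (fun U => a * z U).
Proof.
move=> [_ _ JM] [y [hy Jy]]; exists (fun U => a * y U).
by split=> [|U]; [exact: hdegZ | rewrite kdiffZ -mulrBr; apply: JM].
Qed.

Lemma kboundD f J q z z' : is_ideal J -> kbound f J q z -> kbound f J q z' ->
  kbound f J q (fun U => z U + z' U).
Proof.
move=> [_ JD _] [y [hy Jy]] [y' [hy' Jy']]; exists (fun U => y U + y' U).
split=> [|U]; first exact: hdegD.
by rewrite kdiffD opprD addrACA; apply: JD.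
Qed.

Lemma kbound_congr f J q z z' : is_ideal J -> (forall U, J (z U - z' U)) ->
  kbound f J q z -> kbound f J q z'.
Proof.
move=> iJ zz' [y [hy Jy]]; exists y; split=> // U.
have -> : z' U - kdiff f y U = (z U - kdiff f y U) - (z U - z' U) by ring.
exact: idealB.
Qed.

Lemma kcycleZ f J q a z : is_ideal J -> kcycle f J q z ->
  kcycle f J q (fun U => a * z U).
Proof.
move=> [_ _ JM] [hz Jz]; split=> [|U]; first exact: hdegZ.
by rewrite kdiffZ; apply: JM.
Qed.

(* The connecting map of 0 -> R/J -(u)-> R/J -> R/(J,u) -> 0: since u acts as
   zero on H(f; R/J), it is onto H_q(f; R/J). The set W of denominators
   accounts for quotients that are only known after localization. *)
Lemma kills_regular x f J J' u c (W : R -> Prop) q :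
    is_ideal J -> is_ideal J' -> (forall a, J a -> J' a) ->
    u = \sum_h c h * f h -> J' u -> (forall a, J (u * a) -> J a) ->
    W 1 -> (forall a b, W a -> W b -> W (a * b)) ->
    (forall s, W s -> exists t (v : 'I_n -> R), t * s = 1 - \sum_h v h * f h) ->
    (forall a, J' a -> exists s b, W s /\ J (s * a - b * u)) ->
  kills x f J' q.+1 -> kills x f J q.
Proof.
move=> iJ iJ' JJ' uE J'u ureg W1 WM Winv J'E kx z [hz Jz].
have [J0 JD JM] := iJ; have [_ _ J'M] := iJ'.
(* By the homotopy, d w agrees with u z modulo J. As u lies in J', w is a cycle modulo J', and the
   hypothesis one degree up bounds x w. *)
pose w := extends c z.
have hw : hdeg q.+1 w by apply: hdeg_extends.
have dw U : J (u * z U - kdiff f w U).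
  by rewrite uE -kdiff_extends addrC addKr; apply: extends_ideal.
have [|v [hv J'v]] := kx w.
  split=> // U; rewrite (_ : kdiff f w U = z U * u - (u * z U - kdiff f w U)).
    by apply: idealB => //; [apply: J'M | apply: JJ'].
  by ring.
have [s0 hs0] : exists s, forall U, exists b, W (s U) /\
     J (s U * (x * w U - kdiff f v U) - b * u).
  by apply: (fin_all_exists (fun U => J'E _ (J'v U))).
have [b0 hb0] := fin_all_exists hs0.
(* A common denominator for all coefficients; b is set to zero outside size q+1 so that it stays
   homogeneous. *)
pose s := \prod_U s0 U.
have Ws : W s by apply: (big_ind W) => // U _; case: (hb0 U).
pose b U := if #|U| == q.+1 then \prod_(V | V != U) s0 V * b0 U else 0.
have hb : hdeg q.+1 b by move=> U Uq; rewrite /b (negPf Uq).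
have Jb U : J (s * (x * w U - kdiff f v U) - u * b U).
  rewrite /b; case: eqP => Uq.
    rewrite /s (bigD1 U) //= (mulrC (s0 U)) -mulrA (mulrC u) -mulrA -mulrBr.
    by apply: JM; case: (hb0 U).
  by rewrite hw ?hdeg_kdiff //; try (exact/eqP); rewrite ?(hdeg_kdiff _ hv) //;
     try (exact/eqP); rewrite !mulr0 !subrr ?mulr0 ?subr0.
have Jsz U : J (s * (x * z U) - kdiff f b U).
  apply: ureg.
  have := kdiff_ideal f iJ Jb U.
  rewrite kdiffB !kdiffZ kdiffB kdiffK subr0 kdiffZ => h1.
  have -> : u * (s * (x * z U) - kdiff f b U) =
     s * x * (u * z U - kdiff f w U) + (s * (x * kdiff f w U) - u * kdiff f b U).
    by ring.
  by apply: (JD) => //; apply: (JM).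
(* So far s x z is a boundary; 1 - t s lies in the ideal of the f_h, which acts as zero on
   homology. *)
have [t [r tsE]] := Winv _ Ws.
have cz : kcycle f J q (fun U => x * z U) by apply: kcycleZ.
have b1 : kbound f J q (fun U => s * (x * z U)) by exists b.
have := kboundD iJ (kboundZ t iJ b1) (kbound_comb r iJ cz).
apply: kbound_congr => // U.
by rewrite mulrA tsE -mulrDl subrK mul1r subrr.
Qed.

(** Exactness of H_(q+1)(R/J) -> H_(q+1)(R/J') -> H_q(R/J), from the long exact sequence of
    multiplication by the nonzerodivisor u. *)
Lemma kills_quotient f J J' u q :
    is_ideal J -> (forall a, J' a <-> exists b, J (a - b * u)) ->
    (forall a, J (u * a) -> J a) ->
  kills 1 f J q.+1 -> kills 1 f J q -> kills 1 f J' q.+1.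
Proof.
move=> iJ J'E ureg k1 k0 z [hz J'z]; have [J0 JD JM] := iJ.
have [w0 hw0] := fin_all_exists (fun U => (J'E _).1 (J'z U)).
pose w U := if #|U| == q then w0 U else 0.
have hw : hdeg q w by move=> U Uq; rewrite /w (negPf Uq).
have Jw U : J (kdiff f z U - u * w U).
  rewrite mulrC /w; case: eqP => Uq //.
  by rewrite (hdeg_kdiff f hz) ?mul0r ?subr0 //; apply/eqP.
have [|v [hv Jv]] := k0 w.
  split=> // U; apply: ureg; have := kdiff_ideal f iJ Jw U.
  by rewrite kdiffB kdiffK kdiffZ sub0r -mulrN => /(idealN iJ); rewrite mulrN opprK.
have [|y [hy Jy]] := k1 (fun U => z U - u * v U).
  split=> [|U]; first by apply: hdegB => //; apply: hdegZ.
  rewrite kdiffB kdiffZ.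
  have -> : kdiff f z U - u * kdiff f v U =
      (kdiff f z U - u * w U) + u * (1 * w U - kdiff f v U) by ring.
  by apply: (JD) => //; apply: (JM).
exists y; split=> // U; apply/J'E; exists (v U).
by have := Jy U; congr J; ring.
Qed.

(** In degree n a chain is one coefficient at the full set and there are no boundaries, so H_n is
    the annihilator of the f_i in R/J. *)
Lemma kills_top x f J : is_ideal J ->
  (kills x f J n <-> forall a, (forall i, J (f i * a)) -> J (x * a)).
Proof.
move=> iJ; have [J0 JD JM] := iJ.
have top0 y : hdeg n.+1 y -> forall U, y U = 0.
  move=> hy U; apply: hy; rewrite neq_ltn ltnS.
  by have := max_card (mem U); rewrite card_ord => ->.
split=> [kx a Ja|top z [hz Jz]].
  pose z U := if U == setT then a else 0.
  have [|y [hy Jy]] := kx z.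
    split=> [U|U].
      by rewrite /z; case: (eqVneq U setT) => // ->; rewrite cardsT card_ord eqxx.
    apply: ideal_sum => // h _; rewrite /contract; case: ifP => _; first by rewrite mulr0.
    rewrite /z; case: ifP => _; last by rewrite !mulr0.
    by rewrite mulrCA; apply: JM.
  have := Jy setT; rewrite /z eqxx /kdiff big1 ?subr0 // => h _.
  by rewrite /contract in_setT mulr0.
exists (fun=> 0); split=> // U.
rewrite /kdiff big1 => [|h _]; last by rewrite /contract; case: ifP; rewrite ?mulr0.
rewrite subr0; have [->|UT] := eqVneq U setT; last first.
  rewrite hz ?mulr0 //; apply: contra UT => /eqP Un.
  by rewrite eqEcard subsetT cardsT card_ord Un leqnn.
apply: top => i; have := Jz (setT :\ i).
rewrite /kdiff (bigD1 i) //= big1 ?addr0 => [|j ji]; last first.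
  by rewrite /contract !inE ji mulr0.
rewrite /contract !inE eqxx /= setD1K ?inE // => h.
by have := JM (ksign i (setT :\ i)) _ h; rewrite mulrCA ksignK.
Qed.

End Koszul.

(** * Operators on polynomials *)

Section MonomialOperators.
Variables (k : fieldType) (n : nat).
Local Notation S := {mpoly k[n]}.
Implicit Types (p c g : S) (m u : 'X_{1..n}) (Q : pred 'X_{1..n}) (h : 'I_n).
Implicit Types (U : {set 'I_n}) (z y : {set 'I_n} -> S).

Lemma mcoeffXM u p m :
  ('X_[u] * p)@_m = if (u <= m)%MM then p@_(m - u) else 0.
Proof.
rewrite mulrC; case: ifP => um; first by rewrite -{1}(submK um) addmC mcoeffMX.
apply: memN_msupp_eq0; apply/negP; rewrite (perm_mem (msuppMX _ _)) => /mapP[m' _ mE].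
by move/negP: um; apply; rewrite mE lem_addr.
Qed.

Definition mpart Q p : S := \sum_(m <- msupp p | Q m) p@_m *: 'X_[m].

Lemma mcoeff_mpart Q p m : (mpart Q p)@_m = if Q m then p@_m else 0.
Proof.
rewrite /mpart raddf_sum /=.
under eq_bigr do rewrite mcoeffZ mcoeffX.
case mp: (m \in msupp p).
  rewrite -big_filter; case: ifP => Qm.
    rewrite (bigD1_seq m) ?filter_uniq ?msupp_uniq ?mem_filter ?Qm //=.
    by rewrite eqxx mulr1 big1 ?addr0 // => m' /negPf->; rewrite mulr0.
  rewrite big_seq big1 // => m'; rewrite mem_filter => /andP[Qm' _].
  by case: eqP => [e|]; rewrite ?mulr0 //; rewrite e Qm in Qm'.
rewrite (memN_msupp_eq0 (negbT mp)) if_same big_seq_cond big1 // => m' /andP[m'p _].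
by case: eqP => [e|]; rewrite ?mulr0 //; rewrite -e m'p in mp.
Qed.

Lemma msupp_mpart Q p m : (m \in msupp (mpart Q p)) = Q m && (m \in msupp p).
Proof. by rewrite !mcoeff_msupp mcoeff_mpart; case: ifP; rewrite ?eqxx. Qed.

Lemma mpartD Q p g : mpart Q (p + g) = mpart Q p + mpart Q g.
Proof.
by apply/mpolyP => m; rewrite !(mcoeffD, mcoeff_mpart); case: ifP; rewrite ?addr0.
Qed.

Lemma mpart0 Q : mpart Q 0 = 0.
Proof. by rewrite /mpart msupp0 big_nil. Qed.

Lemma mpartZ Q (a : k) p : mpart Q (a *: p) = a *: mpart Q p.
Proof.
by apply/mpolyP => m; rewrite !(mcoeffZ, mcoeff_mpart); case: ifP; rewrite ?mulr0.
Qed.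

Lemma mpartN Q p : mpart Q (- p) = - mpart Q p.
Proof. by rewrite -scaleN1r mpartZ scaleN1r. Qed.

Lemma mpartB Q p g : mpart Q (p - g) = mpart Q p - mpart Q g.
Proof. by rewrite mpartD mpartN. Qed.

Lemma mpart_sum Q (I : Type) (r : seq I) (F : I -> S) :
  mpart Q (\sum_(i <- r) F i) = \sum_(i <- r) mpart Q (F i).
Proof.
by elim: r => [|i r IH]; rewrite ?big_nil ?mpart0 // !big_cons mpartD IH.
Qed.

Lemma mpart_id Q p : {in msupp p, forall m, Q m} -> mpart Q p = p.
Proof.
move=> hQ; apply/mpolyP => m; rewrite mcoeff_mpart; case: ifP => // nQ.
rewrite memN_msupp_eq0 //; apply/negP => /hQ; by rewrite nQ.
Qed.

Lemma mpart_none Q p : {in msupp p, forall m, ~~ Q m} -> mpart Q p = 0.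
Proof.
move=> hQ; apply/mpolyP => m; rewrite mcoeff_mpart mcoeff0; case: ifP => // Qm.
by rewrite memN_msupp_eq0 //; apply/negP => /hQ; rewrite Qm.
Qed.

Lemma mpartX Q m : mpart Q 'X_[m] = if Q m then 'X_[m] else 0.
Proof.
case: ifP => Qm; [apply: mpart_id | apply: mpart_none] => m'; rewrite msuppX inE => /eqP->//.
by rewrite Qm.
Qed.

Lemma mpart_mul Q Q' c g :
  (forall m u, u \in msupp g -> Q (m + u)%MM = Q' m) ->
  mpart Q (c * g) = mpart Q' c * g.
Proof.
move=> QQ'; rewrite [in LHS](mpolyE c) [in LHS](mpolyE g) mulr_suml mpart_sum.
rewrite [in RHS](mpolyE c) mpart_sum mulr_suml; apply: eq_bigr => m _.
rewrite mulr_sumr mpart_sum mpartZ mpartX [in RHS](mpolyE g) mulr_sumr.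
apply: eq_big_seq => u ug; rewrite -scalerAl -scalerAr -mpolyXD !mpartZ mpartX.
rewrite QQ' //; case: ifP => _; last by rewrite !scaler0 mul0r.
by rewrite -scalerAl -scalerAr mpolyXD.
Qed.

Lemma mpart_sign Q (e : nat) p : mpart Q ((-1) ^+ e * p) = (-1) ^+ e * mpart Q p.
Proof. by rewrite -signr_odd; case: odd; rewrite !(mul1r, mulN1r, mpartN). Qed.

(** A left inverse of multiplication by X_h, linear over polynomials free of X_h. *)
Definition mquo h p : S :=
  \sum_(m <- msupp p | (0 < m h)%N) p@_m *: 'X_[m - U_(h)].

Lemma mcoeff_mquo h p m : (mquo h p)@_m = p@_(m + U_(h)).
Proof.
rewrite /mquo raddf_sum /=.
under eq_bigr do rewrite mcoeffZ mcoeffX.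
have eqm m' : (0 < m' h)%N -> ((m' - U_(h))%MM == m) = (m' == m + U_(h))%MM.
  move=> m'h; have um' : (U_(h) <= m')%MM by rewrite lep1mP -lt0n.
  by rewrite -(eqm_add2r U_(h)) submK.
case mp: ((m + U_(h))%MM \in msupp p).
  rewrite -big_filter (bigD1_seq (m + U_(h))%MM) ?filter_uniq ?msupp_uniq //=; last first.
    by rewrite mem_filter mp mnmDE mnm1E eqxx addn1.
  rewrite addmK eqxx mulr1 big_seq_cond big1 ?addr0 // => m'.
  rewrite mem_filter => /andP[/andP[m'h _] /negPf ne].
  by rewrite eqm // ne mulr0.
rewrite (memN_msupp_eq0 (negbT mp)) big_seq_cond big1 // => m' /andP[m'p m'h].
by rewrite eqm //; case: eqP => [e|]; rewrite ?mulr0 //; rewrite -e m'p in mp.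
Qed.

Lemma msupp_mquo h p m : (m \in msupp (mquo h p)) = ((m + U_(h))%MM \in msupp p).
Proof. by rewrite !mcoeff_msupp mcoeff_mquo. Qed.

Lemma mquoD h p g : mquo h (p + g) = mquo h p + mquo h g.
Proof. by apply/mpolyP => m; rewrite !(mcoeffD, mcoeff_mquo). Qed.

Lemma mquo0 h : mquo h 0 = 0.
Proof. by apply/mpolyP => m; rewrite mcoeff_mquo !mcoeff0. Qed.

Lemma mquo_sum h (I : Type) (r : seq I) (F : I -> S) :
  mquo h (\sum_(i <- r) F i) = \sum_(i <- r) mquo h (F i).
Proof.
by elim: r => [|i r IH]; rewrite ?big_nil ?mquo0 // !big_cons mquoD IH.
Qed.

Lemma mquoZ h (a : k) p : mquo h (a *: p) = a *: mquo h p.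
Proof. by apply/mpolyP => m; rewrite !(mcoeffZ, mcoeff_mquo). Qed.

Lemma mquo_XM h p : mquo h ('X_h * p) = p.
Proof.
by apply/mpolyP => m; rewrite mcoeff_mquo mcoeffXM lem_addl addmK.
Qed.

Lemma XM_mquo h p : {in msupp p, forall m, (0 < m h)%N} -> 'X_h * mquo h p = p.
Proof.
move=> hp; apply/mpolyP => m; rewrite mcoeffXM mcoeff_mquo; case: ifP => hm.
  by rewrite submK.
rewrite memN_msupp_eq0 //; apply/negP => /hp; rewrite lt0n -lep1mP.
by rewrite hm.
Qed.

Definition vfree h p := {in msupp p, forall m, m h = 0%N}.

Lemma mquo_mul h c g : vfree h g -> mquo h (c * g) = mquo h c * g.
Proof.
move=> fg; rewrite [in LHS](mpolyE c) [in LHS](mpolyE g) mulr_suml mquo_sum.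
rewrite [in RHS](mpolyE c) mquo_sum mulr_suml; apply: eq_bigr => m _.
rewrite mulr_sumr mquo_sum mquoZ [in RHS](mpolyE g) mulr_sumr.
apply: eq_big_seq => u ug; rewrite -!scalerAl -!scalerAr -mpolyXD !mquoZ.
do 2!congr (_ *: _); apply/mpolyP => m'; rewrite mcoeff_mquo mcoeffX mulrC mcoeffXM.
rewrite mcoeff_mquo mcoeffX.
have uh : u h = 0%N by apply: fg.
have E : (u <= m' + U_(h))%MM = (u <= m')%MM.
  apply/mnm_lepP/mnm_lepP => le i; have := le i; rewrite mnmDE mnm1E;
    by case: (eqVneq h i) => [<-|_]; rewrite ?uh ?addn0.
case: ifP => um.
  rewrite -(eqm_add2r u m) [(m' - u + _)%MM]addmC -addmA submK // addmC.
  by rewrite [(U_(h) + m')%MM]addmC.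
case: eqP => // e; have : (u <= m' + U_(h))%MM by rewrite -e lem_addl.
by rewrite E um.
Qed.

Lemma iter_mquo_eq0 h p : iter (msize p) (mquo h) p = 0.
Proof.
have sz q N : (msize q <= N)%N -> iter N (mquo h) q = 0.
  elim: N q => [|N IH] q; first by rewrite leqn0 mmeasure_poly_eq0 => /eqP.
  move=> le; rewrite iterSr; apply: IH; rewrite msizeE; apply/bigmax_leqP_seq => m.
  rewrite msupp_mquo => /msize_mdeg_lt; rewrite mdegD mdeg1 addn1 => lt _.
  by rewrite -ltnS; apply: leq_trans le.
exact: sz.
Qed.

Lemma mpart_vfree h c g : vfree h g ->
  mpart (fun m => m h == 0%N) (c * g) = mpart (fun m => m h == 0%N) c * g.
Proof.
by move=> fg; apply: mpart_mul => m u /fg uh; rewrite mnmDE uh addn0.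
Qed.

Lemma mpart_mquo h p : p = mpart (fun m => m h == 0%N) p + 'X_h * mquo h p.
Proof.
apply/mpolyP => m; rewrite mcoeffD mcoeff_mpart mcoeffXM lep1mP mcoeff_mquo.
case: eqP => [m0|/eqP mh] /=; first by rewrite addr0.
by rewrite add0r submK // lep1mP.
Qed.

Lemma ideal_vfree (P : S -> Prop) (T : S -> S) p :
  (forall a b, T (a + b) = T a + T b) -> T 0 = 0 ->
  (forall c g, P g -> T (c * g) = T c * g) ->
  ideal_gen P p -> ideal_gen P (T p).
Proof.
move=> TD T0 TM [N [g [c [Pg ->]]]]; exists N, g, (fun i => T (c i)); split=> //.
rewrite (big_morph T TD T0); apply: eq_bigr => i _.
exact: TM.
Qed.

Lemma var_regular (P : S -> Prop) h a :
  (forall g, P g -> vfree h g) -> ideal_gen P ('X_h * a) -> ideal_gen P a.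
Proof.
move=> fP Pa; rewrite -(mquo_XM h a); apply: ideal_vfree Pa => //.
- exact: mquoD.
- exact: mquo0.
- by move=> c g /fP; apply: mquo_mul.
Qed.

(** Modulo P the ring is polynomial in X_h, so an element killed by g is treated coefficient by
    coefficient: the hypothesis disposes of its X_h-free part, and the rest is divided by X_h. *)
Lemma regular_remove_var (P : S -> Prop) h g :
    (forall b, P b -> vfree h b) -> vfree h g ->
    (forall a, ideal_gen (fun b => P b \/ b = 'X_h) (g * a) ->
       ideal_gen (fun b => P b \/ b = 'X_h) a) ->
  forall a, ideal_gen P (g * a) -> ideal_gen P a.
Proof.
move=> fP fg greg.
pose rho := mpart (fun m => m h == 0%N).
have Prho a : ideal_gen P a -> ideal_gen P (rho a).
  apply: ideal_vfree; [exact: mpartD | exact: mpart0 |].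
  by move=> c b /fP; apply: mpart_vfree.
have Pquo a : ideal_gen P a -> ideal_gen P (mquo h a).
  apply: ideal_vfree; [exact: mquoD | exact: mquo0 |].
  by move=> c b /fP; apply: mquo_mul.
have [P0 PD PM] := ideal_gen_ideal P.
have step a : ideal_gen P (g * a) -> ideal_gen P (rho a).
  move=> /Prho; rewrite mulrC /rho mpart_vfree // -/(rho a) => h1.
  have /greg/ideal_genU1[c /Prho] : ideal_gen (fun b => P b \/ b = 'X_h) (g * rho a).
    by rewrite mulrC; apply: ideal_gen_mono h1 => b; left.
  rewrite /rho mpartB mpart_id; last by move=> m; rewrite msupp_mpart => /andP[].
  rewrite (@mpart_none _ (c * 'X_h)) ?subr0 // => m; rewrite mcoeff_msupp mulrC mcoeffXM lep1mP.
  by case: ifP => // _; rewrite eqxx.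
move=> a; have := iter_mquo_eq0 h a; move: (msize a) => N.
elim: N a => [|N IH] a; first by move=> /= -> _.
rewrite iterSr => /IH{}IH Pga; rewrite (mpart_mquo h a).
apply: (PD); first exact: step.
apply: (PM); apply: IH; rewrite -(mquo_XM h (g * mquo h a)); apply: Pquo.
have -> : 'X_h * (g * mquo h a) = g * a - g * rho a.
  by rewrite [X in g * X - _](mpart_mquo h a) -/(rho a); ring.
by apply: (idealB (ideal_gen_ideal P)) => //; apply: (PM); apply: step.
Qed.

Definition hgens (P : S -> Prop) :=
  forall p, P p -> exists d, {in msupp p, forall m, mdeg m = d}.

Lemma ideal_mpart_deg (P : S -> Prop) d p : hgens P ->
  ideal_gen P p -> ideal_gen P (mpart (fun m => mdeg m == d) p).
Proof.
move=> hP [N [g [c [Pg ->]]]]; rewrite mpart_sum.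
apply: ideal_sum => [|i _]; first exact: ideal_gen_ideal.
have [_ _ PM] := ideal_gen_ideal P.
have [e he] := hP _ (Pg i).
rewrite (@mpart_mul _ (fun m => mdeg m + e == d)%N).
  by apply: PM; apply: ideal_gen_mem.
by move=> m u /he ue; rewrite mdegD ue.
Qed.

Lemma mpart_deg_sum p :
  p = \sum_(0 <= d < msize p) mpart (fun m => mdeg m == d) p.
Proof.
apply/mpolyP => m; rewrite raddf_sum /=.
under eq_bigr do rewrite mcoeff_mpart.
case mp: (m \in msupp p).
  rewrite (bigD1_seq (mdeg m)) ?iota_uniq ?mem_index_iota ?msize_mdeg_lt //=.
  by rewrite eqxx big1 ?addr0 // => d; rewrite eq_sym => /negPf->.
rewrite (memN_msupp_eq0 (negbT mp)) big1 // => d _.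
by rewrite if_same.
Qed.

Definition irrelevant p := p@_0%MM = 0.

Lemma irrelevant_maximal : maximal_ideal irrelevant.
Proof.
split.
- split; rewrite /irrelevant.
  + exact: mcoeff0.
  + by move=> a b ha hb; rewrite mcoeffD ha hb addr0.
  + by move=> a b hb; rewrite rmorphM /= hb mulr0.
- by rewrite /irrelevant mcoeff1 eqxx => /eqP; rewrite oner_eq0.
move=> Q iQ Q1 mQ a Qa; apply: boolp.contrapT => /eqP a0.
case: Q1; have [_ QD QM] := iQ.
have -> : 1 = (a@_0%MM)^-1%:MP * a + (1 - (a@_0%MM)^-1%:MP * a).
  by rewrite addrC subrK.
apply: QD; first exact: QM.
apply: mQ; rewrite /irrelevant mcoeffB mcoeff1 eqxx rmorphM /= mcoeffC eqxx.
by rewrite mulr1 mulVf // subrr.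
Qed.

(** The denominator s has nonzero constant term. Once the lower parts of a, already in the ideal,
    are removed, the degree-d part of s a is a unit multiple of that of a. *)
Lemma locmem_irrelevant (P : S -> Prop) a : hgens P ->
  locmem irrelevant P a -> ideal_gen P a.
Proof.
move=> hP [s [s0 hs]]; have iP := ideal_gen_ideal P; have [_ _ PM] := iP.
rewrite (mpart_deg_sum a); apply: ideal_sum => // d _.
elim/ltn_ind: d => d IH.
pose lo := mpart (fun m => (mdeg m < d)%N) a.
have Plo : ideal_gen P lo.
  have -> : lo = \sum_(0 <= e < d) mpart (fun m => mdeg m == e) a.
    apply/mpolyP => m; rewrite mcoeff_mpart raddf_sum /=.
    under eq_bigr do rewrite mcoeff_mpart.
    case: ltnP => md.
      rewrite (bigD1_seq (mdeg m)) ?iota_uniq ?mem_index_iota //=.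
      by rewrite eqxx big1 ?addr0 // => e; rewrite eq_sym => /negPf->.
    rewrite big_nat big1 // => e /andP[_ ed]; case: eqP => // me.
    by rewrite -me ltnNge md in ed.
  rewrite big_nat; apply: ideal_sum => // e /andP[_ ed]; exact: IH.
have : ideal_gen P (mpart (fun m => mdeg m == d) (s * (a - lo))).
  apply: ideal_mpart_deg => //; rewrite mulrBr; apply: idealB => //.
  exact: PM.
have -> : mpart (fun m => mdeg m == d) (s * (a - lo)) =
          (s@_0%MM)%:MP * mpart (fun m => mdeg m == d) a.
  apply/mpolyP => m; rewrite mcoeffCM !mcoeff_mpart; case: eqP => md; last by rewrite mulr0.
  rewrite {1}[s]mpolyE mulr_suml raddf_sum /=.
  under eq_bigr do rewrite -scalerAl mcoeffZ mcoeffXM mcoeffB mcoeff_mpart.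
  have key u : (if (u <= m)%MM then a@_(m - u) - (if (mdeg (m - u) < d)%N then a@_(m - u) else 0)
      else 0) = if u == 0%MM then a@_m else 0.
    have [->|u0] := eqVneq u 0%MM.
      rewrite (_ : (0 <= m)%MM); last by apply/mnm_lepP => i; rewrite mnm0E.
      by rewrite subm0 md ltnn subr0.
    case: ifP => // um; suff -> : (mdeg (m - u) < d)%N by rewrite subrr.
    have := congr1 (@mdeg n) (submK um); rewrite mdegD md => <-.
    by rewrite -addn1 leq_add2l lt0n mdeg_eq0.
  under eq_bigr do rewrite key.
  case s0m: (0%MM \in msupp s).
    rewrite (bigD1_seq 0%MM) ?msupp_uniq //= eqxx big1 ?addr0 // => u /negPf->.
    by rewrite mulr0.
  by case: s0; apply: memN_msupp_eq0; rewrite s0m.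
move=> h1; have := PM ((s@_0%MM)^-1%:MP) _ h1.
by rewrite mulrA -mpolyCM mulVf ?mul1r //; apply/eqP.
Qed.

End MonomialOperators.

(** * Koszul homology of square-free monomial quotients *)

Section SquareFree.
Variables (k : fieldType) (n : nat).
Local Notation S := {mpoly k[n]}.
Variables (Sg : 'X_{1..n} -> Prop) (cr : {set 'I_n}).
(* Membership in the monomial ideal depends only on the part of the support
   lying in the core: this encodes at once that Sg is an ideal, that it is
   generated by square-free monomials, and that these live on the core. *)
Hypothesis SgP : forall m m' : 'X_{1..n}, Sg m ->
  (forall i, i \in cr -> (0 < m i)%N -> (0 < m' i)%N) -> Sg m'.
Implicit Types (p c : S) (m u b : 'X_{1..n}) (Q : pred 'X_{1..n}) (h g : 'I_n).
Implicit Types (U : {set 'I_n}) (z y : {set 'I_n} -> S) (q : nat).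

Local Notation X := (fun h : 'I_n => 'X_h : S).

Definition monI p := {in msupp p, forall m, Sg m}.

Lemma monI_ideal : is_ideal monI.
Proof.
split; first by move=> m; rewrite msupp0.
- by move=> a b ha hb m /msuppD_le; rewrite mem_cat => /orP[/ha|/hb].
- move=> a b hb m /msuppM_le /allpairsP[[u v] [_ /hb Sv ->]] /=.
  by apply: SgP Sv _ => i _ vi; rewrite mnmDE addn_gt0 vi orbT.
Qed.

Lemma monIE p : ideal_gen (fun r : S => exists m, Sg m /\ r = 'X_[m]) p <-> monI p.
Proof.
split.
  move: p; apply: ideal_gen_sub; first exact: monI_ideal.
  by move=> _ [m [Sm ->]] m'; rewrite msuppX inE => /eqP->.
move=> hp; rewrite (mpolyE p) big_seq; apply: ideal_sum => [|m mp].
  exact: ideal_gen_ideal.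
rewrite -mul_mpolyC; case: (ideal_gen_ideal (fun r : S => exists m, Sg m /\ r = 'X_[m])).
move=> _ _; apply; apply: ideal_gen_mem; exists m; split=> //; exact: hp.
Qed.

Lemma monI_msupp p c : {subset msupp p <= msupp c} -> monI c -> monI p.
Proof. by move=> pc hc m /pc /hc. Qed.

Lemma monI_mpart Q p : monI p -> monI (mpart Q p).
Proof. by apply: monI_msupp => m; rewrite msupp_mpart => /andP[]. Qed.

(* X^m at e_U has multidegree m + 1_U. *)
Definition cpart Q z U : S := mpart (fun m => Q (m + mesym1 U)%MM) (z U).

Definition csupp Q z :=
  forall U, {in msupp (z U), forall m, Q (m + mesym1 U)%MM}.

Lemma mesym1_U1 h U : h \notin U -> mesym1 (h |: U) = (U_(h) + mesym1 U)%MM.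
Proof.
move=> hU; apply/mnmP => i; rewrite mnmDE !mnmE in_setU1 eq_sym.
by case: eqP => // <-; rewrite (negPf hU).
Qed.

Lemma kdiff_cpart Q z U : kdiff X (cpart Q z) U = cpart Q (kdiff X z) U.
Proof.
rewrite /cpart /kdiff mpart_sum; apply: eq_bigr => h _; rewrite /contract.
case: ifP => hU; first by rewrite mulr0 mpart0.
rewrite /ksign !(mulrCA 'X_h) mpart_sign; congr (_ * _).
rewrite !(mulrC 'X_h).
rewrite (@mpart_mul _ _ _ (fun m => Q (m + mesym1 (h |: U))%MM)) // => m u.
by rewrite msuppX inE => /eqP->; rewrite mesym1_U1 ?hU // addmA.
Qed.

Lemma hdeg_cpart Q q z : hdeg q z -> hdeg q (cpart Q z).
Proof. by move=> hz U Uq; rewrite /cpart hz // mpart0. Qed.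

Lemma csupp_cpart Q z : csupp Q (cpart Q z).
Proof. by move=> U m; rewrite msupp_mpart => /andP[]. Qed.

Lemma cpart_id Q z : csupp Q z -> cpart Q z =1 z.
Proof. by move=> hz U; apply: mpart_id; apply: hz. Qed.

Lemma csupp_kdiff Q z : csupp Q z -> csupp Q (kdiff X z).
Proof.
move=> hz U m; rewrite -(eq_kdiff X (cpart_id hz)) kdiff_cpart msupp_mpart.
by case/andP.
Qed.

Lemma kcycle_cpart Q q z : kcycle X monI q z -> kcycle X monI q (cpart Q z).
Proof.
move=> [hz Jz]; split=> [|U]; first exact: hdeg_cpart.
by rewrite kdiff_cpart; apply: monI_mpart.
Qed.

(** The differential preserves multidegrees and only finitely many occur in z, so bounding chains
    can be assembled piece by piece. *)
Lemma kbound_parts q z :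
  (forall b, kbound X monI q (cpart (pred1 b) z)) -> kbound X monI q z.
Proof.
move=> hb; have iJ := monI_ideal; have [J0 _ _] := iJ.
pose bs := undup (flatten [seq [seq (m + mesym1 U)%MM | m <- msupp (z U)]
                          | U <- enum [set: {set 'I_n}]]).
have zE U : \sum_(b <- bs) cpart (pred1 b) z U = z U.
  apply/mpolyP => m; rewrite raddf_sum /=.
  under eq_bigr do rewrite mcoeff_mpart /=.
  case mz: (m \in msupp (z U)).
    rewrite (bigD1_seq (m + mesym1 U)%MM) ?undup_uniq //=; last first.
      rewrite mem_undup; apply/flattenP; exists [seq (m + mesym1 U)%MM | m <- msupp (z U)].
        by apply/mapP; exists U; rewrite ?mem_enum ?inE.
      exact: map_f.
    by rewrite eqxx big1 ?addr0 // => b; rewrite eq_sym => /negPf->.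
  by rewrite (memN_msupp_eq0 (negbT mz)) big1 // => b _; rewrite if_same.
suff : kbound X monI q (fun U => \sum_(b <- bs) cpart (pred1 b) z U).
  by apply: kbound_congr => // U; rewrite zE subrr.
elim: bs {zE} => [|b bs IH].
  exists (fun=> 0); split=> // U; rewrite big_nil /kdiff big1 ?subrr // => h _.
  by rewrite /contract; case: ifP; rewrite ?mulr0.
apply: (kbound_congr iJ _ (kboundD iJ (hb b) IH)) => U.
by rewrite big_cons subrr.
Qed.

(* Exponents beyond the square-free range, or off the core, leave the
   membership in the ideal unchanged, so the homotopy given by e_h can be
   divided by X_h. *)
Lemma kbound_large h q z : kcycle X monI q z ->
  csupp (fun b => ((h \in cr) ==> (1 < b h)%N) && (0 < b h)%N) z ->
  kbound X monI q z.
Proof.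
move=> [hz Jz] sz; have iJ := monI_ideal.
have ones (V : {set 'I_n}) : h \notin V -> mesym1 V h = 0%N by rewrite mnmE => /negPf->.
pose y U := mquo h (extend h z U).
have XyE U : 'X_h * y U = extend h z U.
  apply: XM_mquo; rewrite /extend; case: ifP => hU m; last by rewrite msupp0.
  move=> /msuppM_le /allpairsP[[u v] [_ vz ->]] /=.
  have /andP[_] := sz _ _ vz; rewrite !mnmDE ones ?inE ?eqxx // addn0 => vh.
  by rewrite addn_gt0 vh orbT.
have hy : hdeg q.+1 y.
  by move=> U Uq; rewrite /y (hdeg_extend h hz) // mquo0.
exists y; split=> // U.
have E : z U - kdiff X y U = mquo h (extend h (kdiff X z) U).
  rewrite -[LHS](mquo_XM h); congr (mquo h _); rewrite mulrBr -kdiffZ.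
  rewrite (eq_kdiff _ XyE) -(kdiff_extend X) addrC addKr //.
rewrite E => m; rewrite msupp_mquo /extend; case: ifP => hU; last by rewrite msupp0.
rewrite /ksign -signr_odd.
have main : (m + U_(h))%MM \in msupp (kdiff X z (U :\ h)) -> Sg m.
  move=> mz; have Sm := Jz _ _ mz; apply: SgP Sm _ => i icr.
  have /andP[/implyP h1 h0] := csupp_kdiff sz mz.
  move: h1 h0; rewrite !mnmDE !mnm1E ones ?inE ?eqxx // addn0.
  by case: (eqVneq h i) => [->|_]; rewrite ?addn0 // addn1 => /(_ icr).
case: odd; rewrite ?mul1r ?mulN1r //.
by rewrite (perm_mem (msuppN _)).
Qed.

Definition squared g : 'I_n -> S := fun h => if h == g then 'X_g ^+ 2 else 'X_h.

(** Since z involves neither X_g nor e_g, it is also a cycle for the squared sequence. Comparing the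
    terms of X_g-degree one in X_g z = d y bounds z up to a chain e with X_g e = 0 modulo the ideal.
    Then e_g e is a cycle one degree up, and contracting a chain that bounds it bounds e. *)
Lemma kbound_squared g q z : kcycle X monI q z ->
    csupp (fun b => b g == 0%N) z ->
    kills 'X_g (squared g) monI q -> kills 1 X monI q.+1 ->
  kbound X monI q z.
Proof.
move=> [hz Jz] sz kg k1; have iJ := monI_ideal; have [J0 JD JM] := iJ.
have z0 U : g \in U -> z U = 0.
  move=> gU; apply/eqP; rewrite -msupp_eq0; case E: (msupp (z U)) => [//|m s].
  have := sz U m; rewrite E mem_head => /(_ isT).
  by rewrite mnmDE mnmE gU addn1.
have zfree U : vfree g (z U).
  by move=> m /sz; rewrite mnmDE addn_eq0 => /andP[/eqP].
have dsq y U : (forall V : {set 'I_n}, g \in V -> y V = 0) ->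
    kdiff (squared g) y U = kdiff X y U.
  move=> y0; apply: eq_bigr => h _; rewrite /squared; case: eqP => // ->.
  by rewrite /contract; case: ifP => _; rewrite ?y0 ?setU11 ?mulr0.
have [|y [hy Jy]] := kg z; first by split=> // U; rewrite dsq.
(* Multiplication by the other variables respects the part linear in X_g, and the X_g^2 term of the
   squared differential contributes nothing to it. *)
pose tau : S -> S := mpart (fun m => m g == 1%N).
pose y2 U := if g \in U then 0 else mquo g (tau (y U)).
have hy2 : hdeg q.+1 y2.
  by move=> U Uq; rewrite /y2; case: ifP => // _; rewrite hy // /tau mpart0 mquo0.
have y20 U : g \in U -> y2 U = 0 by rewrite /y2 => ->.
have Xy2 U : g \notin U -> 'X_g * y2 U = tau (y U).
  move=> /negPf gU; rewrite /y2 gU XM_mquo // => m; rewrite msupp_mpart.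
  by case/andP => /eqP->.
have tauM c h : h != g -> tau (c * 'X_h) = tau c * 'X_h.
  move=> hg; apply: mpart_mul => m u; rewrite msuppX inE => /eqP->.
  by rewrite mnmDE mnm1E (negPf hg) addn0.
pose e U := z U - kdiff X y2 U.
have he : hdeg q e by apply: hdegB => //; apply: hdeg_kdiff.
have e0 U : g \in U -> e U = 0.
  move=> gU; rewrite /e z0 // /kdiff big1 ?subrr // => h _.
  by rewrite /contract; case: ifP => _; rewrite ?mulr0 // y20 ?mulr0 // !inE gU orbT.
have ce U : monI (kdiff X e U) by rewrite kdiffB kdiffK subr0; apply: Jz.
have Xe U : monI ('X_g * e U).
  case gU: (g \in U); first by rewrite e0 // mulr0.
  have := @monI_mpart (fun m => m g == 1%N) _ (Jy U).
  rewrite mpartB -!/(tau _) (_ : tau ('X_g * z U) = 'X_g * z U); last first.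
    apply: mpart_id => m; rewrite mulrC (perm_mem (msuppMX _ _)) => /mapP[u uz ->].
    by rewrite mnmDE mnm1E eqxx (zfree U).
  congr monI; rewrite /e mulrBr -kdiffZ; congr (_ - _).
  rewrite /kdiff /tau mpart_sum; apply: eq_bigr => h _; rewrite /contract /squared.
  case hU: (h \in U); first by rewrite !mulr0 mpart0.
  case: (eqVneq h g) => [->|hg].
    rewrite y20 ?setU11 // !mulr0; apply: mpart_none => m.
    rewrite mulrC mpolyXn (perm_mem (msuppMX _ _)) => /mapP[u _ ->].
    by rewrite mnmDE mulmnE mnm1E eqxx.
  rewrite mulrCA /ksign mpart_sign -/(tau _) (mulrC 'X_h (y _)) tauM // Xy2; last first.
    by rewrite !inE gU eq_sym (negPf hg).
  by rewrite (mulrC (tau _)) mulrCA.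
(* e_g e is a cycle because both X_g e and d e vanish modulo the ideal. *)
have [|v [hv Jv]] := k1 (extend g e).
  split=> [|U]; first exact: hdeg_extend.
  have -> : kdiff X (extend g e) U = 'X_g * e U - extend g (kdiff X e) U.
    by rewrite -(kdiff_extend X) addrK.
  by apply: (idealB iJ) => //; exact: (extend_ideal g iJ).
exists (fun U => y2 U - contract g v U); split=> [|U].
  by apply: hdegB => //; apply: hdeg_contract.
have -> : z U - kdiff X (fun V => y2 V - contract g v V) U =
          contract g (fun V => 1 * extend g e V - kdiff X v V) U.
  rewrite kdiffB contractB contract_kdiff contractZ contract_extend_id // /e.
  by ring.
by rewrite /contract; case: ifP => // _; apply: JM.
Qed.

End SquareFree.

(** * Counting and Krull dimension *)

Section Counting.

(** The coefficient matrix has more rows than columns; a nonzero vector of its left kernel is the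
    relation. *)
Lemma linear_dependence (k : fieldType) (V : lmodType k) (I K : finType)
    (v : I -> V) (e : K -> V) (N : V -> Prop) :
    N 0 -> (forall a b, N a -> N b -> N (a + b)) ->
    (forall (c : k) a, N a -> N (c *: a)) -> (#|K| < #|I|)%N ->
    (forall i, exists c : K -> k, N (v i - \sum_j c j *: e j)) ->
  exists l : I -> k, (exists i, l i != 0) /\ N (\sum_i l i *: v i).
Proof.
move=> N0 ND NZ KI /fin_all_exists[c hc].
pose C := \matrix_(i < #|I|, j < #|K|) c (enum_val i) (enum_val j).
have : kermx C != 0.
  rewrite -mxrank_eq0 mxrank_ker -lt0n subn_gt0.
  exact: leq_ltn_trans (rank_leq_col C) KI.
case/rowV0Pn => r /sub_kermxP rC r0.
pose l i := r 0 (enum_rank i); exists l; split.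
  case: (pickP (fun i => r 0 i != 0)) => [i ri|all0].
    by exists (enum_val i); rewrite /l enum_valK.
  case/eqP: r0; apply/rowP => i; rewrite mxE; apply/eqP.
  by move: (all0 i) => /negbFE.
have lC j : \sum_i l i * c i j = 0.
  have := congr1 (fun M : 'rV_#|K| => M 0 (enum_rank j)) rC; rewrite !mxE => E.
  rewrite -[RHS]E.
  rewrite [LHS](reindex (fun i : 'I_#|I| => enum_val i)) /=; last first.
    by apply: onW_bij; exists enum_rank; [exact: enum_valK | exact: enum_rankK].
  by apply: eq_bigr => i _; rewrite mxE /l enum_valK enum_rankK.
have -> : \sum_i l i *: v i = \sum_i l i *: (v i - \sum_j c i j *: e j).
  under [RHS]eq_bigr do rewrite scalerBr scaler_sumr.
  rewrite sumrB exchange_big /= [X in _ - X]big1 ?subr0 // => j _.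
  under eq_bigr do rewrite scalerA.
  by rewrite -scaler_suml lC scale0r.
by elim/big_ind: _ => // i _; apply: NZ.
Qed.

(** The estimate behind both dimension bounds. As (a M + 1)^d <= (a + 1)^d M^d, any M exceeding C (a
    + 1)^d serves. *)
Lemma growth (C a d : nat) :
  exists M, (0 < M)%N /\ (C * (a * M + 1) ^ d < M ^ d.+1)%N.
Proof.
pose M := (C * (a + 1) ^ d).+1; exists M; split=> //.
have le : ((a * M + 1) ^ d <= (a + 1) ^ d * M ^ d)%N.
  rewrite -expnMn; case: d @M => [|d] M; rewrite ?expn0 // leq_exp2r //.
  by rewrite mulnDl mul1n leq_add2l.
apply: (@leq_ltn_trans (C * ((a + 1) ^ d * M ^ d))%N); first by rewrite leq_mul2l le orbT.
by rewrite mulnA expnS ltn_pmul2r ?expn_gt0.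
Qed.

End Counting.

Section Dimension.
Variables (k : fieldType) (n : nat).
Local Notation S := {mpoly k[n]}.
Implicit Types (p : S) (m : 'X_{1..n}) (x : nat -> S).

Lemma msizeM_leq (p q : S) : (msize (p * q) <= (msize p + msize q).-1)%N.
Proof.
have [->|p0] := eqVneq p 0; first by rewrite mul0r msize0.
have [->|q0] := eqVneq q 0; first by rewrite mulr0 msize0.
by rewrite msizeM.
Qed.

Definition msup m : {set 'I_n} := [set i | (0 < m i)%N].

Definition xmon x (e : seq nat) : S := \prod_(i < size e) x i ^+ nth 0%N e i.

Lemma xmon_cons x a (e : seq nat) :
  xmon x (a :: e) = x 0%N ^+ a * xmon (fun i => x i.+1) e.
Proof. by rewrite /xmon big_ord_recl. Qed.

(* A polynomial relation among the x_i, divided by the lowest power of x_0,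
   becomes a relation among x_1, x_2, ... modulo the next prime. *)
Lemma chain_independent t x (P : nat -> S -> Prop) (Es : seq (seq nat)) (l : seq nat -> k) :
    (forall i, (i <= t)%N -> prime_ideal (P i)) ->
    (forall i, (i < t)%N -> [/\ forall a, P i a -> P i.+1 a, P i.+1 (x i) & ~ P i (x i)]) ->
    uniq Es -> Es != [::] -> {in Es, forall e, size e = t /\ l e != 0} ->
  ~ P 0%N (\sum_(e <- Es) l e *: xmon x e).
Proof.
elim: t x P Es l => [|t IH] x P Es l Pp Pc uE nE hE.
  have nilE e : e \in Es -> e = [::] by move=> /hE[/size0nil].
  have EsE : Es = [:: [::]].
    case: Es uE nE nilE {hE} => [//|e [|e' s]] /= + _ nilE.
      by rewrite (nilE e) ?mem_head.
    by rewrite (nilE e) ?mem_head // (nilE e') ?inE ?eqxx ?orbT.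
  have [_ l0] : size ([::] : seq nat) = 0%N /\ l [::] != 0 by apply: hE; rewrite EsE inE.
  rewrite EsE big_seq1 /xmon big_ord0 => Pl.
  have [[_ _ PM] P1 _] := Pp 0%N (leqnn _); apply: P1.
  by have := PM ((l [::])^-1)%:MP _ Pl; rewrite mul_mpolyC scalerA mulVf // scale1r.
move=> P0s.
pose hd (e : seq nat) := head 0%N e.
have exh : exists a, a \in [seq hd e | e <- Es].
  by case: Es nE {uE hE P0s} => // e s _; exists (hd e); rewrite mem_head.
case: (ex_minnP exh) => e0 /mapP[e1 e1E e0E] e0min.
have consE e : e \in Es -> e = hd e :: behead e.
  by case: e => // /hE[].
have sub0 e : e \in Es -> (e0 <= hd e)%N by move=> eE; apply: e0min; apply: map_f.
have [iP P1 Pprime] := Pp 0%N (leq0n _).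
have [P01 Px0 nPx0] := Pc 0%N (ltn0Sn _).
have [iP1 _ _] := Pp 1%N (ltn0Sn _); have [P10 P1D P1M] := iP1.
pose x' i := x i.+1.
have sumE : \sum_(e <- Es) l e *: xmon x e =
   x 0%N ^+ e0 * \sum_(e <- Es) l e *: (x 0%N ^+ (hd e - e0) * xmon x' (behead e)).
  rewrite mulr_sumr; apply: eq_big_seq => e eE.
  rewrite [in LHS](consE e eE) xmon_cons -scalerAr mulrA -exprD subnKC ?sub0 //.
  by rewrite -consE.
move: P0s; rewrite sumE => /Pprime[]; first by move/(prime_idealX (Pp 0%N (leq0n _))).
move/P01; rewrite (bigID (fun e => hd e == e0)) /= => PS.
have Phi : P 1%N (\sum_(e <- Es | hd e != e0) l e *: (x 0%N ^+ (hd e - e0) * xmon x' (behead e))).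
  rewrite big_seq_cond; apply: ideal_sum => // e /andP[eE ne].
  have : (0 < hd e - e0)%N by rewrite subn_gt0 ltn_neqAle eq_sym ne sub0.
  case: (_ - _)%N => // r _; rewrite exprS -mulrA -mul_mpolyC mulrCA mulrC.
  exact: P1M.
have {Phi PS} := idealB iP1 PS Phi; rewrite addrK => PS.
pose Es' := [seq behead e | e <- Es & hd e == e0].
pose l' e := l (e0 :: e).
have Es'P e : e \in Es' -> e0 :: e \in Es.
  case/mapP => f; rewrite mem_filter => /andP[/eqP fe fE] ->.
  by rewrite -fe -consE.
apply: (IH x' (fun i => P i.+1) Es' l').
- by move=> i it; apply: Pp.
- by move=> i it; apply: Pc.
- rewrite map_inj_in_uniq ?filter_uniq // => e f.
  rewrite !mem_filter => /andP[/eqP ee eE] /andP[/eqP fe fE] ef.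
  by rewrite (consE e) // (consE f) // ee fe ef.
- apply/eqP => E0; have : behead e1 \in Es' by apply: map_f; rewrite mem_filter e0E eqxx.
  by rewrite E0.
- by move=> e /Es'P/hE [/= [->]].
rewrite /Es' big_map big_filter.
move: PS; congr (P 1%N _); rewrite big_seq_cond [RHS]big_seq_cond.
apply: eq_bigr => e /andP[eE /eqP ee].
by rewrite ee subnn mul1r /l' -ee -consE.
Qed.

Definition spans (K : finType) (e : K -> S) (J : S -> Prop) p :=
  exists c : K -> k, J (p - \sum_j c j *: e j).

Lemma spansD (K : finType) (e : K -> S) (J : S -> Prop) p p' : is_ideal J ->
  spans e J p -> spans e J p' -> spans e J (p + p').
Proof.
move=> [_ JD _] [c hc] [c' hc']; exists (fun j => c j + c' j).
rewrite (_ : _ - _ = p - \sum_j c j *: e j + (p' - \sum_j c' j *: e j)); first exact: JD.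
rewrite addrACA -opprD -big_split /=; congr (_ - _).
by apply: eq_bigr => j _; rewrite scalerDl.
Qed.

Lemma spansZ (K : finType) (e : K -> S) (J : S -> Prop) a p : is_ideal J ->
  spans e J p -> spans e J (a *: p).
Proof.
move=> [_ _ JM] [c hc]; exists (fun j => a * c j).
rewrite (_ : _ - _ = a%:MP * (p - \sum_j c j *: e j)); first exact: JM.
rewrite mul_mpolyC scalerBr scaler_sumr; congr (_ - _).
by apply: eq_bigr => j _; rewrite scalerA.
Qed.

Lemma spans0 (K : finType) (e : K -> S) (J : S -> Prop) : is_ideal J -> spans e J 0.
Proof.
by move=> [J0 _ _]; exists (fun=> 0); rewrite big1 ?subr0 // => j _; rewrite scale0r.
Qed.

(** A parametrization that makes counting immediate: a support together with d exponents read along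
    its enumeration. Positions beyond d get exponent 0, which is harmless since only surjectivity
    matters. *)
Definition face_monom d N (F : {set 'I_n} * {ffun 'I_d -> 'I_N.+1}) : 'X_{1..n} :=
  [multinom if i \in F.1 then
     (if insub (index i (enum F.1)) is Some j then F.2 j : nat else 0%N) else 0%N | i < n].

Lemma face_monomP d N m : (#|msup m| <= d)%N -> (mdeg m <= N)%N ->
  exists F, m = @face_monom d N F.
Proof.
move=> md mN; pose F := msup m.
pose al := [ffun j : 'I_d => inord (\sum_(i in F | index i (enum F) == j) m i) : 'I_N.+1].
exists (F, al); apply/mnmP => i; rewrite mnmE /=; case: ifP => iF; last first.
  by move/negbT: iF; rewrite inE -eqn0Ngt => /eqP.
have lt : (index i (enum F) < d)%N.
  by apply: leq_trans md; rewrite cardE index_mem mem_enum.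
rewrite insubT /= ffunE inordK /=.
  rewrite (bigD1 i) /= ?iF ?eqxx // big1 ?addn0 // => j /andP[/andP[jF /eqP ij] /eqP ne].
  by case: ne; apply: (@index_inj _ i (enum F) j i); rewrite ?mem_enum.
rewrite ltnS; apply: leq_trans mN; rewrite mdegE [X in (_ <= X)%N](bigID (fun j => (j \in F) && (index j (enum F) == index i (enum F)))) /=.
exact: leq_addr.
Qed.

(** Modulo J, polynomials of degree at most D M are spanned by C (D M + 1)^d monomials, C being the
    number of subsets, whereas M^(d+1) products of powers of the x_i fall in this range. *)
Lemma algebraic_dependence d (J : S -> Prop) (x : nat -> S) : is_ideal J ->
    (forall m, (d < #|msup m|)%N -> J 'X_[m]) ->
  exists Es (l : seq nat -> k), [/\ uniq Es, Es != [::],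
    {in Es, forall e, size e = d.+1 /\ l e != 0} & J (\sum_(e <- Es) l e *: xmon x e)].
Proof.
move=> iJ hJ; have [J0 JD JM] := iJ.
pose D := (\sum_(i < d.+1) msize (x i))%N.
have [M [M0 lt]] := growth #|{set 'I_n}| D d.
pose I := {: d.+1.-tuple 'I_M}.
pose ex (t : I) : seq nat := [seq val a | a <- t].
pose K := ({set 'I_n} * {ffun 'I_d -> 'I_(D * M).+1})%type.
have szx (t : I) : (msize (xmon x (ex t)) <= D * M + 1)%N.
  have szt : size (ex t) = d.+1 by rewrite size_map size_tuple.
  have szX q e : (msize (q ^+ e : S) <= msize q * e + 1)%N.
    elim: e => [|e IH]; first by rewrite muln0 expr0 msize1.
    rewrite exprS; apply: leq_trans (msizeM_leq _ _) _.
    by move: IH; rewrite mulnS; case: (msize q) => [|s]; lia.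
  rewrite /xmon szt.
  apply: (@leq_trans ((\sum_(i < d.+1) msize (x i) * M) + 1)); last by rewrite -big_distrl.
  elim/big_rec2: _ => [|i q p _ IH]; first by rewrite msize1.
  have lt_M : (nth 0%N (ex t) i <= M)%N.
    have : (i < size (ex t))%N by rewrite szt.
    move/(mem_nth 0%N) => /mapP[a _ ->]; exact: ltnW (ltn_ord a).
  apply: leq_trans (msizeM_leq _ _) _.
  have := szX (x i) (nth 0%N (ex t) i).
  have := leq_mul (leqnn (msize (x i))) lt_M.
  by move: IH; move: (msize p) (msize (_ ^+ _)) => a b; lia.
have [|||l [[t0 lt0] hl]] := @linear_dependence k S I K (fun t => xmon x (ex t))
   (fun F => 'X_[face_monom F]) J J0 JD.
- by move=> c a Ja; rewrite -mul_mpolyC; apply: JM.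
- rewrite card_tuple card_ord card_prod card_ffun !card_ord.
  by move: lt; rewrite addn1.
- move=> t; change (spans (fun F : K => 'X_[face_monom F]) J (xmon x (ex t))).
  have := szx t; move: (xmon _ _) => p szp; rewrite (mpolyE p) big_seq.
  elim/big_ind: _ => [|a b|m mp]; first exact: spans0.
    exact: spansD.
  apply: spansZ => //; have mdp := msize_mdeg_lt mp.
  case: (leqP #|msup m| d) => md.
    have [|F ->] := @face_monomP d (D * M)%N m md.
      by move: (leq_trans mdp szp); rewrite addn1 ltnS.
    exists (fun G => (G == F)%:R); rewrite (bigD1 F) //= eqxx scale1r big1 ?addr0 ?subrr // => G.
    by move=> /negPf->; rewrite scale0r.
  exists (fun=> 0); rewrite big1 ?subr0; first exact: hJ.
  by move=> j _; rewrite scale0r.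
pose Ts := [seq t <- enum I | l t != 0].
have exinj : injective ex by move=> s t /(inj_map val_inj) /val_inj.
pose l' (e : seq nat) := \sum_(t : I | ex t == e) l t.
have l'E t : l' (ex t) = l t.
  rewrite /l' (bigD1 t) //= big1 ?addr0 // => s /andP[/eqP /exinj ->].
  by rewrite eqxx.
exists (map ex Ts), l'; split.
- by rewrite map_inj_uniq // filter_uniq // enum_uniq.
- apply/eqP => E; have : ex t0 \in map ex Ts.
    by apply: map_f; rewrite mem_filter lt0 mem_enum.
  by rewrite E.
- move=> e /mapP[t]; rewrite mem_filter => /andP[lt1 _] ->.
  by rewrite l'E size_map size_tuple.
rewrite big_map big_filter; move: hl; congr J.
rewrite big_enum_cond /= (bigID (fun t => l t != 0)) /= [X in _ + X]big1 ?addr0.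
  by apply: eq_bigr => t _; rewrite l'E.
by move=> t /negPn/eqP ->; rewrite scale0r.
Qed.

(** Elements chosen in the successive differences of a longer chain would be independent by
    [chain_independent] and dependent by [algebraic_dependence]. *)
Lemma prime_chain_dim d (B n0 : S -> Prop) h :
    (forall (P : S -> Prop) m, prime_ideal P -> over B P -> (d < #|msup m|)%N -> P 'X_[m]) ->
  prime_chain B n0 h -> (h <= d)%N.
Proof.
move=> hB [P [P1 _ P3]]; rewrite leqNgt; apply/negP => dh.
pose Pn i := P (inord i).
have Pc i : (i <= d)%N -> [/\ forall a, Pn i a -> Pn i.+1 a & exists a, Pn i.+1 a /\ ~ Pn i a].
  move=> id; have [|h1 h2] := P3 (inord i) (inord i.+1); last by split.
  by rewrite !inordK //; lia.
have /boolp.choice[x hx] : forall i, exists a, (i <= d)%N -> Pn i.+1 a /\ ~ Pn i a.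
  move=> i; case: (leqP i d) => [id|_]; last by exists 0.
  by have [_ [a ha]] := Pc i id; exists a.
have [iP _ _] := (P1 (inord 0%N)).1.
have [|Es [l [uE nE hE hP]]] := @algebraic_dependence d (Pn 0%N) x iP.
  by move=> m md; apply: hB => //; case: (P1 (inord 0%N)).
apply: (@chain_independent d.+1 x Pn Es l) hP => //.
  by move=> i _; case: (P1 (inord i)).
by move=> i id; have [h1 _] := Pc i id; have [h2 h3] := hx i id; split.
Qed.

End Dimension.

(** * Zariski's lemma *)

Section Zariski.
Variables (k : fieldType) (n : nat).
Local Notation S := {mpoly k[n]}.
Variable nn : S -> Prop.
Hypothesis nn_max : maximal_ideal nn.
Implicit Types (p q a : S) (W : {set 'I_n}) (v : 'I_n) (L : seq S).

Let nn_prime : prime_ideal nn. Proof. exact: maximal_prime. Qed.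
Let nn_ideal : is_ideal nn. Proof. by case: nn_prime. Qed.

Definition vars_in W p := forall v, v \notin W -> vfree v p.

Lemma vars_inD W p q : vars_in W p -> vars_in W q -> vars_in W (p + q).
Proof.
move=> hp hq v vW m /msuppD_le; rewrite mem_cat => /orP[]; [exact: hp | exact: hq].
Qed.

Lemma vars_inM W p q : vars_in W p -> vars_in W q -> vars_in W (p * q).
Proof.
move=> hp hq v vW m /msuppM_le /allpairsP[[a b] /= [ap bq ->]].
by rewrite mnmDE (hp v) // (hq v).
Qed.

Lemma vars_inC W (c : k) : vars_in W c%:MP.
Proof.
move=> v vW m; rewrite msuppC; case: ifP => // _; rewrite inE => /eqP->.
by rewrite mnm0E.
Qed.

Lemma vars_inN W p : vars_in W p -> vars_in W (- p).
Proof. by move=> hp; rewrite -mulN1r -mpolyC1 -mpolyCN; apply: vars_inM => //; apply: vars_inC. Qed.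

Lemma vars_in0 W : vars_in W 0.
Proof. by rewrite -mpolyC0; apply: vars_inC. Qed.

Lemma vars_in1 W : vars_in W 1.
Proof. by rewrite -mpolyC1; apply: vars_inC. Qed.

Lemma vars_inX W p e : vars_in W p -> vars_in W (p ^+ e).
Proof.
move=> hp; elim: e => [|e IH]; first by rewrite expr0; apply: vars_in1.
by rewrite exprS; apply: vars_inM.
Qed.

Lemma vars_in_prod W (I : Type) (r : seq I) (Q : pred I) (F : I -> S) :
  (forall i, Q i -> vars_in W (F i)) -> vars_in W (\prod_(i <- r | Q i) F i).
Proof.
move=> hF; apply: big_ind => //; first exact: vars_in1.
by move=> *; apply: vars_inM.
Qed.

Lemma vars_in_sum W (I : Type) (r : seq I) (Q : pred I) (F : I -> S) :
  (forall i, Q i -> vars_in W (F i)) -> vars_in W (\sum_(i <- r | Q i) F i).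
Proof.
move=> hF; apply: big_ind => //; first exact: vars_in0.
by move=> *; apply: vars_inD.
Qed.

Definition vcoef v i p : S := mpart (fun m => m v == 0%N) (iter i (mquo v) p).

Lemma vcoef_sum v p : p = \sum_(i < msize p) vcoef v i p * 'X_v ^+ i.
Proof.
have E N : p = \sum_(i < N) vcoef v i p * 'X_v ^+ i + iter N (mquo v) p * 'X_v ^+ N.
  elim: N => [|N IH]; first by rewrite big_ord0 add0r mulr1.
  rewrite {1}IH big_ord_recr /= -addrA; congr (_ + _).
  rewrite {1}(mpart_mquo v (iter N (mquo v) p)) -/(vcoef v N p) exprS.
  by ring.
by rewrite {1}(E (msize p)) iter_mquo_eq0 mul0r addr0.
Qed.

Lemma vars_in_vcoef W v i p : vars_in (v |: W) p -> vars_in W (vcoef v i p).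
Proof.
move=> hp u uW m; rewrite msupp_mpart => /andP[/eqP mv].
case: (eqVneq u v) => [->//|uv].
have : forall m, m \in msupp (iter i (mquo v) p) -> m u = 0%N.
  elim: i => [|i IH] m' /=; first by apply: hp; rewrite !inE negb_or uv uW.
  rewrite msupp_mquo => /IH; rewrite mnmDE => /eqP.
  by rewrite addn_eq0 => /andP[/eqP].
by apply.
Qed.

Definition independent W := forall q, vars_in W q -> nn q -> q = 0.

(** * Finiteness of the quotient over k[X_W] after inverting g *)

Section Finite.
Variables (W : {set 'I_n}) (g : S) (deg : 'I_n -> nat)
  (cf : 'I_n -> nat -> S).
Hypothesis gW : vars_in W g.
Hypothesis cfW : forall v i, v \notin W -> vars_in W (cf v i).
Hypothesis relP : forall v, v \notin W ->
  nn (g * 'X_v ^+ deg v - \sum_(j < deg v) cf v j * 'X_v ^+ j).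

Definition Wspan L a := exists c : 'I_(size L) -> S,
  (forall i, vars_in W (c i)) /\ nn (a - \sum_i c i * L`_i).

Definition Wfinite L p := exists N, Wspan L (g ^+ N * p).

Lemma WspanD L a b : Wspan L a -> Wspan L b -> Wspan L (a + b).
Proof.
have [_ nD _] := nn_ideal.
move=> [c [cW hc]] [c' [cW' hc']]; exists (fun i => c i + c' i); split.
  by move=> i; apply: vars_inD.
under eq_bigr do rewrite mulrDl.
by rewrite big_split opprD addrACA; apply: nD.
Qed.

Lemma WspanM L a q : vars_in W q -> Wspan L a -> Wspan L (q * a).
Proof.
have [_ _ nM] := nn_ideal.
move=> qW [c [cW hc]]; exists (fun i => q * c i); split.
  by move=> i; apply: vars_inM.
under eq_bigr do rewrite -mulrA.
by rewrite -mulr_sumr -mulrBr; apply: nM.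
Qed.

Lemma WfiniteM L p q : vars_in W q -> Wfinite L p -> Wfinite L (q * p).
Proof. by move=> qW [N h]; exists N; rewrite mulrCA; apply: WspanM. Qed.

Lemma WfiniteD L p q : Wfinite L p -> Wfinite L q -> Wfinite L (p + q).
Proof.
move=> [N hp] [M hq]; exists (N + M)%N; rewrite mulrDr; apply: WspanD.
  by rewrite addnC exprD -mulrA; apply: WspanM => //; apply: vars_inX.
by rewrite exprD -mulrA; apply: WspanM => //; apply: vars_inX.
Qed.

Lemma Wfinite0 L : Wfinite L 0.
Proof.
exists 0%N; exists (fun=> 0); split=> [i|]; first exact: vars_in0.
rewrite mulr0 big1 ?subrr => [|i _]; last by rewrite mul0r.
by case: nn_ideal.
Qed.

Lemma Wfinite_sum L (I : Type) (r : seq I) (Q : pred I) (F : I -> S) :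
  (forall i, Q i -> Wfinite L (F i)) -> Wfinite L (\sum_(i <- r | Q i) F i).
Proof. by move=> hF; apply: big_ind => //; [exact: Wfinite0 | exact: WfiniteD]. Qed.

Lemma Wfinite_g L p e : Wfinite L (g ^+ e * p) -> Wfinite L p.
Proof. by move=> [N h]; exists (N + e)%N; rewrite exprD -mulrA. Qed.

Lemma Wfinite_congr L p q : nn (p - q) -> Wfinite L q -> Wfinite L p.
Proof.
have [_ nD nM] := nn_ideal.
move=> pq [N [c [cW hc]]]; exists N, c; split=> //.
have -> : g ^+ N * p - \sum_i c i * L`_i =
   g ^+ N * (p - q) + (g ^+ N * q - \sum_i c i * L`_i) by ring.
by apply: nD => //; apply: nM.
Qed.

Lemma Wfinite_mem L p : p \in L -> Wfinite L p.
Proof.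
move=> pL; exists 0%N.
have lt : (index p L < size L)%N by rewrite index_mem.
exists (fun i => (i == Ordinal lt)%:R); split=> [i|].
  by case: eqP => _; [exact: vars_in1 | exact: vars_in0].
rewrite (bigD1 (Ordinal lt)) //= eqxx nth_index // big1 => [|i /negPf->]; last by rewrite mul0r.
by rewrite addr0 expr0 !mul1r subrr; case: nn_ideal.
Qed.

(** Each variable outside W satisfies modulo [nn] an equation with leading coefficient g, so its
    high powers reduce once g is inverted. Variables are adjoined one at a time, and products of low
    powers generate. *)
Lemma module_finite : exists L, forall p, Wfinite L p.
Proof.
suff : forall (vs : seq 'I_n), {subset vs <= ~: W} ->
    exists L, forall p, vars_in ([set x in vs] :|: W) p -> Wfinite L p.
  case/(_ (enum (~: W))) => [v|L hL]; first by rewrite mem_enum.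
  exists L => p; apply: hL => v; rewrite !inE mem_enum inE.
  by case: (v \in W).
elim=> [|v vs IH] sub.
  exists [:: 1] => p hp.
  rewrite -[p]mulr1; apply: WfiniteM; last by apply: Wfinite_mem; rewrite inE.
  by move=> v vW; apply: hp; rewrite !inE.
have [|L hL] := IH; first by move=> u uvs; apply: sub; rewrite inE uvs orbT.
have vW : v \notin W by have := sub v (mem_head _ _); rewrite inE.
pose L' := [seq l * 'X_v ^+ i | l <- L, i <- iota 0 (deg v)].
exists L' => p hp.
have rel := relP vW.
have pow i l : l \in L -> Wfinite L' ('X_v ^+ i * l).
  elim/ltn_ind: i => i IHi lL; case: (ltnP i (deg v)) => [lt|le].
    rewrite mulrC; apply: Wfinite_mem; apply/allpairsP; exists (l, i).
    by rewrite mem_iota lt.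
  apply: (@Wfinite_g _ _ 1); rewrite expr1.
  apply: (@Wfinite_congr _ _ (\sum_(j < deg v) cf v j * ('X_v ^+ (i - deg v + j) * l))).
    have -> : g * ('X_v ^+ i * l) - \sum_(j < deg v) cf v j * ('X_v ^+ (i - deg v + j) * l)
      = 'X_v ^+ (i - deg v) * l * (g * 'X_v ^+ deg v - \sum_(j < deg v) cf v j * 'X_v ^+ j).
      rewrite mulrBr mulr_sumr; congr (_ - _).
        by rewrite -{1}(subnK le) exprD; ring.
      by apply: eq_bigr => j _; rewrite exprD; ring.
    by case: nn_ideal => _ _; apply.
  apply: Wfinite_sum => j _; apply: WfiniteM; first exact: cfW.
  by apply: IHi => //; have := ltn_ord j; lia.
rewrite (vcoef_sum v p); apply: Wfinite_sum => i _.
have [|N [c [cW hc]]] := hL (vcoef v i p).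
  apply: vars_in_vcoef; rewrite setUA; move: hp; congr vars_in.
  by apply/setP => u; rewrite !inE.
apply: (@Wfinite_g _ _ N).
apply: (@Wfinite_congr _ _ (\sum_j c j * ('X_v ^+ i * L`_j))).
  have -> : g ^+ N * (vcoef v i p * 'X_v ^+ i) - \sum_j c j * ('X_v ^+ i * L`_j)
    = 'X_v ^+ i * (g ^+ N * vcoef v i p - \sum_j c j * L`_j).
    rewrite mulrBr; congr (_ - _); first by rewrite [RHS]mulrCA (mulrC (vcoef _ _ _)).
    by rewrite mulr_sumr; apply: eq_bigr => j _; rewrite mulrCA.
  by case: nn_ideal => _ _; apply.
apply: Wfinite_sum => j _; apply: WfiniteM; first exact: cW.
by apply: pow; apply: mem_nth.
Qed.

End Finite.

Definition eqvmod q a b := exists t, a - b = q * t.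

Lemma det_eqvmod q l (A B : 'M[S]_l) :
  (forall i j, eqvmod q (A i j) (B i j)) -> eqvmod q (\det A) (\det B).
Proof.
move=> AB; rewrite /determinant.
apply: (big_ind2 (eqvmod q)) => [||s _].
- by exists 0; rewrite subrr mulr0.
- move=> a b a' b' [t h] [t' h']; exists (t + t').
  by rewrite mulrDr -h -h' opprD addrACA.
have [t h] : eqvmod q (\prod_i A i (s i)) (\prod_i B i (s i)).
  apply: (big_ind2 (eqvmod q)) => [||i _] //.
    by exists 0; rewrite subrr mulr0.
  move=> a b a' b' [t h] [t' h']; exists (t * a' + b * t').
  by rewrite mulrDr mulrA -h mulrCA -h'; ring.
by exists ((-1) ^+ s * t); rewrite -mulrBr h mulrCA.
Qed.

Lemma vars_in_const p : vars_in set0 p -> p = (p@_0%MM)%:MP.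
Proof.
move=> hp; apply/mpolyP => m; rewrite mcoeffC.
have [->|m0] := eqVneq m 0%MM; first by rewrite mulr1.
rewrite mulr0 memN_msupp_eq0 //; apply/negP => mp; case/eqP: m0; apply/mnmP => v.
by rewrite mnm0E; apply: hp; rewrite ?inE.
Qed.

Lemma algebraic_relation W v : v \notin W -> ~ independent (v |: W) ->
  exists e (a : nat -> S), [/\ a e != 0, forall i, vars_in W (a i) &
    nn (\sum_(i < e.+1) a i * 'X_v ^+ i)].
Proof.
move=> vW; rewrite /independent => /boolp.existsNP[q].
move=> /boolp.not_implyP[qW /boolp.not_implyP[nnq /eqP q0]].
have ex : exists i, (i < msize q)%N && (vcoef v i q != 0).
  apply: boolp.contrapT => h; case/eqP: q0; rewrite (vcoef_sum v q) big1 // => i _.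
  have [->|ne] := eqVneq (vcoef v i q) 0; first by rewrite mul0r.
  by case: h; exists (i : nat); rewrite ltn_ord.
have ub i : (i < msize q)%N && (vcoef v i q != 0) -> (i <= msize q)%N.
  by case/andP => /ltnW.
case: (ex_maxnP ex ub) => e /andP[ltq ae] emax.
exists e, (fun i => vcoef v i q); split=> // [i|]; first exact: vars_in_vcoef.
move: nnq; rewrite {1}(vcoef_sum v q) -!(big_mkord xpredT (fun i => vcoef v i q * 'X_v ^+ i)).
rewrite (big_cat_nat (leq0n e.+1) ltq) /= [X in _ + X]big_nat [X in _ + X]big1 ?addr0 // => i /andP[ei iq].
have [->|ne] := eqVneq (vcoef v i q) 0; first by rewrite mul0r.
by have := emax i; rewrite iq ne => /(_ isT); rewrite leqNgt ei.
Qed.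

Lemma maximal_independent : exists W, independent W /\
  forall v, v \notin W -> ~ independent (v |: W).
Proof.
pose ind W := boolp.asbool (independent W).
have ind0 : ind set0.
  apply/boolp.asboolP => q /vars_in_const -> nnc.
  have [c0|c0] := eqVneq q@_0%MM 0; first by rewrite c0 mpolyC0.
  have [[_ _ nM] n1 _] := nn_prime; case: n1.
  by have := nM (q@_0%MM)^-1%:MP _ nnc; rewrite -mpolyCM mulVf.
have [W indW Wmax] := @arg_maxnP _ set0 ind (fun W => #|W|) ind0.
exists W; split; first by apply/boolp.asboolP.
move=> v vW indv; have := Wmax (v |: W); rewrite /ind.
move=> /(_ (boolp.asboolT indv)) /=; by rewrite cardsU1 vW add1n ltnn.
Qed.

(** Modulo q the product X_w g is -1, so if q divided a power of g it would divide 1. Then q would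
    be constant, forcing X_w g = 0. *)
Lemma unit_dvd_exp q g w r : g != 0 -> q = 1 + 'X_w * g ->
  ~ exists t, q * t = g ^+ r.
Proof.
move=> g0 qE [t qt].
have q00 : q@_0%MM = 1.
  rewrite qE mcoeffD mcoeff1 eqxx mcoeffXM; case: ifP => [/mnm_lepP/(_ w)|_].
    by rewrite mnm1E mnm0E eqxx.
  by rewrite addr0.
have Xg : 'X_w * g = q - 1 by rewrite qE addrC addKr.
have [s hs] : exists s, q * s = (-1) ^+ r.
  have [u hu] : exists u, (q - 1) ^+ r - (-1) ^+ r = q * u.
    elim: r {qt t} => [|r [u hu]]; first by exists 0; rewrite !expr0 subrr mulr0.
    exists ((q - 1) ^+ r - u); rewrite mulrBr -hu !exprS; ring.
  exists ('X_w ^+ r * t - u); rewrite mulrBr -hu mulrCA qt -exprMn.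
  by rewrite Xg opprB addrC subrK.
have u1 : q * (s * (-1) ^+ r) = 1 by rewrite mulrA hs -exprD addnn -mul2n exprM sqrrN !expr1n.
have q0 : q != 0 by apply/eqP => h; move: u1; rewrite h mul0r => /eqP; rewrite eq_sym oner_eq0.
have s0 : s * (-1) ^+ r != 0.
  by apply/eqP => h; move: u1; rewrite h mulr0 => /eqP; rewrite eq_sym oner_eq0.
have : msize q = 1%N.
  have := congr1 (fun p : S => msize p) u1; rewrite msizeM // msize1.
  have : (0 < msize q)%N by rewrite lt0n mmeasure_poly_eq0.
  have : (0 < msize (s * (-1) ^+ r))%N by rewrite lt0n mmeasure_poly_eq0.
  by move: (msize q) (msize _) => a b; lia.
move=> /eqP sz; have /msize1_polyC qC : (msize q <= 1)%N by rewrite (eqP sz).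
have : 'X_w * g = 0 by rewrite Xg qC q00 mpolyC1 subrr.
move/eqP; rewrite mulf_eq0 (negPf g0) orbF => /eqP X0.
by have := congr1 (fun p : S => p@_U_(w)) X0; rewrite mcoeffX eqxx mcoeff0 => /eqP; rewrite oner_eq0.
Qed.

(** If a maximal independent set W contained w, then q = 1 + X_w g would be invertible modulo [nn],
    and a determinant argument on the finite module over k[X_W][1/g] would make q divide a power of
    g. So W is empty and g is a nonzero constant. *)
Lemma finite_dimensional :
  exists L, forall p, exists c : 'I_(size L) -> k, nn (p - \sum_i c i *: L`_i).
Proof.
have [W [indW maxW]] := maximal_independent.
have [n0 nD nM] := nn_ideal.
have relE v : exists e, exists a : nat -> S, v \notin W ->
   [/\ a e != 0, forall i, vars_in W (a i) & nn (\sum_(i < e.+1) a i * 'X_v ^+ i)].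
  case: (boolP (v \in W)) => [_|vW]; first by exists 0%N, (fun=> 0).
  by have [e [a h]] := algebraic_relation vW (maxW v vW); exists e, a.
have [e /fin_all_exists[a ha]] := fin_all_exists relE.
pose g := \prod_(v | v \notin W) a v (e v).
pose g' v := \prod_(u | (u \notin W) && (u != v)) a u (e u).
have gE v : v \notin W -> g = g' v * a v (e v).
  by move=> vW; rewrite /g (bigD1 v) //= mulrC.
have g0 : g != 0 by apply/prodf_neq0 => v vW; case: (ha v vW).
have gW : vars_in W g by apply: vars_in_prod => v vW; case: (ha v vW).
have g'W v : vars_in W (g' v).
  by apply: vars_in_prod => u /andP[uW _]; case: (ha u uW).
have [||L hL] := @module_finite W g e (fun v i => - (g' v * a v i)) gW.
- by move=> v i vW; apply: vars_inN; apply: vars_inM => //; case: (ha v vW).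
- move=> v vW; have [_ _ rel] := ha v vW.
  have := nM (g' v) _ rel; rewrite big_ord_recr /= mulrDr mulr_sumr addrC.
  rewrite mulrA -gE //; congr nn; congr (_ + _); rewrite -sumrN.
  by apply: eq_bigr => j _; rewrite mulNr opprK mulrA.
have W0 : W = set0.
  apply/eqP; apply/set0Pn => [[w wW]].
  pose q := 1 + 'X_w * g.
  have qW : vars_in W q.
    apply: vars_inD; first exact: vars_in1.
    apply: vars_inM => // v vW m; rewrite msuppX inE => /eqP->.
    by rewrite mnm1E; case: eqP => // wv; rewrite -wv wW in vW.
  have nq : ~ nn q.
    move/(indW _ qW)/(congr1 (fun p : S => p@_0%MM)); rewrite mcoeffD mcoeff1 eqxx mcoeff0.
    rewrite mcoeffXM; case: ifP => [/mnm_lepP/(_ w)|_]; first by rewrite mnm1E mnm0E eqxx.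
    by rewrite addr0 => /eqP; rewrite oner_eq0.
  have [p qp] := maximal_inv nn_max nq.
  have [N0 hN0] := fin_all_exists (fun j : 'I_(size L) => hL (p * L`_j)).
  pose N := (\sum_j N0 j)%N.
  have hN (j : 'I_(size L)) : Wspan W L (g ^+ N * (p * L`_j)).
    rewrite /N (bigD1 j) //= addnC exprD -mulrA; apply: WspanM; last exact: hN0.
    exact: vars_inX.
  have [c hc] := fin_all_exists hN.
  (* Since q p = 1 modulo [nn], this matrix annihilates the generators. Its determinant therefore
     lies in [nn] up to a power of g, and being a polynomial in X_W it is zero. *)
  pose M : 'M[S]_(size L) := \matrix_(j, i) ((if j == i then g ^+ N else 0) - q * c j i).
  have ML (j : 'I_(size L)) : nn (\sum_i M j i * L`_i).
    have -> : \sum_i M j i * L`_i = g ^+ N * L`_j - q * \sum_i c j i * L`_i.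
      under eq_bigr do rewrite mxE mulrBl -mulrA.
      rewrite sumrB -mulr_sumr; congr (_ - _).
      rewrite (bigD1 j) //= eqxx big1 ?addr0 // => i; rewrite eq_sym => /negPf->.
      by rewrite mul0r.
    have [_ h] := hc j.
    have -> : g ^+ N * L`_j - q * \sum_i c j i * L`_i =
      q * (g ^+ N * (p * L`_j) - \sum_i c j i * L`_i) + (- (g ^+ N * L`_j)) * (q * p - 1).
      by ring.
    by apply: (nD); apply: (nM).
  have dL (i : 'I_(size L)) : nn (\det M * L`_i).
    have -> : \det M * L`_i = \sum_j (\adj M) i j * (\sum_l M j l * L`_l).
      under eq_bigr do rewrite mulr_sumr; rewrite exchange_big /=.
      have E l : \sum_j (\adj M) i j * (M j l * L`_l) = (\det M)%:M i l * L`_l.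
        by rewrite -mul_adj_mx mxE mulr_suml; apply: eq_bigr => j _; rewrite mulrA.
      under eq_bigr do rewrite E mxE.
      rewrite (bigD1 i) //= eqxx mulr1n big1 ?addr0 // => l; rewrite eq_sym => /negPf->.
      by rewrite mulr0n mul0r.
    by apply: ideal_sum => // j _; apply: nM.
  have MW : vars_in W (\det M).
    apply: vars_in_sum => s _; apply: vars_inM.
      by apply: vars_inX; apply: vars_inN; apply: vars_in1.
    apply: vars_in_prod => j _; rewrite mxE; apply: vars_inD.
      by case: ifP => _; [apply: vars_inX | apply: vars_in0].
    by apply: vars_inN; apply: vars_inM => //; case: (hc j).
  have [N1 [c1 [c1W h1]]] := hL 1.
  have : nn (\det M * g ^+ N1).
    have -> : \det M * g ^+ N1 = \det M * (g ^+ N1 * 1 - \sum_i c1 i * L`_i)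
       + \sum_i c1 i * (\det M * L`_i).
      rewrite mulrBr mulr1 (_ : \sum_i c1 i * (\det M * L`_i) = \det M * \sum_i c1 i * L`_i).
        by rewrite subrK.
      by rewrite mulr_sumr; apply: eq_bigr => i _; rewrite mulrCA.
    by apply: (nD); [exact: nM | apply: ideal_sum => // i _; exact: nM].
  move/(indW _ (vars_inM MW (@vars_inX W g N1 gW)))/eqP.
  rewrite mulf_eq0 expf_eq0 (negPf g0) andbF orbF => /eqP det0.
  (* Modulo q the matrix is the scalar g^N, so q would divide a power of g. *)
  have : eqvmod q (\det M) (\det ((g ^+ N)%:M : 'M[S]_(size L))).
    apply: det_eqvmod => j i; rewrite !mxE; exists (- c j i).
    by case: eqP => _; rewrite ?mulr1n ?mulr0n mulrN; ring.
  rewrite det0 det_scalar -exprM => -[t]; rewrite sub0r => ht.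
  apply: (@unit_dvd_exp q g w (N * size L) g0 erefl).
  by exists (- t); rewrite mulrN -ht opprK.
exists L => p; have [N [c [cW hc]]] := hL p.
have gC : g = (g@_0%MM)%:MP by apply: vars_in_const; rewrite -W0.
have g00 : g@_0%MM != 0 by apply: contra g0 => /eqP h; rewrite gC h mpolyC0.
exists (fun i => (g@_0%MM) ^- N * (c i)@_0%MM).
have gN : ((g@_0%MM) ^- N)%:MP * (g@_0%MM)%:MP ^+ N = 1 :> S.
  by move: g00; move: (g@_0%MM) => b b0; rewrite -rmorphXn /= -mpolyCM mulVf ?expf_neq0 // mpolyC1.
rewrite -gC in gN.
have := nM (((g@_0%MM) ^- N)%:MP) _ hc; congr nn.
rewrite mulrBr mulrA gN mul1r; congr (_ - _).
rewrite mulr_sumr; apply: eq_bigr => i _.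
have cC : c i = ((c i)@_0%MM)%:MP by apply: vars_in_const; rewrite -W0.
by rewrite mulrA [in LHS]cC -mpolyCM mul_mpolyC.
Qed.

(** The powers of p up to [size L] outnumber the generators L of the residue field over k. *)
Lemma zariski p : exists (r : nat) (l : 'I_r.+1 -> k),
  (exists i, l i != 0) /\ nn (\sum_(i < r.+1) l i *: p ^+ i).
Proof.
have [L hL] := finite_dimensional; have [n0 nD nM] := nn_ideal.
exists (size L).
apply: (@linear_dependence k S 'I_(size L).+1 'I_(size L) (fun i => p ^+ i)
   (fun i => L`_i) nn n0 nD).
- by move=> c a na; rewrite -mul_mpolyC; apply: nM.
- by rewrite !card_ord.
- by move=> i; apply: hL.
Qed.

End Zariski.

(** * Degeneration of the algebra to its discrete counterpart *)

Section Degeneration.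
Variables (k : fieldType) (n : nat) (A : comNzRingType).
Local Notation S := {mpoly k[n]}.
Variables (Sg : 'X_{1..n} -> Prop) (cr : {set 'I_n}).
Hypothesis SgP : forall m m' : 'X_{1..n}, Sg m ->
  (forall i, i \in cr -> (0 < m i)%N -> (0 < m' i)%N) -> Sg m'.
Implicit Types (p r : S) (m u b : 'X_{1..n}) (Q : pred 'X_{1..n}) (h : 'I_n).
Implicit Types (U : {set 'I_n}) (z y t e : {set 'I_n} -> S) (q s : nat).
Local Notation X := (fun h : 'I_n => 'X_h : S).

Definition wt (f : 'I_n -> nat) m := (\sum_i m i * f i)%N.

Lemma wtD f m u : wt f (m + u)%MM = (wt f m + wt f u)%N.
Proof. by rewrite -big_split; apply: eq_bigr => i _; rewrite mnmDE mulnDl. Qed.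

Lemma leq_wt f m u : (forall i, m i <= u i)%N -> (wt f m <= wt f u)%N.
Proof. by move=> mu; apply: leq_sum => i _; rewrite leq_mul2r mu orbT. Qed.

Variables (ev : {rmorphism S -> A}) (w dg : 'I_n -> nat).
Hypothesis dg_gt0 : forall i, (0 < dg i)%N.
Hypothesis straighten : forall m, Sg m -> exists p, ev 'X_[m] = ev p /\
  {in msupp p, forall m', wt dg m' = wt dg m /\ (wt w m < wt w m')%N}.
Hypothesis std_free : forall p, {in msupp p, forall m, ~ Sg m} -> ev p = 0 -> p = 0.

(** Straightening fixes the degree and raises the weight; this bound is what makes it terminate. *)
Lemma wt_bound m : (wt w m <= (\sum_i w i) * wt dg m)%N.
Proof.
rewrite big_distrl /=; apply: leq_sum => i _; rewrite mulnC leq_mul2l.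
apply/orP; right; rewrite /wt (bigD1 i) //=.
by apply: leq_trans (leq_addr _ _); rewrite leq_pmulr.
Qed.

Lemma ev_rewrite (T : 'X_{1..n} -> 'X_{1..n} -> Prop) (D : 'X_{1..n} -> Prop) p :
    {in msupp p, forall m, exists r, ev 'X_[m] = ev r /\
       {in msupp r, forall m', T m m' /\ D m'}} ->
  exists r, ev p = ev r /\ {in msupp r, forall m', D m' /\ exists2 m, m \in msupp p & T m m'}.
Proof.
move=> hp.
have /boolp.choice[f hf] : forall m, exists r, m \in msupp p ->
   ev 'X_[m] = ev r /\ {in msupp r, forall m', T m m' /\ D m'}.
  move=> m; case: (boolP (m \in msupp p)) => [/hp[r hr]|_]; last by exists 0.
  by exists r.
exists (\sum_(m <- msupp p) (p@_m)%:MP * f m); split.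
  rewrite {1}(mpolyE p) !rmorph_sum /=; apply: eq_big_seq => m mp.
  by rewrite -mul_mpolyC !rmorphM /=; have [-> _] := hf m mp.
move=> m' /msupp_sum_le /flattenP[s /mapP[m]]; rewrite filter_predT => mp ->.
rewrite mul_mpolyC => /msuppZ_le m'f; have [_ /(_ m' m'f)[Tm Dm]] := hf m mp.
by split=> //; exists m.
Qed.

Lemma standardize p : exists r, ev p = ev r /\ {in msupp r, forall m', ~ Sg m' /\
  exists2 m, m \in msupp p & wt dg m' = wt dg m /\ (wt w m <= wt w m')%N}.
Proof.
apply: (@ev_rewrite (fun m m' => wt dg m' = wt dg m /\ (wt w m <= wt w m')%N)
          (fun m' => ~ Sg m')) => m _.
move E: ((\sum_i w i) * wt dg m - wt w m)%N => N.
elim/ltn_ind: N m E => N IH m E.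
case: (boolp.EM (Sg m)) => [Sm|nSm]; last first.
  by exists 'X_[m]; split=> // m'; rewrite msuppX inE => /eqP->.
have [p1 [-> hp1]] := straighten Sm.
have [|r [-> hr]] := @ev_rewrite (fun m m' => wt dg m' = wt dg m /\ (wt w m <= wt w m')%N)
          (fun m' => ~ Sg m') p1.
  move=> m1 /hp1[d1 w1]; apply: (IH _ _ m1 erefl).
  by have := wt_bound m; have := wt_bound m1; rewrite d1; lia.
exists r; split=> // m' /hr[nS [m1 /hp1[d1 w1] [d2 w2]]]; split=> //.
by split; [rewrite d2 | lia].
Qed.

Lemma lift_monI p : monI Sg p -> exists r, ev p = ev r /\ {in msupp r, forall m',
  exists2 m, m \in msupp p & wt dg m' = wt dg m /\ (wt w m < wt w m')%N}.
Proof.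
move=> hp.
have [m /hp /straighten[r [e hr]]|r [e hr]] := @ev_rewrite
  (fun m m' => wt dg m' = wt dg m /\ (wt w m < wt w m')%N) (fun=> True) p.
  by exists r; split=> // m' /hr.
by exists r; split=> // m' /hr[].
Qed.

(** The associated graded ring of A has no relations beyond the monomial ones: the standard part of
    p has a standard representative of strictly larger weight, and by uniqueness it vanishes. The
    shift c accommodates the weight of an exterior basis element. *)
Lemma lead_monI c s p p' : {in msupp p, forall m, wt w m + c = s}%N ->
  {in msupp p', forall m, (s < wt w m + c)%N} -> ev p = ev p' -> monI Sg p.
Proof.
move=> hp hp' e.
pose ps := mpart (fun m => ~~ boolp.asbool (Sg m)) p.
pose pn := mpart (fun m => boolp.asbool (Sg m)) p.
have pE : p = ps + pn.
  by apply/mpolyP => m; rewrite mcoeffD !mcoeff_mpart; case: (boolp.asbool _); rewrite ?addr0 ?add0r.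
have [m|p1 [e1 hp1]] := @lift_monI pn.
  by rewrite msupp_mpart => /andP[/boolp.asboolP].
have [r [e2 hr]] := standardize (p' - p1).
have w2 : {in msupp (p' - p1), forall m, (s < wt w m + c)%N}.
  move=> m /msuppB_le; rewrite mem_cat => /orP[/hp'//|/hp1[m0]].
  by rewrite msupp_mpart => /andP[_ /hp <-] [_]; rewrite ltn_add2r.
have r0 : ps - r = 0.
  apply: std_free => [m /msuppB_le|].
    rewrite mem_cat => /orP[|/hr[]//]; rewrite msupp_mpart.
    by case/andP => /boolp.asboolPn.
  by rewrite rmorphB /= -e2 rmorphB /= -e1 -e {1}pE rmorphD /=; ring.
have psr : ps = r by apply/eqP; rewrite -subr_eq0 r0.
have ps0 : ps = 0.
  apply/eqP; rewrite -msupp_eq0; case E: (msupp ps) => [//|m l].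
  have mps : m \in msupp ps by rewrite E mem_head.
  have := mps; rewrite {1}psr => /hr[_ [m0 /w2 w0 [_]]].
  by have := mps; rewrite msupp_mpart => /andP[_ /hp E1]; lia.
rewrite pE ps0 add0r => m; rewrite msupp_mpart.
by case/andP => /boolp.asboolP.
Qed.

Local Notation evX := (fun h : 'I_n => ev 'X_h).

Lemma ev_kdiff z U : ev (kdiff X z U) = kdiff evX (fun V => ev (z V)) U.
Proof.
rewrite /kdiff rmorph_sum /=; apply: eq_bigr => h _; rewrite rmorphM /=.
congr (_ * _); rewrite /contract; case: ifP => _; first by rewrite rmorph0.
by rewrite rmorphM rmorph_sign.
Qed.

Lemma kbound_csupp Q q z : csupp Q z -> kbound X (monI Sg) q z ->
  exists y, [/\ hdeg q.+1 y, csupp Q y & forall U, monI Sg (z U - kdiff X y U)].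
Proof.
move=> sz [y [hy Jy]]; exists (cpart Q y); split; first exact: hdeg_cpart.
  exact: csupp_cpart.
move=> U; rewrite kdiff_cpart -(cpart_id sz U) -mpartB.
exact: monI_mpart.
Qed.

Lemma csuppD Q z y : csupp Q z -> csupp Q y -> csupp Q (fun U => z U + y U).
Proof.
by move=> hz hy U m /msuppD_le; rewrite mem_cat => /orP[]; [apply: hz | apply: hy].
Qed.

Lemma csuppB Q z y : csupp Q z -> csupp Q y -> csupp Q (fun U => z U - y U).
Proof.
by move=> hz hy U m /msuppB_le; rewrite mem_cat => /orP[]; [apply: hz | apply: hy].
Qed.

Lemma csuppW (Q Q' : pred 'X_{1..n}) z :
  csupp Q z -> (forall b, Q b -> Q' b) -> csupp Q' z.
Proof. by move=> hz QQ U m /hz /QQ. Qed.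

Lemma cpart_split Q z U : z U = cpart Q z U + cpart (predC Q) z U.
Proof.
apply/mpolyP => m; rewrite mcoeffD !mcoeff_mpart /=.
by case: ifP => /=; rewrite ?addr0 ?add0r.
Qed.

Lemma csupp_cpartI Q Q' z : csupp Q z -> csupp (predI Q Q') (cpart Q' z).
Proof. by move=> hz U m; rewrite msupp_mpart /= => /andP[-> /hz ->]. Qed.

Definition top_wt := wt w (mesym1 cr).

(** A multidegree heavier than 1_core has an exponent above one on the core or a positive one off
    it, so [kbound_large] applies. *)
Lemma kbound_top q e : kcycle X (monI Sg) q e ->
  csupp (fun b => top_wt < wt w b)%N e -> kbound X (monI Sg) q e.
Proof.
move=> ce se; apply: (kbound_parts SgP) => b.
case: (ltnP top_wt (wt w b)) => [lt|ge]; last first.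
  exists (fun=> 0); split=> // U; rewrite /kdiff big1 => [|h _]; last first.
    by rewrite /contract; case: ifP; rewrite ?mulr0.
  rewrite subr0 (_ : cpart _ e U = 0); first by case: (monI_ideal k SgP).
  apply: mpart_none => m /se; apply: contraL => /eqP ->.
  by rewrite -leqNgt.
have [h hb] : exists h, ((h \in cr) ==> (1 < b h)%N) && (0 < b h)%N.
  apply: boolp.contrapT => nex; move: lt; rewrite ltnNge => /negP; apply.
  apply: leq_wt => i; rewrite mnmE; case: (boolP (i \in cr)) => icr.
    by rewrite leqNgt; apply/negP => lt; apply: nex; exists i; rewrite icr lt (ltnW lt).
  by rewrite leqNgt; apply/negP => lt; apply: nex; exists i; rewrite (negPf icr) lt.
apply: (@kbound_large _ _ _ _ SgP h); first exact: kcycle_cpart.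
by apply: csuppW (@csupp_cpart _ _ (pred1 b) e) _ => b' /eqP->.
Qed.

(** Straightening the coefficients raises the weight and keeps the degree. D records the degree
    where termination depends on it and is trivial elsewhere. *)
Lemma lift_chain q (D : pred nat) s z : hdeg q z -> (forall U, monI Sg (z U)) ->
    csupp (fun b => D (wt dg b) && (wt w b == s)) z ->
  exists y, [/\ hdeg q y, csupp (fun b => D (wt dg b) && (s < wt w b)%N) y
    & forall U, ev (z U) = ev (y U)].
Proof.
move=> hz Jz sz; have [y hy] := fin_all_exists (fun U => lift_monI (Jz U)).
exists y; split; last by move=> U; case: (hy U).
  move=> U Uq; apply/eqP; rewrite -msupp_eq0; case E: (msupp (y U)) => [//|m l].
  have [_ /(_ m)] := hy U; rewrite E mem_head hz // => /(_ isT)[m0].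
  by rewrite msupp0.
move=> U m; have [_ h] := hy U; move=> /h[m0 /sz /andP[Dm /eqP wm] [d1 w1]].
by move: Dm wm; rewrite !wtD d1 => -> <-; rewrite /= ltn_add2r.
Qed.

Lemma lead_chain s z y : csupp (fun b => s <= wt w b)%N z ->
    csupp (fun b => s < wt w b)%N y -> (forall U, ev (z U) = ev (y U)) ->
  forall U, monI Sg (cpart (fun b => wt w b == s) z U).
Proof.
move=> sz sy e U.
pose rest := cpart (predC (fun b => wt w b == s)) z.
have srest : csupp (fun b => s < wt w b)%N rest.
  have h := @csupp_cpartI _ (predC (fun b => wt w b == s)) _ sz.
  apply: csuppW h _ => b /= /andP[le ne].
  by rewrite ltn_neqAle eq_sym ne.
apply: (@lead_monI (wt w (mesym1 U)) s _ (y U - rest U)).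
- by move=> m; rewrite msupp_mpart => /andP[/eqP <- _]; rewrite wtD.
- by move=> m /(csuppB sy srest); rewrite wtD.
by rewrite rmorphB /= -e {1}(cpart_split (fun b => wt w b == s) z U) rmorphD addrK.
Qed.

(** The part of weight s is a cycle over A_dis above the top weight, hence bounds there; what
    remains after subtracting the boundary straightens to larger weight. *)
Lemma lift_cycle_step q E s e : (top_wt < s)%N -> hdeg q e ->
    csupp (fun b => (wt dg b == E) && (s <= wt w b)%N) e ->
    (forall U, ev (kdiff X e U) = 0) ->
  exists y e', [/\ hdeg q.+1 y, hdeg q e',
    csupp (fun b => (wt dg b == E) && (s <= wt w b)%N) y,
    csupp (fun b => (wt dg b == E) && (s < wt w b)%N) e' &
    forall U, ev (e U) = ev (kdiff X y U) + ev (e' U)].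
Proof.
move=> ls he se ce.
pose Q := [pred b | (wt dg b == E) && (wt w b == s)].
pose es := cpart (fun b => wt w b == s) e.
have ses : csupp Q es.
  by apply: csuppW (@csupp_cpartI _ (fun b => wt w b == s) _ se) _ => b /= /andP[/andP[-> _] ->].
have hes : hdeg q es by apply: hdeg_cpart.
have ces : kcycle X (monI Sg) q es.
  split=> // U; rewrite kdiff_cpart.
  apply: (@lead_chain s (kdiff X e) (fun=> 0)) => [||V]; last by rewrite ce rmorph0.
    by apply: csupp_kdiff; apply: csuppW se _ => b /andP[].
  by move=> V m; rewrite msupp0.
have [|y [hy sy Jy]] := kbound_csupp ses (kbound_top ces _).
  by apply: csuppW ses _ => b /= /andP[_ /eqP ->].
have [||sg [hsg ssg esg]] := @lift_chain q (pred1 E) s (fun U => es U - kdiff X y U) _ Jy.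
- by apply: hdegB => //; apply: hdeg_kdiff.
- by apply: csuppB => //; apply: csupp_kdiff.
exists y, (fun U => e U - es U + sg U); split=> //.
- by apply: hdegD => //; apply: hdegB.
- by apply: csuppW sy _ => b /= /andP[-> /eqP->] /=.
- apply: csuppD => //.
  have E1 : (fun U => e U - es U) =1 cpart (predC (fun b => wt w b == s)) e.
    by move=> U; rewrite {1}(cpart_split (fun b => wt w b == s) e U) addrC addKr.
  move=> U m; rewrite E1 => /(@csupp_cpartI _ (predC (fun b => wt w b == s)) _ se) /=.
  by move=> /andP[/andP[-> le] ne]; rewrite ltn_neqAle eq_sym ne.
move=> U; rewrite rmorphD /= -esg !rmorphB /=.
by ring.
Qed.

(** Iterates the preceding step. Chains of degree E have weight at most B, so nothing remains once s
    exceeds B. *)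
Lemma lift_cycle q E s e : (top_wt < s)%N -> hdeg q e ->
    csupp (fun b => (wt dg b == E) && (s <= wt w b)%N) e ->
    (forall U, ev (kdiff X e U) = 0) ->
  exists y, [/\ hdeg q.+1 y, csupp (fun b => s <= wt w b)%N y &
    forall U, ev (e U) = ev (kdiff X y U)].
Proof.
pose B := ((\sum_i w i) * E)%N.
move EN: (B.+1 - s)%N => N; elim: N s e EN => [|N IH] s e EN ls he se ce.
  have e0 U : e U = 0.
    apply/eqP; rewrite -msupp_eq0; case Em: (msupp (e U)) => [//|m l].
    have /andP[/eqP d1 w1] : (wt dg (m + mesym1 U)%MM == E) && (s <= wt w (m + mesym1 U)%MM)%N.
      by apply: (se U); rewrite Em mem_head.
    by have := wt_bound (m + mesym1 U); rewrite d1 -/B; lia.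
  exists (fun=> 0); split=> // [U m|U]; first by rewrite msupp0.
  rewrite e0 /kdiff big1 // => h _; rewrite /contract.
  by case: ifP; rewrite ?mulr0.
have [y [e' [hy he' sy se' ee]]] := lift_cycle_step ls he se ce.
have [|||||y' [hy' sy' ey']] := IH s.+1 e'.
- by lia.
- exact: ltnW.
- exact: he'.
- exact: se'.
- move=> U; rewrite ev_kdiff; have := ce U; rewrite ev_kdiff.
  rewrite (eq_kdiff _ ee) kdiffD (_ : kdiff _ (fun V => ev (kdiff X y V)) U = 0) ?add0r //.
  by rewrite -ev_kdiff kdiffK rmorph0.
exists (fun U => y U + y' U); split.
- exact: hdegD.
- apply: csuppD; first by apply: csuppW sy _ => b /andP[].
  by apply: csuppW sy' _ => b /ltnW.
by move=> U; rewrite kdiffD rmorphD /= ee ey'.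
Qed.

Hypothesis ev_surj : forall a, exists p, ev p = a.

(* A class of top weight lifts to a cycle over A, the obstructions living in
   degrees where the homology of A_dis vanishes; over A it is a boundary, and a
   chain bounding it can be pushed up to the same weight because the next
   homology of A_dis vanishes. *)
Lemma kbound_degeneration q z : kcycle X (monI Sg) q z ->
    csupp (pred1 (mesym1 cr)) z -> kills 1 X (monI Sg) q.+1 ->
    kills 1 evX (fun a => a = 0) q ->
  kbound X (monI Sg) q z.
Proof.
move=> [hz Jz] sz k1 kA.
pose E := wt dg (mesym1 cr); pose s0 := top_wt.
have szw : csupp (fun b => (wt dg b == E) && (wt w b == s0)) z.
  by apply: csuppW sz _ => b /eqP->; rewrite !eqxx.
(* Over A, d z equals a heavier chain that is itself a cycle, hence the boundary of a heavy y; z - y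
   is then a cycle over A. For q = 0 the differential vanishes and y = 0. *)
have [y [hy sy ey]] : exists y, [/\ hdeg q y, csupp (fun b => s0 < wt w b)%N y &
    forall U, ev (kdiff X z U) = ev (kdiff X y U)].
  case: q hz Jz k1 kA => [|q] hz Jz _ _.
    exists (fun=> 0); split=> // [U m|U]; first by rewrite msupp0.
    rewrite /kdiff !big1 // => h _; rewrite /contract; case: ifP; rewrite ?mulr0 // => hU.
    by rewrite hz ?mulr0 // cardsU1 hU.
  have [||e0 [he0 se0 ee0]] := @lift_chain q (pred1 E) s0 (kdiff X z) _ Jz.
  - exact: hdeg_kdiff.
  - exact: csupp_kdiff.
  have [||y [hy sy ey]] := @lift_cycle q E s0.+1 e0 (ltnSn _) he0; first exact: se0.
    move=> U; rewrite ev_kdiff -(eq_kdiff _ ee0) -ev_kdiff kdiffK rmorph0 //.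
  by exists y; split=> // U; rewrite ee0.
pose z' U := z U - y U.
have hz' : hdeg q z' by apply: hdegB.
have [|t0 [ht0 et0]] := kA (fun U => ev (z' U)).
  split=> [U Uq|U]; first by rewrite hz' // rmorph0.
  by rewrite -ev_kdiff kdiffB rmorphB /= ey subrr.
have [t1 ht1] := fin_all_exists (fun U => ev_surj (t0 U)).
pose t2 U := if #|U| == q.+1 then t1 U else 0.
have et2 U : ev (kdiff X t2 U) = ev (z' U).
  rewrite ev_kdiff; have -> : kdiff evX (fun V => ev (t2 V)) U = kdiff evX t0 U.
    apply: eq_kdiff => V; rewrite /t2; case: eqP => [_|/eqP Vq]; first exact: ht1.
    by rewrite ht0 // rmorph0.
  by have /eqP := et0 U; rewrite mul1r subr_eq0 => /eqP ->.
(* The bounding chain is raised one weight at a time. Below s0 its lightest part is a cycle over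
   A_dis, since z - y starts at weight s0, and H_(q+1) = 0 lets it be replaced by heavier terms. *)
have down s : (s <= s0)%N -> exists t, [/\ hdeg q.+1 t, csupp (fun b => s <= wt w b)%N t &
    forall U, ev (kdiff X t U) = ev (z' U)].
  elim: s => [|s IH] les.
    by exists t2; split=> // U Uq; rewrite /t2 (negPf Uq).
  have [t [ht st et]] := IH (ltnW les).
  pose top_seq := cpart (fun b => wt w b == s) t.
  have sts : csupp (fun b => wt w b == s) top_seq by apply: csupp_cpart.
  have cts : kcycle X (monI Sg) q.+1 top_seq.
    split; first exact: hdeg_cpart.
    move=> U; rewrite kdiff_cpart.
    apply: (@lead_chain s (kdiff X t) z') => //; first exact: csupp_kdiff.
    apply: csuppB; last by apply: csuppW sy _ => b /(ltn_trans les).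
    by apply: csuppW szw _ => b /andP[_ /eqP->].
  have [|v [hv sv Jv]] := @kbound_csupp (fun b => wt w b == s) q.+1 top_seq sts.
    have := k1 top_seq cts; apply: (kbound_congr (monI_ideal k SgP)).
    by move=> U; rewrite mul1r subrr; case: (monI_ideal k SgP).
  have [||j [hj sj ej]] := @lift_chain q.+1 predT s (fun U => top_seq U - kdiff X v U) _ Jv.
  - by apply: hdegB; [apply: hdeg_cpart | apply: hdeg_kdiff].
  - by apply: csuppB => //; apply: csupp_kdiff.
  exists (fun U => t U - top_seq U + j U); split.
  - by apply: hdegD => //; apply: hdegB => //; apply: hdeg_cpart.
  - apply: csuppD; last by apply: csuppW sj _ => b /andP[].
    have E1 : (fun U => t U - top_seq U) =1 cpart (predC (fun b => wt w b == s)) t.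
      by move=> U; rewrite {1}(cpart_split (fun b => wt w b == s) t U) addrC addKr.
    move=> U m; rewrite E1 => /(@csupp_cpartI _ (predC (fun b => wt w b == s)) _ st) /=.
    by move=> /andP[le ne]; rewrite ltn_neqAle eq_sym ne.
  move=> U; rewrite -et !ev_kdiff.
  have -> : kdiff evX (fun V => ev (t V)) U =
     kdiff evX (fun V => ev (t V - top_seq V + j V) + ev (kdiff X v V)) U.
    apply: eq_kdiff => V; rewrite rmorphD /= -ej !rmorphB /=; ring.
  rewrite kdiffD (_ : kdiff _ (fun V => ev (kdiff X v V)) U = 0) ?addr0 //.
  by rewrite -ev_kdiff kdiffK rmorph0.
have [t [ht st et]] := down s0 (leqnn _).
(* Over A, z - d t equals the heavier chain y, so its part of weight s0 vanishes over A_dis. *)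
have h1 : forall U, monI Sg (cpart (fun b => wt w b == s0) (fun U => z U - kdiff X t U) U).
  apply: (@lead_chain s0 _ y) => //.
    apply: csuppB; last exact: csupp_kdiff.
    by apply: csuppW szw _ => b /andP[_ /eqP->].
  by move=> U; rewrite !rmorphB /= et rmorphB /=; ring.
exists (cpart (fun b => wt w b == s0) t); split; first exact: hdeg_cpart.
move=> U; rewrite kdiff_cpart; have := h1 U; rewrite /cpart mpartB mpart_id //.
by move=> m /szw /andP[].
Qed.

End Degeneration.

(** * Consequences of the Cohen-Macaulay property *)

Section CohenMacaulayA.
Variables (k : fieldType) (n : nat) (A : comAlgType k).
Local Notation S := {mpoly k[n]}.
Variable Sg : 'X_{1..n} -> Prop.
Implicit Types (p r : S) (m u b : 'X_{1..n}) (a : A).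
Variables (ev : {rmorphism S -> A}) (w dg : 'I_n -> nat).
Hypothesis evZ : forall (c : k) p, ev (c *: p) = c *: ev p.
Hypothesis dg_gt0 : forall i, (0 < dg i)%N.
Hypothesis straighten : forall m, Sg m -> exists p, ev 'X_[m] = ev p /\
  {in msupp p, forall m', wt dg m' = wt dg m /\ (wt w m < wt w m')%N}.
Hypothesis std_free : forall p, {in msupp p, forall m, ~ Sg m} -> ev p = 0 -> p = 0.
Hypothesis ev_surj : forall a, exists p, ev p = a.
Hypothesis Sg0 : ~ Sg 0%MM.
Local Notation evX := (fun h : 'I_n => ev 'X_h).

Lemma irrelevant_gen p : irrelevant p -> exists v : 'I_n -> S, p = \sum_h v h * 'X_h.
Proof.
rewrite /irrelevant => p0; rewrite (mpolyE p) big_seq.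
elim/big_ind: _ => [|_ _ [v ->] [v' ->]|m mp].
- by exists (fun=> 0); rewrite big1 // => h _; rewrite mul0r.
- exists (fun h => v h + v' h); rewrite -big_split.
  by apply: eq_bigr => h _; rewrite mulrDl.
have [h mh] : exists h, m h != 0%N.
  apply/existsP; rewrite -negb_forall; apply/negP => /forallP m0.
  have mE : m = 0%MM by apply/mnmP => i; rewrite mnm0E; apply/eqP.
  by move: mp; rewrite mE mcoeff_msupp p0 eqxx.
exists (fun i => if i == h then p@_m *: 'X_[m - U_(h)] else 0).
rewrite (bigD1 h) //= eqxx big1 => [|i /negPf->]; last by rewrite mul0r.
by rewrite addr0 -scalerAl -mpolyXD submK // lep1mP.
Qed.

Definition AG N a := exists p, {in msupp p, forall m, (N <= wt dg m)%N} /\ ev p = a.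

Lemma AG0 a : AG 0 a.
Proof. by have [p <-] := ev_surj a; exists p. Qed.

Lemma AGz N : AG N 0.
Proof. by exists 0; split=> [m|]; rewrite ?msupp0 ?rmorph0. Qed.

Lemma AGD N a a' : AG N a -> AG N a' -> AG N (a + a').
Proof.
move=> [p [hp <-]] [p' [hp' <-]]; exists (p + p'); split; last by rewrite rmorphD.
by move=> m /msuppD_le; rewrite mem_cat => /orP[/hp|/hp'].
Qed.

Lemma AGM N M a a' : AG N a -> AG M a' -> AG (N + M) (a * a').
Proof.
move=> [p [hp <-]] [p' [hp' <-]]; exists (p * p'); split; last by rewrite rmorphM.
move=> m /msuppM_le /allpairsP[[m1 m2] /= [/hp h1 /hp' h2 ->]].
by rewrite wtD leq_add.
Qed.

Lemma AGMl N a a' : AG N a' -> AG N (a * a').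
Proof. by move=> h; have := AGM (AG0 a) h. Qed.

Lemma AGZ N (c : k) a : AG N a -> AG N (c *: a).
Proof. by move=> h; rewrite -mulr_algl; apply: AGMl. Qed.

Lemma AG_sum N (I : Type) (s : seq I) (Q : pred I) (F : I -> A) :
  (forall i, Q i -> AG N (F i)) -> AG N (\sum_(i <- s | Q i) F i).
Proof. by move=> hF; elim/big_ind: _ => //; [exact: AGz | exact: AGD]. Qed.

Definition nA a := exists2 p, irrelevant p & ev p = a.

Lemma wt_gt0 m : m != 0%MM -> (0 < wt dg m)%N.
Proof.
apply: contraR; rewrite -leqNgt leqn0 sum_nat_eq0 => /forallP h.
apply/eqP/mnmP => i; have := h i; rewrite mnm0E muln_eq0.
by rewrite [dg i == _]eqn0Ngt dg_gt0 orbF => /eqP.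
Qed.

Lemma nA_AG a : nA a -> AG 1 a.
Proof.
move=> [p p0 <-]; exists p; split=> // m mp; apply: wt_gt0.
by apply/eqP => m0; move: mp; rewrite m0 mcoeff_msupp p0 eqxx.
Qed.

(** [standardize] preserves degrees and standard representatives are unique. *)
Lemma AG_std N p : {in msupp p, forall m, ~ Sg m} -> AG N (ev p) ->
  {in msupp p, forall m, (N <= wt dg m)%N}.
Proof.
move=> sp [p' [hp' e]].
have [r [er hr]] := standardize dg_gt0 straighten p'.
have pr : p = r.
  apply/eqP; rewrite -subr_eq0; apply/eqP; apply: std_free.
    by move=> m /msuppB_le; rewrite mem_cat => /orP[/sp|/hr[]].
  by rewrite rmorphB /= -er e subrr.
by rewrite pr => m /hr[_ [m0 /hp' le [-> _]]].
Qed.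

Lemma nA_ideal : is_ideal nA.
Proof.
have [[m0 mD mM] _ _] := irrelevant_maximal k n; split.
- by exists 0; rewrite ?rmorph0.
- by move=> _ _ [p hp <-] [q hq <-]; exists (p + q); rewrite ?rmorphD //; apply: mD.
- move=> a _ [p hp <-]; have [q <-] := ev_surj a; exists (q * p); rewrite ?rmorphM //.
  exact: mM.
Qed.

Lemma nA1 : ~ nA 1.
Proof.
move=> /nA_AG; rewrite -(rmorph1 ev) => /AG_std h.
have : (1 <= wt dg 0%MM)%N.
  apply: h; last by rewrite msupp1 inE.
  by move=> m; rewrite msupp1 inE => /eqP->.
by rewrite /wt big1 // => i _; rewrite mnm0E.
Qed.

(** Rescaled to constant term one, a differs from 1 by a combination of the generators. Such
    elements act invertibly on Koszul homology, which allows denominators to be removed. *)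
Lemma notin_nA a : ~ nA a -> exists t (v : 'I_n -> A), t * a = 1 - \sum_h v h * evX h.
Proof.
have [p <-] := ev_surj a => np.
have c0 : p@_0%MM != 0 by apply/eqP => h; apply: np; exists p.
have [|v hv] := @irrelevant_gen (1 - (p@_0%MM)^-1 *: p).
  by rewrite /irrelevant mcoeffB mcoeff1 eqxx mcoeffZ mulVf // subrr.
exists (p@_0%MM)^-1%:A, (fun h => ev (v h)).
have -> : \sum_h ev (v h) * ev 'X_h = ev (1 - (p@_0%MM)^-1 *: p).
  by rewrite hv rmorph_sum; apply: eq_bigr => h _; rewrite rmorphM.
by rewrite rmorphB rmorph1 evZ opprB addrC subrK mulr_algl.
Qed.

Lemma nA_gen a : nA a -> exists c : 'I_n -> A, a = \sum_h c h * evX h.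
Proof.
case=> p /irrelevant_gen[v ->] <-; exists (fun h => ev (v h)).
by rewrite rmorph_sum; apply: eq_bigr => h _; rewrite rmorphM.
Qed.

Lemma nA_X h : nA (evX h).
Proof.
exists 'X_h => //; rewrite /irrelevant mcoeffX; case: eqP => // /eqP.
by rewrite mnm1_eq0.
Qed.

Lemma nA_maximal : maximal_ideal nA.
Proof.
split; [exact: nA_ideal | exact: nA1 |] => Q iQ Q1 nQ a Qa.
apply: boolp.contrapT => /notin_nA[t [v tv]]; apply: Q1.
have [_ QD QM] := iQ; rewrite -(subrK (\sum_h v h * evX h) 1) -tv; apply: QD.
  exact: QM.
by apply: ideal_sum => // h _; apply: QM; apply: nQ; apply: nA_X.
Qed.

(** * A maximal regular sequence at the irrelevant ideal of A *)

Section Regular.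
Variables (h : nat) (x : 'I_h -> A).
Let B := fun _ : A => False.
Hypothesis xh : height B nA h.
Hypothesis xreg : loc_regular B nA x.

Let J i := locmem nA (gens B x i).
Let pn : prime_ideal nA. Proof. exact: maximal_prime nA_maximal. Qed.

(** Depth sensitivity: from the trivial range q > n modulo all of x, each element removed from the
    sequence lowers the range of vanishing by one. *)
Lemma kills_loc i j q : (i + j = h)%N -> (n < q + j)%N -> kills 1 evX (J i) q.
Proof.
elim: j i q => [|j IH] i q ij nq.
  have iJ : is_ideal (J i) by apply: locmem_ideal.
  move=> z [hz _]; exists (fun=> 0); split=> // U; rewrite hz; last first.
    by apply/eqP => Uq; have := max_card (mem U); rewrite card_ord Uq; lia.
  rewrite mulr0 /kdiff big1 ?subr0; first by case: iJ.
  by move=> g _; rewrite /contract; case: ifP; rewrite ?mulr0.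
have lt : (i < h)%N by lia.
have [xn xr] := xreg.
have [c hc] := nA_gen (xn (Ordinal lt)).
apply: (@kills_regular _ _ 1 evX (J i) (J i.+1) (x (Ordinal lt)) c (fun s => ~ nA s)) => //.
- exact: locmem_ideal.
- exact: locmem_ideal.
- move=> a [s [ns hs]]; exists s; split=> //; apply: ideal_gen_mono hs.
  by move=> b0 [[]|[l [li ->]]]; right; exists l; split=> //; apply: ltnW.
- apply: locmem_gen => //; apply: ideal_gen_mem; right.
  by exists (Ordinal lt).
- exact: (xr (Ordinal lt)).
- exact: nA1.
- by move=> a b0 ha hb; case: pn => _ _ np /np[].
- exact: notin_nA.
- move=> a [s [ns hs]].
  have /ideal_genU1[c' hc'] : ideal_gen (fun e0 : A => gens B x i e0 \/ e0 = x (Ordinal lt)) (s * a).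
    apply: ideal_gen_mono hs => b0 [[]|[l [li ->]]].
    move: li; rewrite ltnS leq_eqVlt => /orP[/eqP li|li].
      by right; congr x; apply: val_inj.
    by left; right; exists l.
  by exists s, c'; split=> //; apply: locmem_gen.
by apply: IH; lia.
Qed.

(** The localized statement bounds s z for some s outside [nA]; s and the generators generate the
    unit ideal, and the latter act as zero. *)
Lemma kills_A q : (n < q + h)%N -> kills 1 evX (fun a => a = 0) q.
Proof.
move=> nq z [hz z0].
have i0 : is_ideal (fun a : A => a = 0).
  by split=> [//|a b0 -> ->|a b0 ->]; rewrite ?addr0 ?mulr0.
have o0 : over (gens B x 0) (fun a : A => a = 0) by move=> b0 [[]|[l []]].
have J00 a : ideal_gen (gens B x 0) a -> a = 0 by apply: (ideal_gen_sub i0 o0).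
have [|y [hy Jy]] := @kills_loc 0 h q erefl nq z.
  split=> // U; rewrite z0; apply: locmem_gen => //.
  by case: (ideal_gen_ideal (gens B x 0)).
have [s0 hs0] := fin_all_exists Jy.
pose s := \prod_U s0 U.
have ns : ~ nA s.
  apply: (big_ind (fun s => ~ nA s)); first exact: nA1.
    by move=> a b0 ha hb; case: pn => _ _ np /np[].
  by move=> U _; case: (hs0 U).
have b1 : kbound evX (fun a => a = 0) q (fun U => s * z U).
  exists (fun U => s * y U); split; first exact: hdegZ.
  move=> U; rewrite kdiffZ -mulrBr /s (bigD1 U) //= mulrAC.
  by have [_ /J00] := hs0 U; rewrite mul1r => ->; rewrite mul0r.
have [t [r tsE]] := notin_nA ns.
have := kboundD i0 (kboundZ t i0 b1) (kbound_comb r i0 (conj hz z0)).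
by apply: kbound_congr => // U; rewrite mulrA tsE -mulrDl subrK !mul1r subrr.
Qed.

(** Otherwise some prime inside [nA] containing x would avoid X_g, but by [height_regular_maximal]
    that prime is [nA]. *)
Lemma nilpotent_mod g : exists K, J h (evX g ^+ K).
Proof.
apply: boolp.contrapT => nex.
have iJ : is_ideal (J h) by apply: locmem_ideal.
have [||||P [pP JP PW]] := @prime_avoid _ (J h)
   (fun a => exists s K, ~ nA s /\ a = s * evX g ^+ K).
- exact: iJ.
- by exists 1, 0%N; split; [exact: nA1 | rewrite mulr1].
- move=> _ _ [s [K [ns ->]]] [s' [K' [ns' ->]]]; exists (s * s'), (K + K')%N.
  by split; [case: pn => _ _ np /np[] | rewrite exprD mulrACA].
- move=> a Ja [s [K [ns aE]]]; apply: nex; exists K.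
  by apply: locmem_cancel ns _ => //; rewrite -aE.
have Pn a : P a -> nA a.
  move=> Pa; apply: boolp.contrapT => na; apply: (PW _ Pa).
  by exists a, 0%N; rewrite mulr1.
have oP : over (gens B x h) P.
  by move=> a ga; apply: JP; apply: locmem_gen => //; apply: ideal_gen_mem.
have := height_regular_maximal pn xh xreg pP oP Pn (nA_X g).
by move/PW; apply; exists 1, 1%N; split; [exact: nA1 | rewrite mul1r expr1].
Qed.

Lemma monomials_in_J : exists N, forall m, (N <= mdeg m)%N -> J h (ev 'X_[m]).
Proof.
have iJ : is_ideal (J h) by apply: locmem_ideal.
have [K hK] := fin_all_exists nilpotent_mod.
(* Beyond this degree some exponent of m reaches the corresponding K. *)
exists (\sum_i K i).+1 => m Nm.
have [g Kg] : exists g, (K g <= m g)%N.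
  apply: boolp.contrapT => nex; move: Nm; rewrite mdegE ltnNge => /negP; apply.
  apply: leq_sum => i _; rewrite leqNgt; apply/negP => lt; apply: nex.
  by exists i; apply: ltnW.
rewrite -(@submK _ (U_(g) *+ K g) m); last first.
  apply/mnm_lepP => i; rewrite mulmnE mnm1E; case: eqP => // <-.
  by rewrite mul1n.
rewrite mpolyXD rmorphM; have [_ _ JM] := iJ; apply: JM.
by rewrite -mpolyXn rmorphXn.
Qed.

(** With a = t (s a) + V a, where s a lies in (x) and V has positive degree, each iteration
    multiplies the error by V. *)
Lemma J_approx a N : J h a -> exists b : 'I_h -> A, AG N (a - \sum_j b j * x j).
Proof.
move=> [s [ns hs]].
have [b0 hb0] : exists b : 'I_h -> A, s * a = \sum_j b j * x j.
  move: (s * a) hs; apply: ideal_gen_sub; first split.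
  - by exists (fun=> 0); rewrite big1 // => j _; rewrite mul0r.
  - move=> _ _ [c ->] [c' ->]; exists (fun j => c j + c' j); rewrite -big_split.
    by apply: eq_bigr => j _; rewrite mulrDl.
  - move=> a' _ [c ->]; exists (fun j => a' * c j); rewrite mulr_sumr.
    by apply: eq_bigr => j _; rewrite mulrA.
  move=> _ [[]|[j [_ ->]]]; exists (fun i => (i == j)%:R); rewrite (bigD1 j) //=.
  by rewrite eqxx mul1r big1 ?addr0 // => i /negPf->; rewrite mul0r.
have [t [v tv]] := notin_nA ns.
set V := \sum_h v h * evX h in tv.
have VAG : AG 1 V.
  by apply: AG_sum => g _; apply: AGMl; apply: nA_AG; apply: nA_X.
have aE : a = t * (s * a) + V * a by rewrite mulrA tv -mulrDl subrK mul1r.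
elim: N => [|N [b hb]]; first by exists (fun=> 0); apply: AG0.
exists (fun j => t * b0 j + V * b j).
have -> : a - \sum_j (t * b0 j + V * b j) * x j = V * (a - \sum_j b j * x j).
  under eq_bigr do rewrite mulrDl -!mulrA.
  rewrite big_split /= -!mulr_sumr -hb0 mulrBr {1}aE.
  by ring.
by have := AGM VAG hb.
Qed.

(** * Bounding the Hilbert function of A *)

Section Span.
Variable M : nat.
Hypothesis MJ : forall m, (M <= mdeg m)%N -> J h (ev 'X_[m]).

Definition pw N (F : {ffun 'I_h -> 'I_N} * 'X_{1..n < M}) : A :=
  \prod_j x j ^+ F.1 j * ev 'X_[F.2].

Definition spA N N' a := exists c : {ffun 'I_h -> 'I_N} * 'X_{1..n < M} -> k,
  AG N' (a - \sum_F c F *: pw F).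

Lemma spAD N N' a a' : spA N N' a -> spA N N' a' -> spA N N' (a + a').
Proof.
move=> [c hc] [c' hc']; exists (fun F => c F + c' F).
rewrite (_ : _ - _ = a - \sum_F c F *: pw F + (a' - \sum_F c' F *: pw F)); first exact: AGD.
rewrite addrACA -opprD -big_split /=; congr (_ - _).
by apply: eq_bigr => j _; rewrite scalerDl.
Qed.

Lemma spAZ N N' (d : k) a : spA N N' a -> spA N N' (d *: a).
Proof.
move=> [c hc]; exists (fun F => d * c F).
rewrite (_ : _ - _ = d *: (a - \sum_F c F *: pw F)); first exact: AGZ.
rewrite scalerBr scaler_sumr; congr (_ - _).
by apply: eq_bigr => j _; rewrite scalerA.
Qed.

Lemma spA_AG N N' a : AG N' a -> spA N N' a.
Proof.
by move=> h1; exists (fun=> 0); rewrite big1 ?subr0 // => F _; rewrite scale0r.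
Qed.

Lemma spA_sum N N' (I : Type) (s : seq I) (Q : pred I) (F : I -> A) :
  (forall i, Q i -> spA N N' (F i)) -> spA N N' (\sum_(i <- s | Q i) F i).
Proof.
move=> hF; elim/big_ind: _ => //; last exact: spAD.
by apply: spA_AG; apply: AGz.
Qed.

Lemma spA_mem N N' F : spA N N' (@pw N F).
Proof.
exists (fun G => (G == F)%:R); rewrite (bigD1 F) //= eqxx scale1r big1.
  by rewrite addr0 subrr; apply: AGz.
by move=> G /negPf->; rewrite scale0r.
Qed.

(** Monomials of degree at least M lie in (x) up to high degree. Their coefficients are expanded
    recursively, one degree of precision less being enough because every x_j has positive degree. *)
Lemma spA_all N a : spA N N a.
Proof.
elim: N a => [|N IH] a; first by apply: spA_AG; apply: AG0.
have [p <-] := ev_surj a; rewrite (mpolyE p) rmorph_sum; apply: spA_sum => m _ /=.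
rewrite evZ; apply: spAZ; case: (ltnP (mdeg m) M) => mM.
  have -> : ev 'X_[m] = @pw N.+1 ([ffun=> ord0], BMultinom mM).
    by rewrite /pw big1 ?mul1r // => j _; rewrite ffunE.
  exact: spA_mem.
have [b hb] := @J_approx _ N.+1 (MJ mM).
rewrite -(subrK (\sum_j b j * x j) (ev _)); apply: spAD; first exact: spA_AG.
apply: spA_sum => j _; have [c hc] := IH (b j).
have xj : AG 1 (x j) by apply: nA_AG; case: xreg.
rewrite -(subrK (\sum_F c F *: pw F) (b j)) mulrDl; apply: spAD.
  by apply: spA_AG; rewrite mulrC; have := AGM xj hc.
rewrite mulr_suml; apply: spA_sum => F _; rewrite -scalerAl; apply: spAZ.
have -> : pw F * x j = @pw N.+1 ([ffun i => inord (F.1 i + (i == j))], F.2).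
  rewrite /pw /= mulrAC; congr (_ * _).
  have lt i : (F.1 i + (i == j) < N.+1)%N.
    by have := ltn_ord (F.1 i); case: (i == j); lia.
  rewrite (bigD1 j) //= [RHS](bigD1 j) //= ffunE inordK // eqxx addn1 exprS.
  rewrite mulrAC [X in X * _]mulrC; congr (_ * _); apply: eq_bigr => i /negPf ij.
  by rewrite ffunE inordK ?ij ?addn0 //; have := lt i; rewrite ij addn0.
exact: spA_mem.
Qed.

End Span.

(** Monomials on F are standard, hence independent in A. If F had more than h elements, those with
    exponents below M would number at least M^(h+1), all of degree below N, while A modulo degree N
    is spanned by a constant times N^h elements. *)
Lemma dim_le_height (F : {set 'I_n}) :
  (forall m, msup m \subset F -> ~ Sg m) -> (#|F| <= h)%N.
Proof.
move=> maxface_std; rewrite leqNgt; apply/negP => hF.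
have [M0 hM0] := monomials_in_J.
pose D := (\sum_i dg i)%N.
have [M [M_gt0 lt]] := growth #|{: 'X_{1..n < M0}}| D h.
pose N := (D * M + 1)%N.
pose I := {ffun 'I_#|F| -> 'I_M}.
pose mono (al : I) : 'X_{1..n} := [multinom (\sum_(j | enum_val j == i) al j)%N | i < n].
have monoE al j : mono al (enum_val j) = al j.
  rewrite mnmE (bigD1 j) //= big1 ?addn0 // => l /andP[/eqP/enum_val_inj ->].
  by rewrite eqxx.
have mono_supp al : msup (mono al) \subset F.
  apply/subsetP => i; rewrite inE mnmE; apply: contraLR => iF.
  rewrite -eqn0Ngt big_pred0 // => j; apply/negP => /eqP ji.
  by move: iF; rewrite -ji enum_valP.
have mono_inj : injective mono.
  by move=> al be e; apply/ffunP => j; apply: val_inj; rewrite /= -!monoE e.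
have mono_wt al : (wt dg (mono al) < N)%N.
  rewrite /N addn1 ltnS /D big_distrl /=; apply: leq_sum => i _.
  rewrite mulnC leq_mul2l; apply/orP; right.
  case: (boolP (i \in F)) => iF.
    by rewrite -(enum_rankK_in iF iF) monoE ltnW.
  have := mono_supp al; move/subsetP/(_ i)/contra => /(_ iF).
  by rewrite inE -eqn0Ngt => /eqP->.
have [||||| l [[al0 l0] hl]] := @linear_dependence k A I
   ({ffun 'I_h -> 'I_N} * 'X_{1..n < M0})%type
   (fun al => ev 'X_[mono al]) (@pw M0 N) (AG N).
- exact: AGz.
- by move=> a b; apply: AGD.
- by move=> c a; apply: AGZ.
- rewrite card_ffun !card_ord card_prod card_ffun !card_ord mulnC.
  by apply: leq_trans lt _; rewrite leq_pexp2l.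
- by move=> al; apply: spA_all.
pose p := \sum_al l al *: 'X_[mono al].
have evp : ev p = \sum_al l al *: ev 'X_[mono al].
  by rewrite rmorph_sum; apply: eq_bigr => al _; rewrite evZ.
have psupp m : m \in msupp p -> exists al, m = mono al.
  move=> /msupp_sum_le /flattenP[s /mapP[al _ ->]] /msuppZ_le.
  by rewrite msuppX inE => /eqP->; exists al.
have p0 : mono al0 \in msupp p.
  rewrite mcoeff_msupp raddf_sum (bigD1 al0) //= mcoeffZ mcoeffX eqxx mulr1.
  rewrite big1 ?addr0 // => al ne; rewrite mcoeffZ mcoeffX.
  by case: eqP => [/mono_inj e|]; rewrite ?mulr0 //; rewrite e eqxx in ne.
have sp : {in msupp p, forall m, ~ Sg m} by move=> m /psupp[al ->]; apply: maxface_std.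
have hp : AG N (ev p) by rewrite evp.
by have := AG_std sp hp p0; rewrite leqNgt mono_wt.
Qed.

End Regular.

Theorem cohen_macaulay_kills : CohenMacaulay (fun _ : A => False) ->
  exists h, (forall F : {set 'I_n}, (forall m, msup m \subset F -> ~ Sg m) -> (#|F| <= h)%N)
    /\ forall q, (n < q + h)%N -> kills 1 evX (fun a => a = 0) q.
Proof.
move=> /(_ nA nA_maximal (fun _ => False_ind _))[h [hh [x xr]]]; exists h; split.
  by move=> F; apply: (dim_le_height hh xr).
by move=> q nq; apply: (kills_A xr nq).
Qed.

End CohenMacaulayA.

(** * Straightening in a Hodge algebra *)

Section HodgeAlgebra.
Variables (k : fieldType) (A : comAlgType k) (d : Order.disp_t) (H : finPOrderType d).
Variables (emb : H -> A) (Sigma : monom H -> Prop) (G : nat -> A -> Prop).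
Hypothesis HA : hodge_algebra emb Sigma.
Hypothesis HG : graded_hodge emb G.
Hypothesis Hsq : square_free Sigma.
Local Notation n := #|H|.
Local Notation S := {mpoly k[n]}.
Implicit Types (mu nu : monom H) (m : 'X_{1..n}) (p r : S).

Definition monom_of m : monom H := [ffun h => m (enum_rank h)].
Definition mnm_of mu : 'X_{1..n} := [multinom mu (enum_val i) | i < n].

Lemma monom_ofK : cancel monom_of mnm_of.
Proof. by move=> m; apply/mnmP => i; rewrite mnmE ffunE enum_valK. Qed.

Lemma mnm_ofK : cancel mnm_of monom_of.
Proof. by move=> mu; apply/ffunP => h; rewrite ffunE mnmE enum_rankK. Qed.

Definition nonstd m := Sigma (monom_of m).

Definition core_set : {set 'I_n} := [set i | boolp.asbool (core Sigma (enum_val i))].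

Lemma reindex_rank (R : Type) (idx : R) (op : Monoid.com_law idx) (F : 'I_n -> R) :
  \big[op/idx]_(h : H) F (enum_rank h) = \big[op/idx]_(i < n) F i.
Proof.
rewrite [RHS](reindex (@enum_rank H)) //; apply: onW_bij.
by exists enum_val; [exact: enum_rankK | exact: enum_valK].
Qed.

Lemma XmonE mu : Xmon k mu = 'X_[mnm_of mu].
Proof.
rewrite mpolyXE_id -(reindex_rank _ (fun i => 'X_i ^+ mnm_of mu i)) /=.
by apply: eq_bigr => h _; rewrite mnmE enum_rankK.
Qed.

Lemma dis_gensE : dis_gens k Sigma = fun p => exists m, nonstd m /\ p = 'X_[m].
Proof.
apply: boolp.funext => p; apply: boolp.propext; split=> [[mu [Smu ->]]|[m [Sm ->]]].
  by exists (mnm_of mu); rewrite XmonE /nonstd mnm_ofK.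
by exists (monom_of m); rewrite XmonE monom_ofK.
Qed.

Lemma core_gensE : core_gens k Sigma =
  fun p => (exists m, nonstd m /\ p = 'X_[m]) \/ exists2 i, i \notin core_set & p = 'X_i.
Proof.
apply: boolp.funext => p; apply: boolp.propext; rewrite /core_gens dis_gensE.
split=> [[h|[h [nc ->]]]|[h|[i]]]; [by left | right | by left |].
  by exists (enum_rank h) => //; rewrite inE enum_rankK; apply/boolp.asboolP.
rewrite inE => /boolp.asboolP nc ->; right; exists (enum_val i); split=> //.
by rewrite enum_valK.
Qed.

Lemma min_gen_dvd mu : Sigma mu -> exists2 nu, min_gen Sigma nu & mdivides nu mu.
Proof.
move E: (\sum_h mu h)%N => N; elim/ltn_ind: N mu E => N IH mu E Smu.
case: (boolp.EM (min_gen Sigma mu)) => [|nmin]; first by exists mu.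
have [nu [dn ne Sn]] : exists nu, [/\ mdivides nu mu, nu <> mu & Sigma nu].
  apply: boolp.contrapT => nex; apply: nmin; split=> // nu dn ne Sn.
  by apply: nex; exists nu.
have [|nu' mn dn'] := IH (\sum_h nu h)%N _ nu erefl Sn.
  rewrite -E ltn_neqAle leq_sum ?andbT => [|h _]; last exact: dn.
  apply/eqP => e; apply: ne; apply/ffunP => h.
  have : (\sum_h (mu h - nu h) = 0)%N.
    rewrite sumnB; last by move=> i _; apply: dn.
    by rewrite e subnn.
  move=> /eqP; rewrite sum_nat_eq0 => /forallP/(_ h); rewrite subn_eq0 /= => le.
  by apply/eqP; rewrite eqn_leq le dn.
by exists nu' => // h; apply: leq_trans (dn' h) (dn h).
Qed.

Lemma min_gen_sqfree mu : min_gen Sigma mu -> square_free_mon mu.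
Proof.
move=> [Smu mmin]; have [g [Sgg sq dv]] := Hsq Smu.
case: (boolp.EM (g = mu)) => [<-//|ne].
by case: (mmin g dv ne).
Qed.

(** A minimal generator dividing m is square-free and supported on the core, so only the core part
    of the support of m is relevant. *)
Lemma nonstd_core (m m' : 'X_{1..n}) : nonstd m ->
  (forall i, i \in core_set -> (0 < m i)%N -> (0 < m' i)%N) -> nonstd m'.
Proof.
move=> Sm hm; have [g mg dv] := min_gen_dvd Sm.
have sq := min_gen_sqfree mg.
have dv' : mdivides g (monom_of m').
  move=> h; rewrite ffunE; have := sq h; case gh: (g h) => [|[|]] // _.
  apply: hm; first by rewrite inE enum_rankK; apply/boolp.asboolP; exists g; rewrite gh.
  by have := dv h; rewrite ffunE gh.
have [_ iS _ _ _] := HA; have := iS g [ffun h => monom_of m' h - g h]%N (proj1 mg).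
rewrite /nonstd; congr Sigma; apply/ffunP => h; rewrite !ffunE subnKC //.
by have := dv' h; rewrite ffunE.
Qed.

Definition hodge_ev : S -> A := mmap (in_alg A) (fun i => emb (enum_val i)).

HB.instance Definition _ := GRing.RMorphism.on hodge_ev.

Lemma hodge_evX m : hodge_ev 'X_[m] = evalA emb (monom_of m).
Proof.
rewrite /hodge_ev mmapX /mmap1 -(reindex_rank _ (fun i => emb (enum_val i) ^+ m i)) /=.
by apply: eq_bigr => h _; rewrite enum_rankK ffunE.
Qed.

Lemma hodge_evZ (c : k) p : hodge_ev (c *: p) = c *: hodge_ev p.
Proof. by rewrite /hodge_ev mmapZ mulr_algl. Qed.

Lemma hodge_ev_sum p : hodge_ev p = \sum_(m <- msupp p) p@_m *: evalA emb (monom_of m).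
Proof.
rewrite {1}(mpolyE p) rmorph_sum; apply: eq_bigr => m _.
by rewrite /= hodge_evZ hodge_evX.
Qed.

Lemma hodge_ev_std_surj (a : A) : exists2 p, {in msupp p, forall m, ~ nonstd m} & hodge_ev p = a.
Proof.
have [_ _ span _ _] := HA; have [N [mu [c [std ->]]]] := span a.
exists (\sum_(i < N) c i *: 'X_[mnm_of (mu i)]).
  move=> m /msupp_sum_le /flattenP[s /mapP[i _ ->]] /msuppZ_le.
  by rewrite msuppX inE => /eqP->; rewrite /nonstd mnm_ofK; apply: std.
by rewrite rmorph_sum; apply: eq_bigr => i _; rewrite /= hodge_evZ hodge_evX mnm_ofK.
Qed.

Lemma hodge_ev_surj (a : A) : exists p, hodge_ev p = a.
Proof. by have [p _] := hodge_ev_std_surj a; exists p. Qed.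

Let supp_mon p (i : 'I_(size (msupp p))) := monom_of (nth 0%MM (msupp p) i).

Lemma supp_mon_inj p : injective (@supp_mon p).
Proof.
move=> i j /(can_inj monom_ofK) /eqP; rewrite nth_uniq ?msupp_uniq //.
by move/eqP/val_inj.
Qed.

Lemma std_free p : {in msupp p, forall m, ~ nonstd m} -> hodge_ev p = 0 -> p = 0.
Proof.
move=> sp p0; have [_ _ _ free _] := HA.
have E : \sum_(i < size (msupp p)) p@_(nth 0%MM (msupp p) i) *: evalA emb (supp_mon i) = 0.
  by rewrite -[RHS]p0 hodge_ev_sum (big_nth 0%MM) big_mkord.
have := free _ _ (fun i => p@_(nth 0%MM (msupp p) i)) (@supp_mon_inj p) _ E.
move=> /(_ (fun i => sp _ (mem_nth 0%MM (ltn_ord i)))) c0.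
apply/eqP; rewrite -msupp_eq0 -size_eq0; apply/negPn/negP; rewrite -lt0n => lt.
have := mem_nth 0%MM lt; rewrite mcoeff_msupp.
by have /= -> := c0 (Ordinal lt); rewrite eqxx.
Qed.

(** If 1 were nonstandard, no monomial would be standard and A would be zero. *)
Lemma nonstd0 : ~ nonstd 0%MM.
Proof.
move=> S0; have [p sp p1] := hodge_ev_std_surj 1.
suff p0 : p = 0 by move: p1; rewrite p0 rmorph0 => /eqP; rewrite eq_sym oner_eq0.
apply/eqP; rewrite -msupp_eq0; case E: (msupp p) => [//|m l].
have : ~ nonstd m by apply: sp; rewrite E mem_head.
by case; apply: nonstd_core S0 _ => i _; rewrite mnm0E.
Qed.

Definition poset_rank (x : H) := #|[set y | (x < y)%O]|.
(** Smaller elements have more elements above them and weigh more. The base n+1 lets a single y < x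
    outweigh n factors of the weight of x. *)
Definition poset_wt (x : H) := (n.+1 ^ poset_rank x)%N.
Definition hodge_wt (i : 'I_n) := poset_wt (enum_val i).

Lemma poset_wt_lt x y : (y < x)%O -> (n.+1 * poset_wt x <= poset_wt y)%N.
Proof.
have n0 : (0 < n)%N by apply/card_gt0P; exists x.
move=> yx; rewrite /poset_wt -expnS leq_exp2l ?ltnS //; apply: proper_card.
apply/properP; split; last by exists x; rewrite !inE ?ltxx.
by apply/subsetP => z; rewrite !inE; apply: lt_trans yx.
Qed.

Lemma wt_monom (f : H -> nat) m :
  wt (fun i => f (enum_val i)) m = (\sum_h monom_of m h * f h)%N.
Proof.
rewrite /wt -(reindex_rank _ (fun i => m i * f (enum_val i))%N) /=.
by apply: eq_bigr => h _; rewrite ffunE enum_rankK.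
Qed.

Lemma degrees : exists dg : H -> nat, forall h, (0 < dg h)%N /\ G (dg h) (emb h).
Proof. by have [_ /fin_all_exists[dg hdg]] := HG; exists dg. Qed.

(** * Straightening relations are homogeneous and raise the weight *)

Section Straighten.
Variable dg : H -> nat.
Hypothesis dgP : forall h, (0 < dg h)%N /\ G (dg h) (emb h).
Local Notation dgi := (fun i : 'I_n => dg (enum_val i)).

Lemma G_ev m : G (wt dgi m) (hodge_ev 'X_[m]).
Proof.
have [[_ GM _ _ G0] _] := HG.
rewrite wt_monom hodge_evX /evalA.
apply: (big_ind2 (fun a e => G e a)).
- by apply/G0; exists 1; rewrite scale1r.
- by move=> a e b e' Ga Gb; apply: GM.
move=> h _; elim: (monom_of m h) => [|e IH].
  by rewrite mul0n expr0; apply/G0; exists 1; rewrite scale1r.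
by rewrite mulSn exprS; apply: GM => //; case: (dgP h).
Qed.

Lemma G_part p e : G e (hodge_ev (mpart (fun m => wt dgi m == e) p)).
Proof.
have [[Gl _ _ _ _] _] := HG; have [G0 [GD GZ]] := Gl e.
rewrite hodge_ev_sum big_seq; elim/big_ind: _ => // m.
rewrite msupp_mpart => /andP[/eqP me _]; apply: GZ.
by rewrite -hodge_evX -me; apply: G_ev.
Qed.

(** Subtracting the value of p from its component of degree e decomposes 0 into homogeneous terms.
    Directness of the grading and independence of standard monomials kill the other components. *)
Lemma homogeneous_std p e : {in msupp p, forall m, ~ nonstd m} -> G e (hodge_ev p) ->
  {in msupp p, forall m, wt dgi m = e}.
Proof.
move=> sp Gp m mp; apply/eqP/negPn/negP => ne.
have [[Gl _ _ Gf _] _] := HG.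
pose N := ((\max_(m <- msupp p) wt dgi m) + e).+1.
have ltN m' : m' \in msupp p -> (wt dgi m' < N)%N.
  move=> m'p; rewrite ltnS; apply: leq_trans (leq_addr _ _).
  exact: leq_bigmax_seq.
pose f (i : 'I_N) := hodge_ev (mpart (fun m => wt dgi m == i) p) - (if i == e :> nat then hodge_ev p else 0).
have Gfi (i : 'I_N) : G i (f i).
  have [G0 [GD GZ]] := Gl i; apply: GD; first exact: G_part.
  rewrite -scaleN1r; apply: GZ; case: eqP => [->|_] //.
have sum0 : \sum_i f i = 0.
  rewrite /f sumrB -rmorph_sum /=.
  have -> : \sum_(i < N) mpart (fun m => wt dgi m == i) p = p.
    apply/mpolyP => m'; rewrite raddf_sum /=.
    under eq_bigr do rewrite mcoeff_mpart.
    case m'p: (m' \in msupp p); last first.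
      by rewrite (memN_msupp_eq0 (negbT m'p)) big1 // => i _; rewrite if_same.
    rewrite (bigD1 (Ordinal (ltN _ m'p))) //= eqxx big1 ?addr0 // => i.
    by rewrite -(inj_eq val_inj) /= eq_sym => /negPf->.
  have eN : (e < N)%N by rewrite ltnS leq_addl.
  rewrite (bigD1 (Ordinal eN)) //= eqxx big1 ?addr0 ?subrr // => i.
  by rewrite -(inj_eq val_inj) /= => /negPf->.
have := Gf _ f Gfi sum0 (Ordinal (ltN _ mp)).
rewrite /f /= (negPf ne) subr0 => /std_free h0.
have : m \in msupp (mpart (fun m' => wt dgi m' == wt dgi m) p) by rewrite msupp_mpart eqxx.
by rewrite h0 ?msupp0 // => m'; rewrite msupp_mpart => /andP[_ /sp].
Qed.

(** Let x be a heaviest factor of mu. Being square-free, mu weighs at most n times x, and the Hodge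
    axiom at x puts into each standard term a factor y < x weighing at least n+1 times x. *)
Lemma straighten_gen mu : min_gen Sigma mu -> exists p, hodge_ev 'X_[mnm_of mu] = hodge_ev p /\
  {in msupp p, forall m', wt dgi m' = wt dgi (mnm_of mu) /\ (wt hodge_wt (mnm_of mu) < wt hodge_wt m')%N}.
Proof.
move=> mmu; have [p sp pE] := hodge_ev_std_surj (hodge_ev 'X_[mnm_of mu]).
exists p; split=> // m' m'p; split.
  by apply: (homogeneous_std sp) => //; rewrite pE; apply: G_ev.
have [_ _ _ _ str] := HA.
have lt : (index m' (msupp p) < size (msupp p))%N by rewrite index_mem.
have muE : evalA emb mu =
    \sum_(i < size (msupp p)) p@_(nth 0%MM (msupp p) i) *: evalA emb (supp_mon i).
  have := pE; rewrite hodge_evX mnm_ofK => <-.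
  by rewrite hodge_ev_sum (big_nth 0%MM) big_mkord.
have := str mu mmu _ _ _ (@supp_mon_inj p) (fun i => sp _ (mem_nth 0%MM (ltn_ord i))) muE (Ordinal lt).
rewrite /supp_mon /= nth_index // -mcoeff_msupp => /(_ m'p) below.
have [x0 x0mu] : exists x, (0 < mu x)%N.
  apply: boolp.contrapT => nex; apply: nonstd0; rewrite /nonstd.
  suff <- : mu = monom_of 0%MM by case: mmu.
  apply/ffunP => h; rewrite ffunE mnm0E; apply/eqP; rewrite eqn0Ngt.
  by apply/negP => h0; apply: nex; exists h.
case: (@arg_maxnP _ x0 (fun x => 0 < mu x)%N poset_wt x0mu) => x xmu xmax.
have [y [ym yx]] := below x xmu.
rewrite /hodge_wt !(wt_monom poset_wt) mnm_ofK.
apply: (@leq_ltn_trans (n * poset_wt x)).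
  rewrite -sum_nat_const; apply: leq_sum => h _.
  have := min_gen_sqfree mmu h; case mh: (mu h) => [|[|]] // _.
  by rewrite mul1n; apply: xmax; rewrite mh.
apply: (@leq_trans (poset_wt y)).
  apply: leq_trans (poset_wt_lt yx); rewrite ltn_pmul2r ?expn_gt0 //.
rewrite (bigD1 y) //=; apply: leq_trans (leq_addr _ _).
by rewrite leq_pmull.
Qed.

Lemma straighten m : nonstd m -> exists p, hodge_ev 'X_[m] = hodge_ev p /\
  {in msupp p, forall m', wt dgi m' = wt dgi m /\ (wt hodge_wt m < wt hodge_wt m')%N}.
Proof.
move=> Sm; have [mu mmu dv] := min_gen_dvd Sm.
have [p [pE hp]] := straighten_gen mmu.
have le : (mnm_of mu <= m)%MM.
  apply/mnm_lepP => i; have := dv (enum_val i).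
  by rewrite mnmE ffunE enum_valK.
exists (p * 'X_[m - mnm_of mu]); split.
  by rewrite -{1}(submK le) addmC mpolyXD !rmorphM /= pE.
move=> m'; rewrite (perm_mem (msuppMX _ _)) => /mapP[m0 /hp[d1 w1] ->].
have e f : (wt f (m - mnm_of mu) + wt f (mnm_of mu))%N = wt f m by rewrite -wtD submK.
by rewrite !wtD -(e hodge_wt) -(e dgi) d1 ltn_add2l.
Qed.

End Straighten.
End HodgeAlgebra.

(** * Top forms and elementary symmetric polynomials *)

Section TopForms.
Variables (k : fieldType) (n : nat).
Local Notation S := {mpoly k[n]}.
Implicit Types (a b f t : S) (W T : S -> Prop).

Local Notation part e := (mpart (fun m : 'X_{1..n} => mdeg m == e)).

Definition hclosed T := forall e a, T a -> T (part e a).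

(** Together with [top_sup], and for T homogeneous, this makes T the ideal of top forms of W. Any e
    at least the degree is allowed, the part being zero beyond it, which avoids speaking of exact
    degrees. *)
Definition top_sub W T := forall a, W a -> forall e, (msize a <= e.+1)%N -> T (part e a).

Definition top_sup W T := forall g e, T g -> part e g = g ->
  exists a, [/\ W a, (msize a <= e.+1)%N & part e a = g].

Lemma msize_partP a e : (msize a <= e)%N <-> {in msupp a, forall m, (mdeg m < e)%N}.
Proof.
split=> [le m /msize_mdeg_lt lt|h]; first exact: leq_trans lt le.
by rewrite msizeE; apply/bigmax_leqP_seq => m /h.
Qed.

Lemma msizeB_le a b e : (msize a <= e)%N -> (msize b <= e)%N -> (msize (a - b) <= e)%N.
Proof.
move=> /msize_partP ha /msize_partP hb; apply/msize_partP => m /msuppB_le.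
by rewrite mem_cat => /orP[/ha|/hb].
Qed.

Lemma msize_top a e : (msize a <= e.+1)%N -> part e a = 0 -> (msize a <= e)%N.
Proof.
move=> /msize_partP ha a0; apply/msize_partP => m ma.
have := ha m ma; rewrite ltnS leq_eqVlt => /orP[me|//].
have : m \in msupp (part e a) by rewrite msupp_mpart me.
by rewrite a0 msupp0.
Qed.

Lemma part_msize a e : (msize a <= e)%N -> part e a = 0.
Proof.
by move=> /msize_partP ha; apply: mpart_none => m /ha lt; rewrite neq_ltn lt.
Qed.

Lemma partK a e : part e (part e a) = part e a.
Proof. by apply: mpart_id => m; rewrite msupp_mpart => /andP[]. Qed.

Lemma msize_part a e : (msize (part e a) <= e.+1)%N.
Proof. by apply/msize_partP => m; rewrite msupp_mpart => /andP[/eqP->]. Qed.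

Lemma msizeM_top a b e e' : (msize a <= e.+1)%N -> (msize b <= e'.+1)%N ->
  (msize (a * b) <= (e + e').+1)%N.
Proof. by move=> ha hb; apply: leq_trans (msizeM_leq _ _) _; lia. Qed.

Lemma part_mul_hom a t e e' : part e' t = t ->
  part e (a * t) = if (e' <= e)%N then part (e - e')%N a * t else 0.
Proof.
move=> ht; have hm u : u \in msupp t -> mdeg u = e'.
  by rewrite -ht msupp_mpart => /andP[/eqP].
case: ifP => le.
  apply: mpart_mul => m u /hm ue; rewrite mdegD ue.
  by rewrite -{1}(subnK le) eqn_add2r.
apply: mpart_none => m /msuppM_le /allpairsP[[u v] /= [_ /hm ve ->]].
by rewrite mdegD ve; apply/eqP; lia.
Qed.

Lemma part_mul_top a b e e' : (msize a <= e.+1)%N -> (msize b <= e'.+1)%N ->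
  part (e + e')%N (a * b) = part e a * part e' b.
Proof.
move=> ha hb.
have E : a * b = a * part e' b + a * (b - part e' b) by rewrite -mulrDr addrC subrK.
rewrite E mpartD (part_mul_hom _ _ (partK b e')) leq_addl addnK.
rewrite [X in _ + X]part_msize ?addr0 //.
have lt : (msize (b - part e' b) <= e')%N.
  apply: msize_top; first by apply: msizeB_le => //; apply: msize_part.
  by rewrite mpartB partK subrr.
by apply: leq_trans (msizeM_leq _ _) _; lia.
Qed.

(** Regularity of the top form t modulo T controls the cancellation of leading terms: f is regular
    modulo W, and adjoining f to W adjoins exactly t to the top forms. *)
Lemma top_step W T W' T' f t E (c : k) :
    is_ideal W -> is_ideal T -> hclosed T -> top_sub W T -> top_sup W T ->
    c != 0 -> (msize f <= E.+1)%N -> part E f = c *: t ->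
    (forall a, T (t * a) -> T a) ->
    (forall a, W' a <-> exists b, W (a - b * f)) ->
    (forall a, T' a <-> exists b, T (a - b * t)) ->
  [/\ forall a, W (f * a) -> W a, hclosed T', top_sub W' T' & top_sup W' T'].
Proof.
move=> iW iT hT sub sup c0 szf topf treg W'E T'E.
have [W0 WD WM] := iW; have [T0 TD TM] := iT.
have tE : t = c^-1 *: part E f by rewrite topf scalerA mulVf // scale1r.
have tht : part E t = t by rewrite tE mpartZ partK.
have TZ (l : k) a : T a -> T (l *: a) by move=> Ta; rewrite -mul_mpolyC; apply: TM.
have reduce a e : (msize a <= e.+1)%N -> T (part e a) ->
    exists a', W a' /\ (msize (a - a') <= e)%N.
  move=> sza /sup/(_ (partK a e))[a' [Wa' sza' topa']]; exists a'; split=> //.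
  by apply: msize_top; [apply: msizeB_le | rewrite mpartB topa' subrr].
have key a e : (msize a <= e.+1)%N -> T (part (E + e)%N (f * a)) -> T (part e a).
  move=> sza; rewrite part_mul_top // topf => h; apply: treg.
  by have := TZ c^-1 _ h; rewrite -scalerAl scalerA mulVf // scale1r.
split.
- move=> a; have : (msize a <= msize a)%N by [].
  move: {2}(msize a) => N; elim: N a => [|N IH] a sza Wfa.
    by move: sza; rewrite leqn0 mmeasure_poly_eq0 => /eqP->.
  have [|a' [Wa' sza']] := @reduce a N sza.
    by apply: key => //; apply: sub => //; apply: msizeM_top.
  rewrite -(subrK a' a); apply: WD => //; apply: IH => //.
  by rewrite mulrBr; apply: idealB => //; apply: WM.
- move=> e a /T'E[b hb]; apply/T'E.
  have := hT e _ hb; rewrite mpartB (part_mul_hom _ _ tht).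
  case: ifP => _ h; first by eexists; exact: h.
  by exists 0; rewrite mul0r.
- move=> a /W'E[b hb] e sza; have : (msize b <= msize b)%N by [].
  move: {2}(msize b) => N; elim: N b hb => [|N IH] b hb szb.
    move: szb hb; rewrite leqn0 mmeasure_poly_eq0 => /eqP->.
    rewrite mul0r subr0 => Wa; apply/T'E; exists 0; rewrite mul0r subr0.
    exact: sub.
  have szbf : (msize (b * f) <= (E + N).+1)%N by rewrite mulrC; apply: msizeM_top.
  case: (leqP (E + N) e) => le.
    have szbf' : (msize (b * f) <= e.+1)%N by apply: leq_trans szbf _.
    have h := sub _ hb e (msizeB_le sza szbf').
    apply/T'E; exists (c *: part (e - E)%N b).
    have -> : part e a - c *: part (e - E)%N b * t = part e (a - b * f).
      rewrite mpartB; congr (_ - _).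
      have szb' : (msize b <= (e - E).+1)%N by apply: leq_trans szb _; lia.
      have -> : e = (e - E + E)%N by lia.
      by rewrite part_mul_top // topf addnK -scalerAl scalerAr.
    exact: h.
  have sza' : (msize a <= E + N)%N by apply: leq_trans sza _.
  have h := sub _ hb (E + N)%N (msizeB_le (leqW sza') szbf).
  (* Here b f may reach beyond the degree of a, so its top form must lie in T. Regularity of t puts
     the top form of b in T, and b is lowered by an element of W. *)
  have Tb : T (part N b).
    apply: key => //; move: h; rewrite mpartB (part_msize sza') sub0r mulrC.
    by move/(idealN iT); rewrite opprK.
  have [b' [Wb' szb']] := reduce b N szb Tb.
  apply: (IH (b - b')) => //.
  have -> : a - (b - b') * f = a - b * f + f * b' by ring.
  by apply: (WD) => //; apply: (WM).
- move=> g e /T'E[b hb] hg.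
  pose b' := if (E <= e)%N then part (e - E)%N b else 0.
  have Tg : T (part e (g - b * t)) by apply: hT.
  have gE : part e (g - b * t) = g - b' * t.
    by rewrite mpartB hg (part_mul_hom _ _ tht) /b'; case: ifP => // _; rewrite mul0r.
  have [a0 [Wa0 sza0 topa0]] := sup _ e Tg (partK _ _).
  have szb' : (msize (c^-1 *: b' * f) <= e.+1)%N.
    rewrite /b'; case: ifP => le; last by rewrite scaler0 mul0r msize0.
    have -> : e.+1 = ((e - E) + E).+1 by lia.
    apply: msizeM_top => //; rewrite msizeZ ?invr_eq0 //; exact: msize_part.
  exists (a0 + c^-1 *: b' * f); split.
  + by apply/W'E; exists (c^-1 *: b'); rewrite addrK.
  + have -> : a0 + c^-1 *: b' * f = a0 - (- (c^-1 *: b' * f)) by rewrite opprK.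
    by apply: msizeB_le => //; rewrite mmeasureN.
  rewrite mpartD topa0 gE.
  suff -> : part e (c^-1 *: b' * f) = b' * t by rewrite subrK.
  rewrite /b'; case: ifP => le; last by rewrite scaler0 !mul0r mpart0.
  have {1}-> : e = (e - E + E)%N by lia.
  rewrite part_mul_top //; last by rewrite msizeZ ?invr_eq0 //; apply: msize_part.
  by rewrite mpartZ partK topf -scalerAr -scalerAl scalerA mulfV // scale1r.
Qed.

Lemma top_init T : hclosed T -> top_sub T T /\ top_sup T T.
Proof.
move=> hT; split=> [a Ta e _|g e Tg hg]; first exact: hT.
by exists g; split=> //; rewrite -hg msize_part.
Qed.

End TopForms.

(** * Elementary symmetric polynomials in the core variables *)

Section ElementarySymmetric.
Variables (k : fieldType) (n : nat) (cr : {set 'I_n}).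
Local Notation S := {mpoly k[n]}.

Definition esym (j : nat) : S :=
  \sum_(F : {set 'I_n} | (F \subset cr) && (#|F| == j)) 'X_[mesym1 F].

Lemma msupp_esym j m : m \in msupp (esym j) ->
  exists F : {set 'I_n}, [/\ F \subset cr, #|F| = j & m = mesym1 F].
Proof.
move=> /msupp_sum_le /flattenP[s /mapP[F]]; rewrite mem_filter => /andP[/andP[sF /eqP Fj] _] ->.
by rewrite msuppX inE => /eqP->; exists F.
Qed.

Lemma mdeg_esym j m : m \in msupp (esym j) -> mdeg m = j.
Proof. by move=> /msupp_esym[F [_ <- ->]]; rewrite mdeg_mesym1. Qed.

Lemma vfree_esym j y : y \notin cr -> vfree y (esym j).
Proof.
move=> yc m /msupp_esym[F [sF _ ->]]; rewrite mnmE.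
by case: (boolP (y \in F)) => // /(subsetP sF); rewrite (negPf yc).
Qed.

Lemma esym0 : esym 0 = 1.
Proof.
rewrite /esym (big_pred1 set0); first by rewrite mesym1_set0 mpolyX0.
by move=> F; rewrite cards_eq0 /=; case: eqP => [->|]; rewrite ?sub0set ?andbF.
Qed.

(* Expansion of \prod_(g in cr) (X_h - X_g) = 0. *)
Lemma esym_relation h : h \in cr ->
  \sum_(j < n.+1) (-1) ^+ j * 'X_h ^+ (#|cr| - j) * esym j = 0.
Proof.
move=> hc.
pose F (i : 'I_n) : S := if i \in cr then - 'X_i else 0.
pose Gh (i : 'I_n) : S := if i \in cr then 'X_h else 1.
have prod0 : \prod_i (F i + Gh i) = 0.
  by rewrite (bigD1 h) //= /F /Gh hc addrC subrr mul0r.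
rewrite -[RHS]prod0 (bigA_distr _ +%R) /=.
have termE (J : {set 'I_n}) : \prod_i (if i \in J then F i else Gh i) =
    if J \subset cr then (-1) ^+ #|J| * 'X_h ^+ (#|cr| - #|J|) * 'X_[mesym1 J] else 0.
  case: ifP => sJ; last first.
    have /subsetPn[i iJ ic] := negbT sJ.
    by rewrite (bigD1 i) //= iJ /F (negPf ic) mul0r.
  rewrite (bigID (mem J)) /= (eq_bigr (fun i => - 'X_i)); last first.
    by move=> i iJ; rewrite iJ /F (subsetP sJ).
  rewrite prodrN -!mulrA; congr (_ * _); rewrite mulrC; congr (_ * _).
    rewrite (bigID (mem cr)) /= [X in _ * X]big1 ?mulr1; last first.
      by move=> i /andP[/negPf-> /negPf ic]; rewrite /Gh ic.
    rewrite (eq_bigr (fun=> 'X_h)); last by move=> i /andP[/negPf-> ic]; rewrite /Gh ic.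
    rewrite prodr_const; congr (_ ^+ _).
    have /setIidPr sJ' := sJ; rewrite -(cardsID J cr) sJ' addKn.
    by apply: eq_card => i; rewrite !inE.
  rewrite mprodXE; congr 'X_[_]; apply/mnmP => i; rewrite mnm_sumE mnmE.
  rewrite (eq_bigr (fun j => (j == i) : nat)); last by move=> j _; rewrite mnm1E.
  case: (boolP (i \in J)) => iJ.
    by rewrite (bigD1 i) //= eqxx big1 ?addn0 // => j /andP[_ /negPf->].
  by rewrite big1 // => j jJ; case: eqP => // ji; rewrite -ji jJ in iJ.
under [RHS]eq_bigr do rewrite termE.
rewrite -big_mkcondr /=.
have ltc (J : {set 'I_n}) : (#|J| < n.+1)%N.
  by rewrite ltnS; have := max_card (mem J); rewrite card_ord.
rewrite (partition_big (fun J : {set 'I_n} => Ordinal (ltc J)) xpredT) //=.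
apply: eq_bigr => j _; rewrite /esym mulr_sumr; apply: eq_big => J.
  by rewrite -(inj_eq val_inj).
by move=> /andP[_ /eqP->].
Qed.

End ElementarySymmetric.

(** * Weak sequences on a Stanley-Reisner ring *)

Section StanleyReisner.
Variables (k : fieldType) (n : nat).
Local Notation S := {mpoly k[n]}.
Variables (Sg : 'X_{1..n} -> Prop) (cr : {set 'I_n}).
Hypothesis SgP : forall m m' : 'X_{1..n}, Sg m ->
  (forall i, i \in cr -> (0 < m i)%N -> (0 < m' i)%N) -> Sg m'.
Hypothesis Sg0 : ~ Sg 0%MM.
Implicit Types (p a : S) (m : 'X_{1..n}) (F U : {set 'I_n}) (v : nat -> S).
Local Notation X := (fun h : 'I_n => 'X_h : S).

Definition disB p := exists m, Sg m /\ p = 'X_[m].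
Definition coreB p := disB p \/ exists2 i, i \notin cr & p = 'X_i.

(* Unlike disB, these generators avoid the off-core variables, which are
   therefore visibly regular. *)
Definition redB p := exists m, [/\ Sg m, forall i, i \notin cr -> m i = 0%N & p = 'X_[m]].

Lemma disB_redB p : disB p -> ideal_gen redB p.
Proof.
move=> [m [Sm ->]]; pose m' := [multinom if i \in cr then m i else 0%N | i < n].
have le : (m' <= m)%MM by apply/mnm_lepP => i; rewrite mnmE; case: ifP.
rewrite -(submK le) mpolyXD; have [_ _ PM] := ideal_gen_ideal redB; apply: PM.
apply: ideal_gen_mem; exists m'; split=> // [|i /negPf ic]; last by rewrite mnmE ic.
by apply: SgP Sm _ => i ic; rewrite mnmE ic.
Qed.

Definition Iv v s := ideal_gen (fun p => redB p \/ p \in [seq v j | j <- iota 0 s]).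

Lemma Iv_ideal v s : is_ideal (Iv v s).
Proof. exact: ideal_gen_ideal. Qed.

Lemma Iv0 v p : Iv v 0 p <-> monI Sg p.
Proof.
rewrite -(monIE SgP); split; move: p; apply: ideal_gen_sub.
- exact: ideal_gen_ideal.
- by move=> p [[m [Sm _ ->]]|//]; apply: ideal_gen_mem; exists m.
- exact: ideal_gen_ideal.
- by move=> p /disB_redB; apply: ideal_gen_mono => b; left.
Qed.

Lemma IvS v s p : Iv v s.+1 p <-> exists c, Iv v s (p - c * v s).
Proof.
rewrite -ideal_genU1 /Iv; split; apply: ideal_gen_mono => b.
  case=> [|]; first by left; left.
  rewrite -addn1 iotaD map_cat mem_cat add0n => /orP[h|]; first by left; right.
  by rewrite inE => /eqP ->; right.
case=> [[h|h]|->]; [by left | right | right];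
  by rewrite -addn1 iotaD map_cat mem_cat add0n ?h //= inE eqxx orbT.
Qed.

Lemma Iv_mono v s p : Iv v s p -> Iv v s.+1 p.
Proof. by move=> h; apply/IvS; exists 0; rewrite mul0r subr0. Qed.

Lemma Iv_v v s : Iv v s.+1 (v s).
Proof. by apply/IvS; exists 1; rewrite mul1r subrr; case: (Iv_ideal v s). Qed.

Lemma kills_ext x (f : 'I_n -> S) (J J' : S -> Prop) q :
  (forall p, J p <-> J' p) -> kills x f J q -> kills x f J' q.
Proof.
move=> JJ kx z [hz Jz]; have [|y [hy Jy]] := kx z.
  by split=> // U; apply/JJ.
by exists y; split=> // U; apply/JJ.
Qed.

Lemma kills_big x (f : 'I_n -> S) (J : S -> Prop) q : is_ideal J -> (n < q)%N -> kills x f J q.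
Proof.
move=> iJ nq z [hz _]; exists (fun=> 0); split=> // U; rewrite hz; last first.
  by apply/eqP => Uq; have := max_card (mem U); rewrite card_ord Uq; lia.
rewrite mulr0 /kdiff big1 ?subr0; first by case: iJ.
by move=> g _; rewrite /contract; case: ifP; rewrite ?mulr0.
Qed.

(* A weak sequence stays regular as long as the socle of the quotient, i.e. the
   top Koszul homology, vanishes. *)
Lemma weak_regular v d q0 :
    (forall s a, (s < d)%N -> Iv v s (v s * a) -> forall i, Iv v s ('X_i * a)) ->
    (forall q, (q0 < q)%N -> kills 1 X (monI Sg) q) ->
  forall s, (s <= d)%N -> (q0 + s <= n)%N ->
  (forall q, (q0 + s < q)%N -> kills 1 X (Iv v s) q) /\
  (forall s' a, (s' < s)%N -> Iv v s' (v s' * a) -> Iv v s' a).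
Proof.
move=> wk k0; elim=> [|s IH] sd qn.
  split=> // q; rewrite addn0 => /k0; apply: kills_ext => p; split=> h; exact/(Iv0 v).
have [|kq rg] := IH (ltnW sd); first by lia.
have reg a : Iv v s (v s * a) -> Iv v s a.
  move=> h; have := (kills_top 1 X (Iv_ideal v s)).1 (kq n _) a; rewrite mul1r; apply.
    by lia.
  exact: wk.
split=> [q|s' a]; last first.
  by rewrite ltnS leq_eqVlt => /orP[/eqP->|lt]; [exact: reg | exact: rg].
case: q => [|q]; first by lia.
move=> lt; apply: (@kills_quotient _ _ X (Iv v s) _ (v s)) => //.
- exact: Iv_ideal.
- by move=> a; rewrite IvS.
- by apply: kq; lia.
- by apply: kq; lia.
Qed.

(** Modulo the first i terms, whatever the f_h annihilate is annihilated by v_i, hence by x: this is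
    top homology. Each regular term then lowers the homological degree by one through
    [kills_regular]. *)
Lemma weak_kills x v d i (f : 'I_n -> S) : (i < d)%N -> (i <= n)%N ->
    (forall s a, (s < i)%N -> Iv v s (v s * a) -> Iv v s a) ->
    (forall s a, (s < d)%N -> Iv v s (v s * a) -> Iv v s (x * a)) ->
    (forall s, (s < d)%N -> exists c : 'I_n -> S, v s = \sum_h c h * f h) ->
  kills x f (monI Sg) (n - i).
Proof.
move=> id i_n reg wk vf.
have top : kills x f (Iv v i) n.
  apply/kills_top; first exact: Iv_ideal.
  move=> a fa; apply: wk => //; have [c ->] := vf i id.
  rewrite mulr_suml; apply: ideal_sum; first exact: Iv_ideal.
  by move=> h _; rewrite -mulrA; have [_ _ JM] := Iv_ideal v i; apply: JM.
have : forall j, (j <= i)%N -> kills x f (Iv v (i - j)) (n - j).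
  elim=> [|j IH] ji; first by rewrite !subn0.
  have E : (i - j = (i - j.+1).+1)%N by lia.
  have E' : (n - j = (n - j.+1).+1)%N by lia.
  have := IH (ltnW ji); rewrite E E'; set s := (i - j.+1)%N => kj.
  have [c hc] : exists c : 'I_n -> S, v s = \sum_h c h * f h by apply: vf; lia.
  apply: (@kills_regular _ _ x f (Iv v s) (Iv v s.+1) (v s) c (fun a => a = 1)) => //.
  - exact: Iv_ideal.
  - exact: Iv_ideal.
  - exact: Iv_mono.
  - exact: Iv_v.
  - by move=> a; apply: reg; lia.
  - by move=> a b -> ->; rewrite mulr1.
  - move=> a ->; exists 1, (fun=> 0); rewrite big1 ?subr0 ?mulr1 // => h _.
    by rewrite mul0r.
  by move=> a /IvS[b hb]; exists 1, b; rewrite mul1r.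
move/(_ i (leqnn i)); rewrite subnn; apply: kills_ext => p; exact: Iv0.
Qed.

Definition face F := boolp.asbool (~ Sg (mesym1 F)).

Lemma face0 : face set0 && (set0 \subset cr).
Proof. by rewrite sub0set andbT; apply/boolp.asboolP; rewrite mesym1_set0. Qed.

Definition maxface : {set 'I_n} :=
  [arg max_(F > set0 | face F && (F \subset cr)) #|F|].
(** The Krull dimension of the core; since the off-core variables are free, that of A_dis is
    [dimd]. *)
Definition dc := #|maxface|.

Lemma maxfaceP : [/\ ~ Sg (mesym1 maxface), maxface \subset cr &
  forall F, ~ Sg (mesym1 F) -> F \subset cr -> (#|F| <= dc)%N].
Proof.
rewrite /dc /maxface; case: arg_maxnP; first exact: face0.
move=> F /andP[/boolp.asboolP fF sF] Fmax; split=> // F' fF' sF'.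
by apply: Fmax; rewrite sF' andbT; apply/boolp.asboolP.
Qed.

Local Notation Y := (enum (~: cr)).
Definition dimd := (#|~: cr| + dc)%N.

Lemma Sg_large m : (dc < #|msup m :&: cr|)%N -> Sg m.
Proof.
move=> lt; have [_ _ h] := maxfaceP; apply: boolp.contrapT => nS.
move: lt; rewrite ltnNge => /negP; apply; apply: h; last exact: subsetIr.
move=> S'; apply: nS; apply: SgP S' _ => i ic.
by rewrite mnmE !inE ic andbT; case: (0 < m i)%N.
Qed.

(** A monomial in more than [dimd] variables involves more than [dc] core variables, so it is
    nonstandard. *)
Lemma disB_chain (n0 : S -> Prop) h : prime_chain disB n0 h -> (h <= dimd)%N.
Proof.
apply: prime_chain_dim => P m pP oP lt; apply: oP; exists m; split=> //.
apply: Sg_large; move: lt; rewrite -(cardsID cr (msup m)) /dimd => lt.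
have : (#|msup m :\: cr| <= #|~: cr|)%N by apply: subset_leq_card; rewrite setDE subsetIr.
by move: lt; lia.
Qed.

Lemma coreB_chain (n0 : S -> Prop) h : prime_chain coreB n0 h -> (h <= dc)%N.
Proof.
apply: prime_chain_dim => P m pP oP lt.
case: (boolP (msup m \subset cr)) => [sm|/subsetPn[i im ic]].
  apply: oP; left; exists m; split=> //; apply: Sg_large.
  by have /setIidPl -> := sm.
have le : (U_(i) <= m)%MM by rewrite lep1mP -lt0n; move: im; rewrite inE.
rewrite -(submK le) mpolyXD; have [[_ _ PM] _ _] := pP; apply: PM; apply: oP.
by right; exists i.
Qed.

Lemma maxface_std m : msup m \subset maxface :|: ~: cr -> ~ Sg m.
Proof.
move=> sm Sm; have [nS _ _] := maxfaceP; apply: nS; apply: SgP Sm _ => i ic im.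
have : i \in msup m by rewrite inE.
by move/(subsetP sm); rewrite mnmE !inE ic orbF => ->.
Qed.

Lemma card_maxface_std : #|maxface :|: ~: cr| = dimd.
Proof.
have [_ sF _] := maxfaceP; rewrite cardsU (_ : _ :&: _ = set0) ?cards0 ?subn0 1?addnC //.
by apply/eqP; rewrite setI_eq0 -subsets_disjoint.
Qed.

(** The prime ideal generated by the variables outside V. *)
Definition varker (V : {set 'I_n}) p := {in msupp p, forall m, ~~ (msup m \subset V)}.

Lemma msupD m m' : msup (m + m') = msup m :|: msup m'.
Proof. by apply/setP => i; rewrite !inE mnmDE addn_gt0. Qed.

Lemma mpart_varM (V : {set 'I_n}) p p' :
  mpart (fun m => msup m \subset V) (p * p') =
  mpart (fun m => msup m \subset V) p * mpart (fun m => msup m \subset V) p'.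
Proof.
set Q := (fun m => _).
have E : p' = mpart Q p' + mpart (predC Q) p'.
  by apply/mpolyP => m; rewrite mcoeffD !mcoeff_mpart /=; case: (Q m); rewrite ?addr0 ?add0r.
rewrite {1}E mulrDr mpartD (@mpart_mul _ _ Q Q p (mpart Q p')); last first.
  by move=> m u; rewrite msupp_mpart /Q msupD subUset => /andP[-> _]; rewrite andbT.
rewrite [X in _ + X]mpart_none ?addr0 // => m /msuppM_le /allpairsP[[u w] /= [_ + ->]].
by rewrite msupp_mpart /= /Q msupD subUset => /andP[/negPf-> _]; rewrite andbF.
Qed.

Lemma varkerE V p : varker V p <-> mpart (fun m => msup m \subset V) p = 0.
Proof.
split=> [h|h m mp]; first exact: mpart_none.
apply/negP => sm; have : m \in msupp (mpart (fun m => msup m \subset V) p).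
  by rewrite msupp_mpart sm mp.
by rewrite h msupp0.
Qed.

Lemma varker_prime V : prime_ideal (varker V).
Proof.
split; first split.
- by apply/varkerE; rewrite mpart0.
- by move=> a b /varkerE ha /varkerE hb; apply/varkerE; rewrite mpartD ha hb addr0.
- by move=> a b /varkerE hb; apply/varkerE; rewrite mpart_varM hb mulr0.
- move/varkerE; rewrite mpart_id => [/eqP|m]; first by rewrite oner_eq0.
  rewrite msupp1 inE => /eqP ->; apply/subsetP => i.
  by rewrite inE mnm0E.
- move=> a b /varkerE/eqP; rewrite mpart_varM mulf_eq0 => /orP[] /eqP h; [left | right];
    exact/varkerE.
Qed.

(** Vertices of a largest face are removed from V one at a time, until V is empty and the ideal
    irrelevant. *)
Lemma core_prime_chain : prime_chain coreB (@irrelevant k n) dc.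
Proof.
have [nS sF _] := maxfaceP.
pose V (j : nat) : {set 'I_n} := [set i in drop j (enum maxface)].
have VF j : V j \subset maxface.
  by apply/subsetP => i; rewrite inE => /mem_drop; rewrite mem_enum.
have sz : size (enum maxface) = dc by rewrite -cardE.
exists (fun j : 'I_dc.+1 => varker (V j)); split.
- move=> j; split; first exact: varker_prime.
  move=> p [[m [Sm ->]]|[i ic ->]] m'; rewrite msuppX inE => /eqP->.
    apply/negP => sm; apply: (@maxface_std m) Sm.
    by apply: subset_trans sm _; apply: subset_trans (VF _) _; apply: subsetUl.
  apply/negP => /subsetP/(_ i); rewrite inE mnm1E eqxx => /(_ isT).
  by move/(subsetP (VF _))/(subsetP sF); rewrite (negPf ic).
- move=> p; have -> : V (ord_max : 'I_dc.+1) = set0.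
    by apply/setP => i; rewrite !inE /= drop_oversize ?sz.
  have E m : (msup m \subset set0) = (m == 0%MM).
    apply/idP/eqP => [/subsetP h|->]; last by apply/subsetP => i; rewrite inE mnm0E.
    apply/mnmP => i; rewrite mnm0E; apply/eqP; rewrite eqn0Ngt; apply/negP => mi.
    by have := h i; rewrite !inE mi => /(_ isT).
  split=> [h|p0 m mp].
    by apply: memN_msupp_eq0; apply/negP => /h; rewrite E eqxx.
  by rewrite E; apply/eqP => m0; move: mp; rewrite m0 mcoeff_msupp p0 eqxx.
move=> i j ij; have Vij : V j \subset V i.
  apply/subsetP => x; rewrite !inE; have -> : drop j (enum maxface) = drop (j - i) (drop i (enum maxface)).
    by rewrite drop_drop subnK // ltnW.
  exact: mem_drop.
split=> [p h m /h|].
  by apply: contra => sm; apply: subset_trans sm Vij.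
have lti : (i < size (enum maxface))%N by rewrite sz; have := ltn_ord j; lia.
have [x0 _] : exists x, x \in maxface.
  have : (0 < #|maxface|)%N by rewrite -/dc -sz; lia.
  by move/card_gt0P.
pose x := nth x0 (enum maxface) i; exists 'X_x; split.
  move=> m; rewrite msuppX inE => /eqP->; apply/negP => /subsetP/(_ x).
  rewrite !inE mnm1E eqxx => /(_ isT) xd.
  have : x \in take j (enum maxface).
    have jle : (j <= size (enum maxface))%N by rewrite sz -ltnS ltn_ord.
    by rewrite /x -(nth_take x0 ij); apply: mem_nth; rewrite size_takel.
  move=> xt; have := enum_uniq (mem maxface); rewrite -(cat_take_drop j (enum maxface)) cat_uniq.
  by case/and3P => _ /hasPn/(_ _ xd) /negP.
move=> /(_ U_(x)%MM); rewrite msuppX inE eqxx => /(_ isT) /negP; apply.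
apply/subsetP => y; rewrite !inE mnm1E; case: eqP => // <- _.
by rewrite (drop_nth x0) // mem_head.
Qed.

End StanleyReisner.

(** * The Buchsbaum core *)

Section BuchsbaumCore.
Variables (k : fieldType) (n : nat).
Local Notation S := {mpoly k[n]}.
Variables (Sg : 'X_{1..n} -> Prop) (cr : {set 'I_n}).
Hypothesis SgP : forall m m' : 'X_{1..n}, Sg m ->
  (forall i, i \in cr -> (0 < m i)%N -> (0 < m' i)%N) -> Sg m'.
Hypothesis Sg0 : ~ Sg 0%MM.
Hypothesis HB : Buchsbaum (@coreB k n Sg cr).
Implicit Types (p a : S) (m : 'X_{1..n}) (y h : 'I_n) (D : nat -> nat).
Local Notation X := (fun h : 'I_n => 'X_h : S).
Local Notation dc := (dc Sg cr).
Local Notation dimd := (dimd Sg cr).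
Local Notation r := #|~: cr|.
Local Notation coreB := (@coreB k n Sg cr).
Local Notation disB := (@disB k n Sg).
Local Notation redB := (@redB k n Sg cr).
Local Notation Iv := (Iv Sg cr).

(** The exponents are left free: squares serve to bound the homology, and at a maximal ideal they
    come from algebraic equations satisfied there. *)
Definition theta D j : S := esym k cr j.+1 ^+ D j.
Definition thetaI D (j : 'I_dc) : S := theta D j.

Lemma vfree_exp y p e : vfree y p -> vfree y (p ^+ e).
Proof.
move=> hp; elim: e => [|e IH] m.
  by rewrite expr0 msupp1 inE => /eqP->; rewrite mnm0E.
rewrite exprS => /msuppM_le /allpairsP[[u v] /= [/hp up /IH vp ->]].
by rewrite mnmDE up vp.
Qed.

Lemma vfree_theta D j y : y \notin cr -> vfree y (theta D j).
Proof. by move=> yc; apply: vfree_exp; apply: vfree_esym. Qed.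

Lemma vfree_var y y' : y' != y -> vfree y ('X_y' : S).
Proof. by move=> ne m; rewrite msuppX inE => /eqP->; rewrite mnm1E (negPf ne). Qed.

Lemma vfree_redB y p : y \notin cr -> redB p -> vfree y p.
Proof. by move=> yc [m [_ h ->]] m'; rewrite msuppX inE => /eqP->; apply: h. Qed.

Lemma mdeg_exp p e d : {in msupp p, forall m, mdeg m = d} ->
  {in msupp (p ^+ e), forall m, mdeg m = (d * e)%N}.
Proof.
move=> hp; elim: e => [|e IH] m.
  by rewrite expr0 msupp1 inE => /eqP->; rewrite mdeg0 muln0.
rewrite exprS => /msuppM_le /allpairsP[[u v] /= [/hp up /IH vp ->]].
by rewrite mdegD up vp mulnS.
Qed.

Lemma mdeg_theta D j : {in msupp (theta D j), forall m, mdeg m = (j.+1 * D j)%N}.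
Proof. by apply: mdeg_exp => m; apply: mdeg_esym. Qed.

Lemma hgens_coreB D i : hgens (gens coreB (thetaI D) i).
Proof.
move=> p [[[m [_ ->]]|[y _ ->]]|[j [_ ->]]].
- by exists (mdeg m) => m'; rewrite msuppX inE => /eqP->.
- by exists (mdeg U_(y)) => m'; rewrite msuppX inE => /eqP->.
- by eexists; apply: mdeg_theta.
Qed.

Lemma over_irrelevant : over coreB (@irrelevant k n).
Proof.
move=> p [[m [Sm ->]]|[y _ ->]]; rewrite /irrelevant mcoeffX; case: eqP => //.
  by move=> m0; case: Sg0; rewrite -m0.
by move/eqP; rewrite mnm1_eq0.
Qed.

(** Symmetric polynomials of degree above [dc] consist of nonfaces, so P contains all those of
    positive degree; [esym_relation] then puts a power of each core variable in P. *)
Lemma prime_of_theta D (P : S -> Prop) : (forall j, 0 < D j)%N -> prime_ideal P ->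
  over coreB P -> (forall j, (j < dc)%N -> P (theta D j)) -> forall h, P 'X_h.
Proof.
move=> D0 pP oP tP h; have [iP P1 _] := pP; have [_ _ PM] := iP.
case: (boolP (h \in cr)) => [hc|hc]; last by apply: oP; right; exists h.
have Pe j : P (esym k cr j.+1).
  case: (ltnP j dc) => jd; first exact: prime_idealX pP (tP j jd).
  apply: ideal_sum => // F /andP[sF /eqP Fj]; apply: oP; left.
  exists (mesym1 F); split=> //; apply: boolp.contrapT => nS.
  have [_ _ /(_ F nS sF)] := maxfaceP cr Sg0; rewrite Fj -/(dc) => le.
  by have := leq_trans le jd; rewrite ltnn.
have := esym_relation k hc; rewrite big_ord_recl /= expr0 mul1r subn0 esym0 mulr1.
move/eqP; rewrite addr_eq0 => /eqP rel.
apply: (prime_idealX pP (m := #|cr|)); rewrite rel; apply: idealN => //.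
by apply: ideal_sum => // j _; apply: PM; apply: Pe.
Qed.

Lemma theta_sop D : (forall j, 0 < D j)%N ->
  loc_sop coreB (@irrelevant k n) (thetaI D).
Proof.
move=> D0; split.
- by split; [exact: core_prime_chain SgP Sg0 | exact: coreB_chain SgP Sg0 _].
- move=> j; apply: memN_msupp_eq0; apply/negP => /mdeg_theta; rewrite mdeg0.
  by have := D0 j; case: (D j).
move=> P pP oP _ a a0; have [v ->] := irrelevant_gen a0.
have [iP _ _] := pP; have [_ _ PM] := iP; apply: ideal_sum => // h _; apply: PM.
apply: (prime_of_theta D0) => //.
  by move=> b hb; apply: oP; left.
by move=> j jd; apply: oP; right; exists (Ordinal jd).
Qed.

(** The Buchsbaum property at the irrelevant ideal, freed of denominators because all generators are
    homogeneous. *)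
Lemma theta_weak D i a : (forall j, 0 < D j)%N -> (i < dc)%N ->
  ideal_gen (gens coreB (thetaI D) i) (theta D i * a) ->
  forall p, irrelevant p -> ideal_gen (gens coreB (thetaI D) i) (p * a).
Proof.
move=> D0 id ha p p0.
have mI := irrelevant_maximal k n; have pI := maximal_prime mI.
have [h [[hc hmax] weak]] := HB mI over_irrelevant.
have hE : h = dc.
  apply/eqP; rewrite eqn_leq (coreB_chain SgP Sg0 hc) hmax //.
  exact: core_prime_chain SgP Sg0.
move: weak {hmax hc}; rewrite {}hE => /(_ _ (theta_sop D0) (Ordinal id) a) weak.
apply: locmem_irrelevant; first exact: hgens_coreB.
by apply: weak => //; apply: locmem_gen.
Qed.

Definition noncore : seq 'I_n := enum (~: cr).
(** Off-core variables come first: killing them turns A_dis into its core, where the weak-sequence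
    property is available. *)
Definition core_seq D s : S := if (s < r)%N then nth 0 [seq 'X_y | y <- noncore] s else theta D (s - r).

Lemma size_noncore : size noncore = r. Proof. by rewrite -cardE. Qed.

Lemma core_seq_var D s : (s < r)%N -> exists y, [/\ y \notin cr, core_seq D s = 'X_y &
  forall j, (j < s)%N -> exists2 y', y' != y & core_seq D j = 'X_y'].
Proof.
move=> sr; have y0 : 'I_n by have := sr; rewrite -size_noncore; case: noncore => // y0.
have nthE j : (j < r)%N -> core_seq D j = 'X_(nth y0 noncore j).
  by move=> jr; rewrite /core_seq jr (nth_map y0) // size_noncore.
exists (nth y0 noncore s); split; [|exact: nthE|].
  have : nth y0 noncore s \in noncore by apply: mem_nth; rewrite size_noncore.
  by rewrite mem_enum inE.
move=> j js; have jr := ltn_trans js sr; exists (nth y0 noncore j); last exact: nthE.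
by rewrite nth_uniq ?enum_uniq ?size_noncore // neq_ltn js.
Qed.

Lemma Iv_coreB D i p : (i <= dc)%N ->
  Iv (core_seq D) (r + i) p <-> ideal_gen (gens coreB (thetaI D) i) p.
Proof.
move=> idc; split; move: p; apply: ideal_gen_sub; try exact: ideal_gen_ideal.
  move=> p [[m [Sm _ ->]]|/mapP[j]].
    by apply: ideal_gen_mem; left; left; exists m.
  rewrite mem_iota add0n => /= jri ->; case: (ltnP j r) => jr.
    have [y [yc -> _]] := core_seq_var D jr.
    by apply: ideal_gen_mem; left; right; exists y.
  have ji : (j - r < i)%N by move: jri jr; move: #|~: cr| => r0; lia.
  apply: ideal_gen_mem; right; exists (Ordinal (leq_trans ji idc)); split=> //.
  by rewrite /core_seq ltnNge jr.
move=> p [[/(disB_redB SgP)|[y yc ->]]|[j [ji ->]]].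
- by apply: ideal_gen_mono => b; left.
- apply: ideal_gen_mem; right; apply/mapP; exists (index y noncore).
    rewrite mem_iota add0n /=; apply: leq_trans (leq_addr _ _).
    by rewrite -size_noncore index_mem mem_enum inE.
  have lt : (index y noncore < size noncore)%N by rewrite index_mem mem_enum inE.
  by rewrite /core_seq -size_noncore lt (nth_map y) // nth_index // mem_enum inE.
- apply: ideal_gen_mem; right; apply/mapP; exists (r + j)%N.
    by rewrite mem_iota add0n /= ltn_add2l.
  by rewrite /core_seq ltnNge leq_addr /= addKn.
Qed.

Lemma core_seq_weak D s a : (forall j, 0 < D j)%N -> (s < dimd)%N ->
  Iv (core_seq D) s (core_seq D s * a) -> forall i, Iv (core_seq D) s ('X_i * a).
Proof.
move=> D0 sd ha i; case: (ltnP s r) => sr.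
  have [y [yc vy vlt]] := core_seq_var D sr.
  have [_ _ JM] := Iv_ideal Sg cr (core_seq D) s; apply: JM.
  apply: (@var_regular _ _ _ y); last by move: ha; rewrite vy.
  move=> p [|/mapP[j]]; first exact: vfree_redB.
  rewrite mem_iota add0n => /= /vlt[y' ne ->] ->; exact: vfree_var.
have idc : (s - r < dc)%N by move: sd; rewrite /dimd; lia.
have sE : (r + (s - r))%N = s by lia.
have := @Iv_coreB D (s - r) _ (ltnW idc); rewrite sE => E; apply/E.
apply: (theta_weak D0 idc); first by apply/E; move: ha; rewrite /core_seq ltnNge sr.
by rewrite /irrelevant mcoeffX; case: eqP => // /eqP; rewrite mnm1_eq0.
Qed.

(** A monomial of degree at least two is divisible by X_g^2 or by another variable. *)
Lemma squared_gen (g : 'I_n) p : {in msupp p, forall m, (1 < mdeg m)%N} ->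
  exists c : 'I_n -> S, p = \sum_h c h * squared k g h.
Proof.
move=> hp; rewrite (mpolyE p) big_seq.
elim/big_ind: _ => [|_ _ [v ->] [v' ->]|m mp].
- by exists (fun=> 0); rewrite big1 // => h _; rewrite mul0r.
- exists (fun h => v h + v' h); rewrite -big_split.
  by apply: eq_bigr => h _; rewrite mulrDl.
have one h u : (u <= m)%MM -> squared k g h = 'X_[u] ->
    exists c : 'I_n -> S, p@_m *: 'X_[m] = \sum_h c h * squared k g h.
  move=> um hu; exists (fun i => if i == h then p@_m *: 'X_[m - u] else 0).
  rewrite (bigD1 h) //= eqxx big1 => [|i /negPf->]; last by rewrite mul0r.
  by rewrite addr0 hu -scalerAl -mpolyXD submK.
case: (boolp.EM (exists2 h, h != g & m h != 0%N)) => [[h hg mh]|nex].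
  by apply: (one h U_(h)%MM); rewrite ?lep1mP // /squared (negPf hg).
apply: (one g (U_(g) *+ 2)%MM); last by rewrite /squared eqxx mpolyXn.
apply/mnm_lepP => i; rewrite mulmnE mnm1E; case: eqP => // <-; rewrite mul1n.
have := hp m mp; rewrite mdegE (bigD1 g) //= big1 ?addn0 // => j jg.
by apply/eqP; apply: boolp.contrapT => /negP mj; apply: nex; exists j.
Qed.

(** This dictates the exponent two: it brings even the linear symmetric polynomial within reach of
    [squared_gen]. The off-core variables differ from X_g. *)
Lemma core_seq_squared (g : 'I_n) s : g \in cr -> (s < dimd)%N ->
  exists c : 'I_n -> S, core_seq (fun=> 2) s = \sum_h c h * squared k g h.
Proof.
move=> gc sd; case: (ltnP s r) => sr.
  have [y [yc -> _]] := core_seq_var (fun=> 2) sr.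
  exists (fun h => if h == y then 1 else 0); rewrite (bigD1 y) //= eqxx big1.
    by rewrite addr0 mul1r /squared; case: eqP => // yg; rewrite yg gc in yc.
  by move=> h /negPf->; rewrite mul0r.
apply: squared_gen => m; rewrite /core_seq ltnNge sr /= => /mdeg_theta ->.
by rewrite mulnC mulnS.
Qed.

(* The homology of A_dis can only be nonzero, in the first degree where it is
   so, in multidegree 1_core, where the hypothesis Hdeg takes over. *)
Lemma main_kills :
    (forall q z, (n < q + dimd)%N -> kcycle X (monI Sg) q z ->
       csupp (pred1 (mesym1 cr)) z -> kills 1 X (monI Sg) q.+1 ->
       kbound X (monI Sg) q z) ->
  forall q, (n < q + dimd)%N -> kills 1 X (monI Sg) q.
Proof.
move=> Hdeg q; have iJ := monI_ideal k SgP.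
move E: (n.+1 - q)%N => N; elim/ltn_ind: N q E => N IH q E nq.
case: (leqP q n) => qn; last exact: kills_big.
have k1 q' : (q < q')%N -> kills 1 X (monI Sg) q'.
  by move=> qq'; apply: (IH (n.+1 - q')%N _ q' erefl); lia.
have Dpos (j : nat) : (0 < 2)%N by [].
have idim : (n - q < dimd)%N by lia.
(* Vanishing above q makes the first n - q terms regular. The next term is only known to be weak,
   which still gives that X_g kills the homology H_q of the squared sequence. *)
have [||_ reg] := @weak_regular k n Sg cr SgP (core_seq (fun=> 2)) dimd q _ k1 (n - q) (ltnW idim).
- by move=> s a; apply: core_seq_weak.
- by lia.
have ksq g : g \in cr -> kills 'X_g (squared k g) (monI Sg) q.
  move=> gc; have := @weak_kills k n Sg cr SgP 'X_g (core_seq (fun=> 2)) dimd (n - q) (squared k g) idim.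
  rewrite subKn //; apply; first by rewrite leq_subr.
  - exact: reg.
  - by move=> s a sd ha; apply: core_seq_weak.
  - by move=> s; apply: core_seq_squared.
move=> z cz.
suff bz : kbound X (monI Sg) q z.
  by apply: (kbound_congr iJ _ bz) => U; rewrite mul1r subrr; case: iJ.
apply: (kbound_parts SgP) => b.
have cb := kcycle_cpart (pred1 b) cz; have sb := @csupp_cpart _ _ (pred1 b) z.
(* Three cases: b exceeds 1_core somewhere, b vanishes at some core vertex, or b = 1_core. *)
case: (boolp.EM (exists h, ((h \in cr) ==> (1 < b h)%N) && (0 < b h)%N)) => [[h hb]|nlarge].
  by apply: (kbound_large SgP cb (h := h)) => U m /sb /eqP->.
case: (boolp.EM (exists2 g, g \in cr & b g = 0%N)) => [[g gc bg]|nzero].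
  apply: (kbound_squared SgP cb (g := g)); last exact: k1.
    by move=> U m /sb /eqP->; rewrite bg.
  exact: ksq.
apply: Hdeg => //; last exact: k1.
move=> U m /sb /eqP->; apply/eqP/mnmP => i; rewrite mnmE.
case: (boolP (i \in cr)) => ic /=.
  apply/eqP; rewrite eqn_leq; apply/andP; split.
    by rewrite leqNgt; apply/negP => lt; apply: nlarge; exists i; rewrite ic lt ltnW.
  by rewrite lt0n; apply/eqP => b0; apply: nzero; exists i.
apply/eqP; rewrite eqn0Ngt; apply/negP => lt; apply: nlarge; exists i.
by rewrite (negPf ic) lt.
Qed.

(** * From vanishing homology to regular sequences at every maximal ideal *)

Section Final.
Hypothesis kdis : forall q, (n < q + dimd)%N -> kills 1 X (monI Sg) q.

Lemma dimd_le : (dimd <= n)%N.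
Proof. by rewrite -(card_maxface_std cr Sg0) -[X in (_ <= X)%N](card_ord n) max_card. Qed.

Lemma theta_regular_core D i a : (forall j, 0 < D j)%N -> (i < dc)%N ->
  Iv (core_seq D) (r + i) (theta D i * a) -> Iv (core_seq D) (r + i) a.
Proof.
move=> D0 idc; have dn := dimd_le.
have [|||_ reg] := @weak_regular k n Sg cr SgP (core_seq D) dimd (n - dimd) _ _ dimd (leqnn _).
- by move=> s b; apply: core_seq_weak.
- by move=> q lt; apply: kdis; lia.
- by lia.
have /reg : (r + i < dimd)%N by rewrite /dimd ltn_add2l.
by move=> /(_ a); rewrite {2}/core_seq ltnNge leq_addr /= addKn.
Qed.

Lemma regular_remove_vars (P : S -> Prop) g (ys : seq 'I_n) : uniq ys ->
    (forall y, y \in ys -> (forall b, P b -> vfree y b) /\ vfree y g) ->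
    (forall a, ideal_gen (fun b => P b \/ b \in [seq 'X_y | y <- ys]) (g * a) ->
       ideal_gen (fun b => P b \/ b \in [seq 'X_y | y <- ys]) a) ->
  forall a, ideal_gen P (g * a) -> ideal_gen P a.
Proof.
elim: ys => [_ _ reg a|y ys IH /= /andP[yys uys] fr reg].
  move=> h; have /reg : ideal_gen (fun b => P b \/ b \in [seq 'X_y | y <- [::]]) (g * a).
    by apply: ideal_gen_mono h => b; left.
  by apply: ideal_gen_mono => b [].
apply: IH => // [y' y'ys|]; first by apply: fr; rewrite inE y'ys orbT.
have [fP fg] := fr y (mem_head _ _).
apply: (@regular_remove_var _ _ _ y) => // [b [/fP//|/mapP[y' y'ys ->]]|a].
  by apply: vfree_var; apply: contraNneq yys => <-.
have eqv b0 : ideal_gen (fun b => (P b \/ b \in [seq 'X_y | y <- ys]) \/ b = 'X_y) b0 <->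
    ideal_gen (fun b => P b \/ b \in 'X_y :: [seq 'X_y | y <- ys]) b0.
  split; apply: ideal_gen_mono => b.
    by case=> [[h|h]|->]; [left | right; rewrite inE h orbT | right; rewrite mem_head].
  by case=> [h|]; [left; left | rewrite inE => /orP[/eqP|h]; [right | left; right]].
by rewrite !eqv; apply: reg.
Qed.

(** The order is opposite to that of [core_seq]: placed last, the off-core powers are visibly
    regular, no earlier term involving their variable. *)
Definition top_seq D (E : 'I_n -> nat) s : S := if (s < dc)%N then theta D s
  else nth 0 [seq 'X_y ^+ E y | y <- noncore] (s - dc).

Lemma top_seq_var D E s : (dc <= s)%N -> (s < dimd)%N -> exists y, [/\ y \notin cr,
  top_seq D E s = 'X_y ^+ E y & forall j, (j < s)%N -> vfree y (top_seq D E j)].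
Proof.
move=> ds sd; have sr : (s - dc < r)%N by move: sd; rewrite /dimd; lia.
have y0 : 'I_n by have := sr; rewrite -size_noncore; case: noncore => // y0.
have nthE j : (dc <= j)%N -> (j < dimd)%N -> top_seq D E j = 'X_(nth y0 noncore (j - dc)) ^+ E (nth y0 noncore (j - dc)).
  move=> dj jd; rewrite /top_seq ltnNge dj (nth_map y0) // size_noncore.
  by move: jd; rewrite /dimd; lia.
have inY j : (j < r)%N -> nth y0 noncore j \notin cr.
  move=> jr; have : nth y0 noncore j \in noncore by apply: mem_nth; rewrite size_noncore.
  by rewrite mem_enum inE.
exists (nth y0 noncore (s - dc)); split; [exact: inY | exact: nthE |].
move=> j js; case: (ltnP j dc) => jd.
  by rewrite /top_seq jd; apply: vfree_theta; apply: inY.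
have jdim := ltn_trans js sd.
rewrite nthE //; apply: vfree_exp; apply: vfree_var.
have jr : (j - dc < r)%N by move: jdim; rewrite /dimd; lia.
by rewrite nth_uniq ?enum_uniq ?size_noncore //; apply/eqP; lia.
Qed.

(** For the symmetric part, regularity is known modulo the off-core variables. These occur in none
    of the generators involved and can be removed again. *)
Lemma top_seq_regular D E s a : (forall j, 0 < D j)%N -> (s < dimd)%N ->
  Iv (top_seq D E) s (top_seq D E s * a) -> Iv (top_seq D E) s a.
Proof.
move=> D0 sd; case: (ltnP s dc) => sdc; last first.
  have [y [yc -> free]] := top_seq_var D E sdc sd.
  elim: (E y) => [|e IH]; first by rewrite expr0 mul1r.
  rewrite exprS -mulrA => /var_regular h; apply: IH; apply: h.
  move=> p [|/mapP[j]]; first exact: vfree_redB.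
  by rewrite mem_iota add0n => /= /free h ->.
apply: (@regular_remove_vars _ _ noncore); first exact: enum_uniq.
  move=> y; rewrite mem_enum inE => yc; split; last by rewrite /top_seq sdc; apply: vfree_theta.
  move=> b [|/mapP[j]]; first exact: vfree_redB.
  rewrite mem_iota add0n => /= js ->; rewrite /top_seq (ltn_trans js sdc).
  exact: vfree_theta.
have eqv b0 : ideal_gen (fun b => (redB b \/ b \in [seq top_seq D E j | j <- iota 0 s]) \/
     b \in [seq 'X_y | y <- noncore]) b0 <-> Iv (core_seq D) (r + s) b0.
  rewrite /Iv; split; apply: ideal_gen_mono => b.
    case=> [[h|/mapP[j]]|/mapP[y yY ->]]; first by left.
      rewrite mem_iota add0n => /= js ->; right; apply/mapP; exists (r + j)%N.
        by rewrite mem_iota add0n /= ltn_add2l.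
      by rewrite /top_seq (ltn_trans js sdc) /core_seq ltnNge leq_addr /= addKn.
    have lt : (index y noncore < r)%N by rewrite -size_noncore index_mem.
    right; apply/mapP; exists (index y noncore).
      by rewrite mem_iota add0n /=; apply: leq_trans (leq_addr _ _).
    by rewrite /core_seq lt (nth_map y) ?nth_index // size_noncore.
  case=> [h|/mapP[j]]; first by left; left.
  rewrite mem_iota add0n => /= jrs ->; case: (ltnP j r) => jr.
    by right; rewrite /core_seq jr; apply: mem_nth; rewrite size_map size_noncore.
  have lt : (j - r < s)%N by move: jrs jr; move: #|~: cr| => r0; lia.
  left; right; apply/mapP; exists (j - r)%N; first by rewrite mem_iota.
  by rewrite /core_seq ltnNge jr /top_seq (ltn_trans lt sdc).
move=> b; rewrite !eqv {1}/top_seq sdc; exact: theta_regular_core.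
Qed.

(** Trailing zero coefficients are discarded; the degree is positive because [nn] contains no
    nonzero constant. *)
Lemma zariski_top (nn : S -> Prop) p : maximal_ideal nn ->
  exists D : nat, exists c : nat -> k, [/\ (0 < D)%N, c D != 0 & nn (\sum_(i < D.+1) c i *: p ^+ i)].
Proof.
move=> mn; have [N [l [[i0 li0] hl]]] := zariski mn p.
have [[_ _ nM] n1 _] := mn.
pose c (i : nat) := if insub i is Some j then l j else 0.
have cE (i : 'I_N.+1) : c i = l i by rewrite /c valK.
have cbig i : (N < i)%N -> c i = 0.
  by move=> Ni; rewrite /c insubN // -leqNgt.
have ex : exists i, c i != 0 by exists (i0 : nat); rewrite cE.
have ub i : c i != 0 -> (i <= N)%N by move=> ci; rewrite leqNgt; apply/negP => /cbig /eqP; rewrite (negPf ci).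
case: (ex_maxnP ex ub) => D cD Dmax.
have nD : nn (\sum_(i < D.+1) c i *: p ^+ i).
  move: hl; under eq_bigr do rewrite -cE.
  rewrite -(big_mkord xpredT (fun i => c i *: p ^+ i)).
  have DN : (D.+1 <= N.+1)%N by rewrite ltnS; apply: ub.
  rewrite (big_cat_nat (leq0n _) DN) /= big_mkord [X in _ + X]big_nat [X in _ + X]big1 ?addr0 //.
  move=> i /andP[Di _]; have [->|ci] := eqVneq (c i) 0; first by rewrite scale0r.
  by have := Dmax i ci; rewrite leqNgt Di.
exists D, c; split=> //; rewrite lt0n; apply/eqP => D0; apply: n1.
move: nD cD; rewrite D0 big_ord1 expr0 => h c0.
by have := nM (c 0%N)^-1%:MP _ h; rewrite mul_mpolyC scalerA mulVf // scale1r.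
Qed.

Lemma poly_top p e (D : nat) (c : nat -> k) : {in msupp p, forall m, mdeg m = e} -> (0 < e)%N ->
  (msize (\sum_(i < D.+1) c i *: p ^+ i) <= (e * D).+1)%N /\
  mpart (fun m => mdeg m == (e * D)%N) (\sum_(i < D.+1) c i *: p ^+ i) = c D *: p ^+ D.
Proof.
move=> hp e0.
have lowS i : {in msupp (c i *: p ^+ i), forall m, mdeg m = (e * i)%N}.
  by move=> m /msuppZ_le; apply: mdeg_exp.
split.
  apply/msize_partP => m /msupp_sum_le /flattenP[s /mapP[i _ ->]] /lowS ->.
  by rewrite ltnS leq_mul2l -ltnS ltn_ord orbT.
rewrite mpart_sum big_ord_recr /= big1 ?add0r => [|i _].
  by apply: mpart_id => m /lowS ->.
apply: mpart_none => m /lowS ->; rewrite eqn_pmul2l //.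
by rewrite neq_ltn ltn_ord.
Qed.

Theorem dis_CohenMacaulay : CohenMacaulay disB.
Proof.
move=> nn mn on; have pn := maximal_prime mn.
have /boolp.choice[D /boolp.choice[c hc]] := fun j : nat => zariski_top (esym k cr j.+1) mn.
have /fin_all_exists[E /fin_all_exists[e he]] := fun y : 'I_n => zariski_top 'X_y mn.
have D0 j : (0 < D j)%N by case: (hc j).
pose fth j : S := \sum_(i < (D j).+1) c j i *: esym k cr j.+1 ^+ i.
pose fy y : S := \sum_(i < (E y).+1) e y i *: 'X_y ^+ i.
pose ws s : S := if (s < dc)%N then fth s else nth 0 [seq fy y | y <- noncore] (s - dc).
have wsP s : (s < dimd)%N -> nn (ws s) /\ exists e0 (c0 : k), [/\ c0 != 0,
   (msize (ws s) <= e0.+1)%N & mpart (fun m => mdeg m == e0) (ws s) = c0 *: top_seq D E s].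
  move=> sd; rewrite /ws /top_seq; case: ifP => sdc.
    have [_ c0 nf] := hc s; split=> //; exists (s.+1 * D s)%N, (c s (D s)).
    have [|h1 h2] := @poly_top (esym k cr s.+1) s.+1 (D s) (c s) _ (ltn0Sn _); last by split.
    by move=> m; apply: mdeg_esym.
  have sr : (s - dc < r)%N by move: sd; rewrite /dimd; lia.
  have y0 : 'I_n by have := sr; rewrite -size_noncore; case: noncore => // y0.
  rewrite !(nth_map y0) ?size_noncore //; set y := nth y0 _ _.
  have [_ c0 nf] := he y; split=> //; exists (1 * E y)%N, (e y (E y)).
  have [|h1 h2] := @poly_top 'X_y 1 (E y) (e y) _ isT; last by split.
  by move=> m; rewrite msuppX inE => /eqP->; rewrite mdeg1.
(* Regularity and the ideal of top forms are propagated together, starting from the monomial ideal,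
   which is its own ideal of top forms. *)
have main s : (s <= dimd)%N -> [/\ hclosed (Iv (top_seq D E) s),
    top_sub (Iv ws s) (Iv (top_seq D E) s), top_sup (Iv ws s) (Iv (top_seq D E) s) &
    forall s' a, (s' < s)%N -> Iv ws s' (ws s' * a) -> Iv ws s' a].
  elim: s => [|s IH] sd.
    have hcl : hclosed (Iv (top_seq D E) 0).
      move=> e0 a /(Iv0 SgP) h; apply/(Iv0 SgP); exact: monI_mpart.
    have [h1 h2] := top_init hcl.
    by split.
  have [hcl h1 h2 h3] := IH (ltnW sd).
  have [_ [e0 [c0 [c0N szw topw]]]] := wsP s sd.
  have [h4 h5 h6 h7] := top_step (Iv_ideal _ _ _ _) (Iv_ideal _ _ _ _) hcl h1 h2 c0N szw topw
     (fun a => @top_seq_regular D E s a D0 sd) (IvS _ _ _ _) (IvS _ _ _ _).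
  split=> // s' a; rewrite ltnS leq_eqVlt => /orP[/eqP->|]; [exact: h4 | exact: h3].
have [_ _ _ reg] := main dimd (leqnn _).
pose x (j : 'I_dimd) := ws j.
have eqv i p : (i <= dimd)%N -> ideal_gen (gens disB x i) p <-> Iv ws i p.
  move=> id; split; move: p; apply: ideal_gen_sub; try exact: ideal_gen_ideal.
    move=> p [/(disB_redB SgP)|[j [ji ->]]]; first by apply: ideal_gen_mono => b; left.
    by apply: ideal_gen_mem; right; apply: map_f; rewrite mem_iota add0n.
  move=> p [[m [Sm _ ->]]|/mapP[j]]; first by apply: ideal_gen_mem; left; exists m.
  rewrite mem_iota add0n => /= ji ->; apply: ideal_gen_mem; right.
  by exists (Ordinal (leq_trans ji id)).
have xreg : loc_regular disB nn x.
  split=> [j|i a [s [ns hs]]]; first by case: (wsP j (ltn_ord j)).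
  exists s; split=> //; apply/eqv; first exact: ltnW.
  apply: (reg _ _ (ltn_ord i)); rewrite mulrCA; apply/eqv => //; exact: ltnW.
exists dimd; split; last by exists x.
(* The height is at least [dimd] by the regular sequence and at most [dimd] by counting. *)
split; last by move=> h'; apply: disB_chain.
apply: (regular_chain_below pn xreg pn) => //.
by apply: gens_over => // j; case: xreg.
Qed.

End Final.
End BuchsbaumCore.

Theorem theorem5p5 (k : fieldType) (A : comAlgType k)
    (d : Order.disp_t) (H : finPOrderType d) (emb : H -> A)
    (Sigma : monom H -> Prop) (G : nat -> A -> Prop) :
  hodge_algebra emb Sigma ->
  graded_hodge emb G ->
  square_free Sigma ->
  CohenMacaulay (fun _ : A => False) ->
  Buchsbaum (core_gens k Sigma) ->
  CohenMacaulay (dis_gens k Sigma).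
Proof.
move=> hA hG hsq hCM; rewrite core_gensE dis_gensE => hB.
have [dg hdg] := degrees hG.
have dg_gt0 (i : 'I_#|H|) : (0 < dg (enum_val i))%N by case: (hdg (enum_val i)).
pose evm : {rmorphism {mpoly k[#|H|]} -> A} := hodge_ev emb.
have str := straighten hA hG hsq hdg.
have free := std_free hA.
have SP := nonstd_core hA hsq; have S0 := nonstd0 hA hsq.
have [h [hF hk]] := @cohen_macaulay_kills k #|H| A (nonstd Sigma) evm _ _
  (hodge_evZ emb) dg_gt0 str free (hodge_ev_surj hA) S0 hCM.
apply: (dis_CohenMacaulay SP S0 hB); apply: (main_kills SP S0 hB) => q z nq cz sz k1.
apply: (kbound_degeneration SP dg_gt0 str free (hodge_ev_surj hA) cz sz k1).
(* A largest face enlarged by the off-core variables carries only standard monomials, so dimd <= h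
   and q is in the range where the homology of A vanishes. *)
apply: hk; have := hF _ (@maxface_std _ _ _ SP S0); rewrite (card_maxface_std _ S0).
by move: nq; lia.
Qed.
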